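(* Let $(\Gamma,G,\Lambda)$ be a splitting crystal triple in $\mathbb{R}^d$ with fundamental domain $P$, let $a\in\mathbb{R}^{d\times d}$ be a $\Gamma$-admissible matrix, and let $p$ be a positive integer. Assume that $f:\mathbb{R}^d\to\mathbb{C}$ is integrable, compactly supported and satisfies the refinement equation $f(x)=\sum_{\gamma\in\Gamma'}d_\gamma f(\gamma^{-1}(ax))$ for some finite $\Gamma'\subset\Gamma$ and $d_\gamma\in\mathbb{C}$ (put $d_\gamma=0$ for $\gamma\notin\Gamma'$). Consider the following statements. (I) $f$ has accuracy $p$. (II) There exists a collection of complex numbers $\{v_\alpha\in\mathbb{C}:0\le|\alpha|<p\}$ such that (i) $v_0\hat f(0)\neq0$, and (ii) $Y_{[s]}=a_{[s]}Y_{[s]}L$ for $0\le s<p$. Then: (a) If the translates of $f$ along $\Gamma$ are independent, then (I) implies (II). (b) (II) implies (I). In this case, if we scale all the $v_\alpha$ by $C=(v_0\hat f(0))^{-1}|P|$, then $$X_{[s]}(x)=\sum_{\gamma\in\Gamma}y_{[s]}(\gamma)f(\gamma(x))=Y_{[s]}F(x),\qquad 0\le s<p.$$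
   Context: Splitting crystal triple: $\Lambda=R(\mathbb{Z}^d)$ with $R$ an invertible real $d\times d$ matrix; $G$ is a finite subgroup of the orthogonal group $\mathbf{O}(d)$ with $G\Lambda=\Lambda$; $\Gamma=\Lambda\rtimes G$ consists of the isometries $\gamma=(k,g)$, $k\in\Lambda$, $g\in G$, acting by $\gamma(x)=g(x)+k$, with product $(k,g)(k',g')=(k+gk',gg')$. A fundamental domain $P$ of $\Gamma$ is a bounded closed set such that $\bigcup_{\gamma\in\Gamma}\gamma(P)=\mathbb{R}^d$ and such that $\gamma(P^\circ)\cap\gamma'(P^\circ)\neq\emptyset$ implies $\gamma=\gamma'$, where $P^\circ$ is the interior of $P$; $|P|$ is its Lebesgue measure. A matrix $a\in\mathbb{R}^{d\times d}$ is $\Gamma$-admissible if it is expansive (all eigenvalues have modulus $>1$) and $a\Gamma a^{-1}\subset\Gamma$. Notation: for a multi-index $\alpha$, $x^\alpha=x_1^{\alpha_1}\cdots x_d^{\alpha_d}$ and $|\alpha|=\alpha_1+\dots+\alpha_d$; $d_s=\binom{s+d-1}{d-1}$ is the number of multi-indices of degree $s$; $X_{[s]}(x)=[x^\alpha]_{|\alpha|=s}\in\mathbb{R}^{d_s}$ (column vector). For a $d\times d$ matrix $b$, $b_{[s]}\in\mathbb{R}^{d_s\times d_s}$ is defined by $X_{[s]}(bx)=b_{[s]}X_{[s]}(x)$. The matrices $Q_{[s,t]}(y)\in\mathbb{R}^{d_s\times d_t}$ are defined by $X_{[s]}(x-y)=\sum_{t=0}^sQ_{[s,t]}(y)X_{[t]}(x)$.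 For $\gamma=(l,g)\in\Gamma$, $\widetilde{Q}_{[s,t]}(\gamma)=g^{-1}_{[s]}Q_{[s,t]}(l)$, where $g^{-1}_{[s]}$ is the matrix with $X_{[s]}(g^{-1}(x))=g^{-1}_{[s]}X_{[s]}(x)$; thus $X_{[s]}(\gamma^{-1}(x))=\sum_{t=0}^s\widetilde{Q}_{[s,t]}(\gamma)X_{[t]}(x)$. Given $\{v_\alpha\}$, put $v_{[s]}=[v_\alpha]_{|\alpha|=s}\in\mathbb{C}^{d_s}$, $y_{[s]}(\gamma)=\sum_{t=0}^s\widetilde{Q}_{[s,t]}(\gamma)v_{[t]}$, and $Y_{[s]}=(y_{[s]}(\gamma))_{\gamma\in\Gamma}$ (infinite row with entries in $\mathbb{C}^{d_s}$). $F(x)=[f(\gamma(x))]_{\gamma\in\Gamma}$ is an infinite column vector, and $L$ is the $\Gamma\times\Gamma$ matrix $L=[d_{a\gamma a^{-1}\sigma^{-1}}]_{\gamma,\sigma\in\Gamma}$. $\hat f$ is the Fourier transform of $f$, so $\hat f(0)=\int_{\mathbb{R}^d}f(x)\,dx$. Accuracy: the (crystal) accuracy of $f$ is the largest integer $p$ such that all multivariate polynomials $q(x)=q(x_1,\dots,x_d)$ of degree $<p$ lie in the space $\mathcal S(f)$ that is the closure of all finite linear combinations of the $\Gamma$-translates $f(\gamma(x))$, $\gamma\in\Gamma$. Equality of functions is understood almost everywhere. Independence: the translates of $f$ along $\Gamma$ are independent if for every choice of scalars $b_\gamma\in\mathbb{C}$, $\sum_{\gamma\in\Gamma}b_\gamma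 f(\gamma(x))=0$ if and only if $b_\gamma=0$ for every $\gamma$.
   Formalization: The final formula in (b) additionally assumes that the boundary of P has Lebesgue measure zero (it fails for fundamental domains with fat boundary, e.g. [0,1] plus a fat Cantor set); ''f has accuracy p'' is read as accuracy at least p, since (b) is false for accuracy exactly p. *)

(* Defs.v *)
From HB Require Import structures.
From mathcomp Require Import all_boot all_order all_algebra.
From mathcomp Require Import all_classical all_reals all_analysis.
From mathcomp Require Import complex.
From mathcomp Require mpoly.
(* The notations of mpoly clash with those of MathComp-Analysis. *)
Import(coercions, canonicals) mpoly.

Set Implicit Arguments.
Unset Strict Implicit.
Unset Printing Implicit Defensive.

Import Order.TTheory GRing.Theory Num.Theory numFieldNormedType.Exports.

Local Open Scope classical_set_scope.
Local Open Scope ring_scope.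

(* R^d is the type of column vectors, with the Borel sigma-algebra, here
   generated by the coordinates. *)
Definition cV_display : measure_display.
Proof. exact: default_measure_display. Qed.

Section cV_measurable.
Context {R : realType} (d : nat).

Definition cV_coord (i : 'I_d) (x : 'cV[R]_d) : measurableTypeR R := x i 0.

Let cV0 : g_sigma_preimage cV_coord set0.
Proof. exact: sigma_algebra0. Qed.

Let cVC A : g_sigma_preimage cV_coord A -> g_sigma_preimage cV_coord (~` A).
Proof. exact: sigma_algebraC. Qed.

Let cVU (F : _^nat) : (forall i, g_sigma_preimage cV_coord (F i)) ->
  g_sigma_preimage cV_coord (\bigcup_i (F i)).
Proof. exact: sigma_algebra_bigcup. Qed.

HB.instance Definition _ := @isMeasurable.Build cV_display 'cV[R]_d
  (g_sigma_preimage cV_coord) cV0 cVC cVU.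

End cV_measurable.

Section lebesgue_cV.
Context {R : realType}.

Definition cV_cons d (p : measurableTypeR R * 'cV[R]_d) : 'cV[R]_d.+1 :=
  \col_i (if unlift ord0 i is Some j then p.2 j 0 else p.1).

Lemma cV_cons0 d (p : measurableTypeR R * 'cV[R]_d) :
  cV_cons p ord0 0 = p.1.
Proof. by rewrite mxE unlift_none. Qed.

Lemma cV_consS d (p : measurableTypeR R * 'cV[R]_d) (i : 'I_d) :
  cV_cons p (lift ord0 i) 0 = p.2 i 0.
Proof. by rewrite mxE liftK. Qed.

Lemma measurable_cV_coord d (i : 'I_d) : measurable_fun setT (@cV_coord R d i).
Proof.
move=> _ A mA; rewrite setTI; apply: sub_sigma_algebra.
rewrite -bigcup_seq/=; exists i => /=; first by rewrite mem_index_enum.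
by exists A => //; rewrite setTI.
Qed.

Lemma measurable_fun_cV d d' (T : measurableType d') (h : T -> 'cV[R]_d) :
  (forall i, measurable_fun setT (cV_coord i \o h)) -> measurable_fun setT h.
Proof.
move=> mh; have : g_sigma_preimage (fun i => cV_coord i \o h) `<=` measurable.
  apply: smallest_sub; first exact: sigma_algebra_measurable.
  rewrite -bigcup_seq; apply: bigcup_sub => i _ A [B mB <-].
  exact: mh.
rewrite g_sigma_preimage_comp => H _ A mA.
by apply: H; exists A.
Qed.

Lemma measurable_cV_cons d : measurable_fun setT (@cV_cons d).
Proof.
apply: measurable_fun_cV => i; case: (unliftP ord0 i) => [j|] ->.
  rewrite (_ : _ \o _ = cV_coord j \o snd).
    by apply: measurableT_comp => //; exact: measurable_cV_coord.
  by apply/funext => p; rewrite /cV_coord/= cV_consS.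
rewrite (_ : _ \o _ = fst) //.
by apply/funext => p; rewrite /cV_coord/= cV_cons0.
Qed.

Definition cV_behead d (x : 'cV[R]_d.+1) : 'cV[R]_d := \col_i x (lift ord0 i) 0.

Lemma measurable_cV_behead d : measurable_fun setT (@cV_behead d).
Proof.
apply: measurable_fun_cV => i.
rewrite (_ : _ \o _ = cV_coord (lift ord0 i)); first exact: measurable_cV_coord.
by apply/funext => x; rewrite /cV_coord/= mxE.
Qed.

Lemma cV_consK d (p : measurableTypeR R * 'cV[R]_d) : cV_behead (cV_cons p) = p.2.
Proof. by apply/colP => i; rewrite mxE cV_consS. Qed.

HB.instance Definition _ d :=
  isMeasurableFun.Build _ _ _ _ (@cV_cons d) (@measurable_cV_cons d).

Section step.
Variables (d : nat) (mu : {sigma_finite_measure set 'cV[R]_d -> \bar R}).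

Definition lebesgue_step : set 'cV[R]_d.+1 -> \bar R :=
  pushforward (@lebesgue_measure R \x mu)%E (@cV_cons d).

Let step0 : lebesgue_step set0 = 0%E.
Proof. exact: measure0. Qed.

Let step_ge0 A : (0 <= lebesgue_step A)%E.
Proof. exact: measure_ge0. Qed.

Let step_sigma_additive : semi_sigma_additive lebesgue_step.
Proof. exact: measure_semi_sigma_additive. Qed.

HB.instance Definition _ := isMeasure.Build _ _ _ lebesgue_step
  step0 step_ge0 step_sigma_additive.

Lemma lebesgue_step_box (A : set (measurableTypeR R)) (B : set 'cV[R]_d) :
  measurable A -> measurable B ->
  measurable ((@cV_coord R d.+1 ord0 @^-1` A) `&` (@cV_behead d @^-1` B)) /\
  lebesgue_step ((@cV_coord R d.+1 ord0 @^-1` A) `&` (@cV_behead d @^-1` B)) =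
  (lebesgue_measure A * mu B)%E.
Proof.
move=> mA mB; split.
  apply: measurableI; rewrite -[X in measurable X]setTI.
    exact: measurable_cV_coord.
  exact: measurable_cV_behead.
rewrite -product_measure1E//; congr product_measure1.
apply/seteqP; split => p; rewrite /= /cV_coord cV_cons0 cV_consK.
  by case.
by case.
Qed.

Let step_sigma_finite : sigma_finite setT lebesgue_step.
Proof.
have /sigma_finiteP[F [TF ndF Foo]] := sigma_finiteT (@lebesgue_measure R).
have /sigma_finiteP[G [TG ndG Goo]] := sigma_finiteT mu.
exists (fun n => (@cV_coord R d.+1 ord0 @^-1` F n) `&` (@cV_behead d @^-1` G n)).
  apply/esym; rewrite -subTset => x _.
  have [n _ Fn] : (\bigcup_i F i) (cV_coord ord0 x) by rewrite -TF.
  have [k _ Gk] : (\bigcup_i G i) (cV_behead x) by rewrite -TG.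
  exists (maxn n k) => //; split.
    by have /subsetPset := ndF _ _ (leq_maxl n k); exact.
  by have /subsetPset := ndG _ _ (leq_maxr n k); exact.
move=> k; have [mF Fk] := Foo k; have [mG Gk] := Goo k.
have [? ->] := lebesgue_step_box mF mG; split => //.
by rewrite lte_mul_pinfty// ge0_fin_numE.
Qed.

HB.instance Definition _ := Measure_isSigmaFinite.Build _ _ _ lebesgue_step
  step_sigma_finite.

End step.

(* See lebesgue_cV_box for the measure of a product of sets. *)
Fixpoint lebesgue_cV d : {sigma_finite_measure set 'cV[R]_d -> \bar R} :=
  if d is e.+1 then lebesgue_step (lebesgue_cV e) else \d_(0 : 'cV[R]_0).

Lemma lebesgue_cV_box d (A : 'I_d -> set (measurableTypeR R)) :
  (forall i, measurable (A i)) ->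
  lebesgue_cV d [set x | forall i, A i (x i 0)] =
  (\prod_(i < d) lebesgue_measure (A i))%E.
Proof.
elim: d A => [|d IH] A mA.
  by rewrite big_ord0 /= diracE mem_set// => -[].
rewrite big_ord_recl -IH//.
have mB : measurable [set x : 'cV[R]_d | forall i, A (lift ord0 i) (x i 0)].
  rewrite (_ : [set _ | _] = \bigcap_(i in setT) (cV_coord i @^-1` A (lift ord0 i))).
    apply: fin_bigcap_measurable => // i _; rewrite -[X in measurable X]setTI.
    exact: measurable_cV_coord.
  by apply/seteqP; split => [x Ax i _|x Ax i]; exact: Ax.
have [_ <-] := lebesgue_step_box (lebesgue_cV d) (mA ord0) mB.
rewrite [LHS]/=; congr lebesgue_step; apply/seteqP; split => x.
  by move=> Ax; split => [|i]; [exact: Ax|rewrite mxE; exact: Ax].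
move=> [Ax0 AxS] i; case: (unliftP ord0 i) => [j|] ->; last exact: Ax0.
by have := AxS j; rewrite mxE.
Qed.

End lebesgue_cV.

Section complex_functions.
Context {R : realType} {d : nat}.
Implicit Types (f : 'cV[R]_d -> R[i]) (D : set 'cV[R]_d).

Definition integrableC f :=
  (lebesgue_cV d).-integrable setT (fun x => (complex.Re (f x))%:E) /\
  (lebesgue_cV d).-integrable setT (fun x => (complex.Im (f x))%:E).

Definition integralC f : R[i] :=
  Complex (\int[lebesgue_cV d]_x complex.Re (f x))
          (\int[lebesgue_cV d]_x complex.Im (f x)).

Definition L1dist D f g : \bar R :=
  (\int[lebesgue_cV d]_(x in D) (complex.Re `|f x - g x|)%:E)%E.

Definition compactly_supported f := compact (closure [set x | f x != 0]).

End complex_functions.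

Section isometries.
Context {R : realType} {d : nat}.

(* (k, g) stands for the affine map x |-> g x + k. *)
Definition affine := ('cV[R]_d * 'M[R]_d)%type.
Implicit Types (u w : affine) (Gamma : set affine) (G : set 'M[R]_d)
  (Lambda P : set 'cV[R]_d) (a : 'M[R]_d).

Definition aff_act u (x : 'cV[R]_d) : 'cV[R]_d := u.2 *m x + u.1.

Definition aff_mul u w : affine := (u.1 + u.2 *m w.1, u.2 *m w.2).

Definition aff_inv u : affine := (- (invmx u.2 *m u.1), invmx u.2).

Definition aff_conj a u : affine :=
  aff_mul (aff_mul (0, a) u) (aff_inv (0, a)).

Definition is_lattice Lambda := exists2 B : 'M[R]_d, B \in unitmx &
  Lambda = range (fun z : 'cV[int]_d => B *m map_mx intr z).

Definition finite_orthogonal_group G :=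
  [/\ finite_set G,
      G 1%:M,
      forall g h, G g -> G h -> G (g *m h),
      forall g, G g -> G (invmx g)
    & forall g, G g -> g^T *m g = 1%:M].

Definition splitting_crystal_triple Gamma G Lambda :=
  [/\ is_lattice Lambda,
      finite_orthogonal_group G,
      [set g *m k | g in G & k in Lambda] = Lambda
    & Gamma = Lambda `*` G].

(* This allows the boundary of P to have positive measure. *)
Definition fundamental_domain Gamma P :=
  [/\ bounded_set P,
      closed P,
      \bigcup_(u in Gamma) (aff_act u @` P) = setT
    & forall u w, Gamma u -> Gamma w ->
        (aff_act u @` P°) `&` (aff_act w @` P°) !=set0 -> u = w].

Definition expansive a := forall z : R[i],
  eigenvalue (map_mx (real_complex R) a) z -> 1 < `|z|.

Definition admissible Gamma a :=
  expansive a /\ (aff_conj a @` Gamma `<=` Gamma).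

End isometries.
Arguments affine : clear implicits.

Section accuracy.
Context {R : realType} {d : nat}.
Implicit Types (Gamma : set (affine R d)) (f h : 'cV[R]_d -> R[i]).

(* Closure, in L^1_loc, of the finite linear combinations of the translates *)
Definition translate_space Gamma f h := forall K, compact K ->
  forall e : R, 0 < e ->
  exists (A : set (affine R d)) (b : affine R d -> R[i]),
    [/\ finite_set A, A `<=` Gamma &
     (L1dist K h (fun x => (\sum_(u \in A) b u * f (aff_act u x))%R)
        < e%:E)%E].

Definition poly_fun (q : mpoly.mpoly d R[i]) (x : 'cV[R]_d) : R[i] :=
  mpoly.meval (fun i => (x i 0)%:C%C) q.

(* msize q is the degree of q plus one (and 0 for q = 0), so that the bound
   reads deg q < n; the supremum is +oo if there is no largest n. *)
Definition accuracy Gamma f : \bar R :=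
  ereal_sup [set n%:R%:E | n in [set n : nat |
    forall q : mpoly.mpoly d R[i], (mpoly.mmeasure mpoly.mdeg q <= n)%N ->
      translate_space Gamma f (poly_fun q)]].

Definition independent_translates Gamma f := forall b : affine R d -> R[i],
  {ae lebesgue_cV d, forall x, \sum_(u \in Gamma) b u * f (aff_act u x) = 0} <->
  (forall u, Gamma u -> b u = 0).

(* f(x) = \sum_(u in Gamma') c_u f(u^-1 (a x)) *)
Definition refinable Gamma' (c : affine R d -> R[i]) (a : 'M[R]_d) f :=
  {ae lebesgue_cV d, forall x,
    f x = \sum_(u \in Gamma') c u * f (aff_act (aff_inv u) (a *m x))}.

End accuracy.

Section indices.
Variable d : nat.

Definition degree_index (s : nat) :=
  {m : mpoly.bmultinom d s.+1 | mpoly.mdeg m == s}.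

(* d_s *)
Definition nb_index (s : nat) := #|{: degree_index s}|.

Definition index_val s (k : 'I_(nb_index s)) : mpoly.multinom d :=
  mpoly.bmnm (val (enum_val k)).

End indices.

Section monomials.
Context {R : realType} {d : nat}.
Local Notation nb_index := (nb_index d).

Definition monomials s (x : 'cV[R]_d) : 'cV[R]_(nb_index s) :=
  \col_k \prod_(i < d) x i 0 ^+ index_val k i.

(* b_[s] *)
Definition sym_mx s (b : 'M[R]_d) : 'M[R]_(nb_index s) :=
  xget 0 [set M | forall x : 'cV[R]_d, monomials s (b *m x) = M *m monomials s x].

(* Q_[s,t](y), for t <= s *)
Definition shift_mx s (y : 'cV[R]_d) :
    forall t, 'M[R]_(nb_index s, nb_index t) :=
  xget (fun t : nat => 0 : 'M[R]_(nb_index s, nb_index t)) [set Q | forall x : 'cV[R]_d,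
    monomials s (x - y) = \sum_(t < s.+1) Q t *m monomials t x].

End monomials.

(* sym_mx and shift_mx do satisfy the identities they are chosen for:
   see sym_mxE and shift_mxE. *)
Section monomial_identities.
Context {R : realType} {d : nat}.
Implicit Types (q : mpoly.mpoly d R) (x y : 'cV[R]_d).

Lemma index_val_inj s : injective (@index_val d s).
Proof. by move=> i j /val_inj /val_inj /enum_val_inj. Qed.

Lemma mdeg_index_val s (k : 'I_(nb_index d s)) :
  mpoly.mdeg (@index_val d s k) = s.
Proof. exact/eqP/(valP (enum_val k)). Qed.

Lemma index_val_surj s (m : mpoly.multinom d) : mpoly.mdeg m = s ->
  exists k : 'I_(nb_index d s), m = index_val k.
Proof.
move=> <-.
have lt : (mpoly.mdeg m < (mpoly.mdeg m).+1)%N by [].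
have H : mpoly.mdeg (mpoly.bmnm (mpoly.BMultinom lt)) == mpoly.mdeg m by [].
exists (enum_rank (exist (fun m' : mpoly.bmultinom d _ => mpoly.mdeg m' == _) (mpoly.BMultinom lt) H : degree_index d _)).
by rewrite /index_val enum_rankK.
Qed.

Lemma sum_index_val q s (F : mpoly.multinom d -> R) :
  (forall m, m \notin mpoly.msupp q -> F m = 0) ->
  \sum_(m <- mpoly.msupp q | mpoly.mdeg m == s) F m =
  \sum_(k < nb_index d s) F (index_val k).
Proof.
move=> F0; rewrite -(big_map (@index_val d s) predT F) /=.
rewrite [RHS](bigID (mem (mpoly.msupp q)))/= [X in _ + X]big1 ?addr0//.
rewrite -big_filter -[RHS]big_filter; apply: perm_big; apply: uniq_perm.
- exact/filter_uniq/mpoly.msupp_uniq.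
- apply: filter_uniq; rewrite map_inj_uniq; last exact: index_val_inj.
  exact: index_enum_uniq.
- move=> m; rewrite !mem_filter andbC; apply: andb_id2l => _.
  apply/eqP/mapP => [ms|[k _ ->]]; last exact: mdeg_index_val.
  have [k mk] := index_val_surj ms.
  by exists k => //; exact: mem_index_enum.
Qed.


Lemma meval_monomials q s x : (mpoly.mmeasure mpoly.mdeg q <= s.+1)%N ->
  mpoly.meval (fun i => x i 0) q =
  \sum_(t < s.+1) \sum_(k < nb_index d t)
     mpoly.mcoeff (index_val k) q * monomials t x k 0.
Proof.
move=> qs; rewrite mpoly.mevalE.
pose F m := mpoly.mcoeff m q * \prod_i x i 0 ^+ (m : mpoly.multinom d) i.
rewrite (eq_big_seq (fun m => \sum_(t < s.+1 | mpoly.mdeg m == t) F m)); last first.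
  move=> m mq; have ms : (mpoly.mdeg m < s.+1)%N.
    by apply: leq_trans qs; exact: mpoly.msize_mdeg_lt.
  by rewrite (big_pred1 (Ordinal ms))//.
rewrite (exchange_big_dep predT)//=; apply: eq_bigr => t _.
rewrite (@sum_index_val q t F) => [|m mq].
  by apply: eq_bigr => k _; rewrite mxE.
by rewrite /F mpoly.memN_msupp_eq0 ?mul0r.
Qed.


Definition supp_in (D : nat -> Prop) q :=
  forall m, m \in mpoly.msupp q -> D (mpoly.mdeg m).

Lemma supp_inM (D E H : nat -> Prop) q r :
  (forall s t, D s -> E t -> H (s + t)%N) ->
  supp_in D q -> supp_in E r -> supp_in H (q * r).
Proof.
move=> DEH Dq Er m /mpoly.msuppM_le /allpairsP[[m1 m2] [/= /Dq D1 /Er E2 ->]].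
by rewrite mpoly.mdegD; exact: DEH.
Qed.

Lemma supp_in_prod (D : nat -> nat -> Prop) (l : 'I_d -> mpoly.mpoly d R)
    (m : mpoly.multinom d) :
  D 0%N 0%N ->
  (forall s t s' t', D s s' -> D t t' -> D (s + t)%N (s' + t')%N) ->
  (forall i, supp_in (D 1%N) (l i)) ->
  supp_in (D (mpoly.mdeg m)) (\prod_i l i ^+ m i).
Proof.
move=> D0 DD Dl.
have one : supp_in (D 0%N) 1.
  by move=> m'; rewrite mpoly.msupp1 inE => /eqP ->; rewrite mpoly.mdeg0.
rewrite mpoly.mdegE; elim/big_ind2 : _ => [//|s1 x1 s2 x2 D1 D2|i _].
  by apply: supp_inM D1 D2 => *; exact: DD.
elim: (m i) => [|k IH]; first by rewrite expr0.
by rewrite exprS -[k.+1]add1n; apply: supp_inM (Dl i) IH => *; exact: DD.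
Qed.

Lemma sym_mxE s (b : 'M[R]_d) x :
  monomials s (b *m x) = sym_mx s b *m monomials s x.
Proof.
suff [M HM] : exists M, forall x, monomials s (b *m x) = M *m monomials s x.
  move: x; rewrite /sym_mx.
  by case: xgetP => [? _ //|/(_ M)].
pose lin i : mpoly.mpoly d R := \sum_j b i j *: mpoly.mpolyX R (mpoly.mnm1 j).
pose q (m : mpoly.multinom d) : mpoly.mpoly d R := \prod_i lin i ^+ m i.
have qE m y : mpoly.meval (fun i => y i 0) (q m) = \prod_i (b *m y) i 0 ^+ m i.
  rewrite rmorph_prod; apply: eq_bigr => i _; rewrite rmorphXn; congr (_ ^+ _).
  rewrite mxE raddf_sum; apply: eq_bigr => j _.
  by rewrite /= mpoly.mevalZ mpoly.mevalXU.
have qs m : supp_in (eq (mpoly.mdeg m)) (q m).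
  apply: (@supp_in_prod eq) => //; first by move=> ? ? ? ? -> ->.
  move=> i m' /mpoly.msupp_sum_le; rewrite filter_predT => /flattenP[_ /mapP[j _ ->]].
  by move=> /mpoly.msuppZ_le; rewrite mpoly.msuppX inE => /eqP ->; rewrite mpoly.mdeg1.
exists (\matrix_(k, l) mpoly.mcoeff (index_val l) (q (index_val k))) => {}x.
apply/colP => k; rewrite !mxE -qE (@meval_monomials _ s); last first.
  apply/bigmax_leqP_seq => m mq _; rewrite ltnS.
  by have := qs _ _ mq; rewrite mdeg_index_val => /esym/eq_leq.
rewrite (bigD1 ord_max)//= [X in _ + X]big1 ?addr0 => [|t ts].
  by apply: eq_bigr => l _; rewrite !mxE.
apply: big1 => l _; rewrite mpoly.memN_msupp_eq0 ?mul0r//.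
apply: contra ts => /qs; rewrite !mdeg_index_val => st.
by apply/eqP/val_inj/esym.
Qed.

Lemma shift_mxE s x y :
  monomials s (x - y) = \sum_(t < s.+1) shift_mx s y t *m monomials t x.
Proof.
suff [Q HQ] : exists Q : (forall t, 'M[R]_(nb_index d s, nb_index d t)),
    forall x, monomials s (x - y) = \sum_(t < s.+1) Q t *m monomials t x.
  move: x; rewrite /shift_mx.
  by case: xgetP => [? _ //|/(_ Q)].
pose lin i : mpoly.mpoly d R := mpoly.mpolyX R (mpoly.mnm1 i) - mpoly.mpolyC d (y i 0).
pose q (m : mpoly.multinom d) : mpoly.mpoly d R := \prod_i lin i ^+ m i.
have qE m (z : 'cV[R]_d) : mpoly.meval (fun i => z i 0) (q m) = \prod_i (z - y) i 0 ^+ m i.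
  rewrite rmorph_prod; apply: eq_bigr => i _; rewrite rmorphXn; congr (_ ^+ _).
  by rewrite /lin raddfB /= mpoly.mevalXU mpoly.mevalC !mxE.
have qs m : supp_in (fun t => (t <= mpoly.mdeg m)%N) (q m).
  apply: (@supp_in_prod (fun s t => (t <= s)%N)) => // [? ? ? ?|i m'].
    exact: leq_add.
  move=> /mpoly.msuppB_le; rewrite mem_cat mpoly.msuppX inE mpoly.msuppC.
  case/orP => [/eqP ->|]; first by rewrite mpoly.mdeg1.
  by case: ifP => //= _; rewrite inE => /eqP ->; rewrite mpoly.mdeg0.
exists (fun t => \matrix_(k, l) mpoly.mcoeff (index_val l) (q (index_val k))) => {}x.
apply/colP => k; rewrite summxE mxE -qE (@meval_monomials _ s).
  by apply: eq_bigr => t _; rewrite mxE; apply: eq_bigr => l _; rewrite !mxE.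
apply/bigmax_leqP_seq => m mq _; rewrite ltnS.
by apply: leq_trans (qs _ _ mq) _; rewrite mdeg_index_val.
Qed.

End monomial_identities.

Section refinement.
Context {R : realType} {d : nat}.
Local Notation nb_index := (nb_index d).

(* For u = (l, g), the matrix g^-1_[s] Q_[s,t](l) *)
Definition shift_mx_iso s t (u : affine R d) : 'M[R]_(nb_index s, nb_index t) :=
  sym_mx s (invmx u.2) *m shift_mx s u.1 t.

Definition toC m n (M : 'M[R]_(m, n)) : 'M[R[i]]_(m, n) :=
  map_mx (real_complex R) M.

Implicit Types (v : mpoly.multinom d -> R[i]) (Gamma : set (affine R d))
  (c : affine R d -> R[i]) (f : 'cV[R]_d -> R[i]).

Definition vsub v s : 'cV[R[i]]_(nb_index s) := \col_k v (index_val k).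

Definition ysub v s (u : affine R d) : 'cV[R[i]]_(nb_index s) :=
  \sum_(t < s.+1) toC (shift_mx_iso s t u) *m vsub v t.

Definition refinement_mx c (a : 'M[R]_d) (u w : affine R d) : R[i] :=
  c (aff_mul (aff_conj a u) (aff_inv w)).

(* The entry at w of the row vector Y L *)
Definition row_mul Gamma n (Y : affine R d -> 'cV[R[i]]_n)
    (L : affine R d -> affine R d -> R[i]) (w : affine R d) : 'cV[R[i]]_n :=
  \sum_(u \in Gamma) L u w *: Y u.

Definition conditionII Gamma c (a : 'M[R]_d) f p v :=
  v (@mpoly.mnm0 d) * integralC f <> 0 /\
  forall s, (s < p)%N -> forall w, Gamma w ->
    ysub v s w =
    toC (sym_mx s a) *m row_mul Gamma (ysub v s) (refinement_mx c a) w.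

End refinement.

(* Main.v *)
From HB Require Import structures.
Require Import Defs.
From mathcomp Require Import all_boot all_order all_algebra.
From mathcomp Require Import all_classical all_reals all_analysis.
From mathcomp Require Import measurable_realfun.
From mathcomp Require Import complex ring zify.
From mathcomp Require mpoly.
Import(coercions, canonicals) mpoly.

Set Implicit Arguments.
Unset Strict Implicit.
Unset Printing Implicit Defensive.

Import Order.TTheory GRing.Theory Num.Theory numFieldNormedType.Exports.

Local Open Scope classical_set_scope.
Local Open Scope ring_scope.

(** Write T b for the function with value \sum_(u in Gamma) b u * f (u x) at x.
    As Gamma is locally finite and f has compact support, T b is a finite sum on
    each cube, and the refinement equation says that T b x = T (b L) (a x).

    Necessity. On a cube, a function in the translate space is a limit of
    combinations of finitely many fixed translates, hence itself such a
    combination (closed_span). The coefficients of these local representations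
    form a decreasing sequence of affine subspaces, each constraining finitely
    many coordinates, and such a sequence has a common point
    (nested_affine_subspaces). So each monomial x^m of degree < p is a series
    T (z m) (translate_space_series). Let v m be the coefficient of f itself,
    that is the value of z m at the identity of Gamma. The polynomials
    X_[s](gamma^-1 x) and X_[s](a x) have two expansions each; as the translates
    are independent, the coefficients agree. The first comparison gives
    z_[s](gamma) = y_[s](gamma), the second one is then (ii). In degree 0,
    1 = v_0 T 1, and integration over a tile U of the lattice gives
    v_0^-1 |U| = |G| fhat(0), whence (i).

    Sufficiency. The functions g_s = Y_[s] F satisfy the translation law of the
    monomials under Gamma (gvec_act), and by (ii) their dilation law
    g_s(a x) = a_[s] g_s(x) (gvec_dilation). Hence g_0 is invariant under
    translation by a^-n k for each lattice vector k. These vectors are dense, and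
    a function invariant under a dense set of translations is constant
    (dense_invariant_constant). Let K be the value of g_0. If g_t = K X_[t] for
    all t < s, then h = g_s - K X_[s] is periodic and h(a x) = a_[s] h(x). A
    power of a at least doubles the size of h; but it also induces a measure
    preserving map of the torus, so h = 0 (periodic_contraction). Integrating g_0
    over U shows that K |U| = v_0 |G| fhat(0), so K is not 0 and all polynomials
    of degree < p are series of translates. When the boundary of P is null,
    |U| = |G| |P| (tile_volume), which says that C K = 1.

    The measure theory rests on one fact: a translation invariant measure that is
    finite on cubes is a multiple of the Lebesgue measure
    (translation_invariant_measure). It gives the effect of affine maps on
    volume, the invariance of the measure of the torus under endomorphisms, and,
    applied to the restriction of the Lebesgue measure to a set, ergodicity. *)

(** * Linear independence of the monomials *)

(** The nodes 0, ..., N - 1 are distinct, so that the inverse of their Vandermonde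
    matrix separates the powers of degree < N. *)
Lemma vandermonde_dual (F : numFieldType) N : exists u : nat -> nat -> F,
  forall e e', (e < N)%N -> (e' < N)%N ->
  \sum_(j < N) u e j * (j%:R : F) ^+ e' = (e == e')%:R.
Proof.
pose V : 'M[F]_N := Vandermonde N (\row_(j < N) (j%:R : F)).
have Vu : V \in unitmx.
  rewrite unitmxE det_Vandermonde unitfE; apply/prodf_neq0 => i _.
  apply/prodf_neq0 => j ij; rewrite !mxE subr_eq0 eqr_nat.
  by rewrite neq_ltn ij orbT.
exists (fun e j => if insub e is Some e1 then
  if insub j is Some j1 then invmx V j1 e1 else 0 else 0) => e e' eN e'N.
have := congr1 (fun M : 'M[F]_N => M (Ordinal e'N) (Ordinal eN)) (mulmxV Vu).
rewrite !mxE => H; rewrite -[RHS](_ : (Ordinal e'N == Ordinal eN)%:R = _); last first.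
  by rewrite eq_sym.
rewrite -H insubT; apply: eq_bigr => j _.
by rewrite valK !mxE mulrC.
Qed.

Definition monom {F : numFieldType} {d} (m : 'I_d -> nat) (x : 'cV[F]_d) : F :=
  \prod_(i < d) x i 0 ^+ m i.

(** Products of the functionals of one variable, on the grid {0, ..., N - 1}^d. *)
Lemma monom_dual (F : numFieldType) d N :
  exists (J : finType) (pt : J -> 'cV[F]_d) (w : ('I_d -> nat) -> J -> F),
  forall m m', (forall i, m i < N)%N -> (forall i, m' i < N)%N ->
  \sum_j w m j * monom m' (pt j) = [forall i, m i == m' i]%:R.
Proof.
have [u Hu] := vandermonde_dual F N.
exists {ffun 'I_d -> 'I_N}, (fun phi : {ffun 'I_d -> 'I_N} => \col_i ((phi i : nat)%:R : F)),
  (fun (m : 'I_d -> nat) (phi : {ffun 'I_d -> 'I_N}) => \prod_i u (m i) (phi i)) => m m' mN m'N.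
rewrite /monom; under eq_bigr do (rewrite -big_split /=; under eq_bigr do rewrite mxE).
rewrite -(bigA_distr_bigA (fun i j => u (m i) (val j) * (val j)%:R ^+ m' i)) /=.
under eq_bigr do rewrite Hu//.
case: forallP => [mm|/existsNP[i /negP mi]].
  by rewrite big1// => i _; rewrite mm.
by rewrite (bigD1 i)//= (negbTE mi) mul0r.
Qed.

Section monomials_independence.
Context {R : realType} {d : nat}.
Local Notation nb := (nb_index d).

Lemma index_val_ub s (k : 'I_(nb s)) i : (index_val k i <= s)%N.
Proof.
by rewrite -[X in (_ <= X)%N](mdeg_index_val k) mpoly.mdegE (bigD1 i)//= leq_addr.
Qed.

Lemma monomialsE s (x : 'cV[R]_d) k :
  monomials s x k 0 = monom (index_val k) x.
Proof. by rewrite mxE. Qed.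

(** Evaluation on the grid followed by the dual functionals extracts any
    coefficient. As the points and weights depend only on the degree bound, this
    gives the uniqueness of the coefficients and also their continuity in the
    values. *)
Lemma coef_from_values s :
  exists (J : finType) (pt : J -> 'cV[R]_d) (w : forall t, 'I_(nb t) -> J -> R),
  forall n (M : forall t, 'M[R]_(n, nb t)) t k i, (t <= s)%N ->
  M t i k = \sum_j w t k j * (\sum_(t' < s.+1) M t' *m monomials t' (pt j)) i 0.
Proof.
have [J [pt [w H]]] := monom_dual R d s.+1.
exists J, pt, (fun t k => w (index_val k)) => n M t k i ts.
transitivity (\sum_(t' < s.+1) \sum_(k' < nb t') M t' i k' *
    \sum_j w (index_val k) j * monom (index_val k') (pt j)).
  have ts1 : (t < s.+1)%N by [].
  rewrite (bigD1 (Ordinal ts1))//= [X in _ + X]big1 ?addr0; last first.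
    move=> t' tt'; apply: big1 => k' _; rewrite H; last 2 first.
    - by move=> l; rewrite ltnS (leq_trans (index_val_ub k l)).
    - by move=> l; rewrite ltnS (leq_trans (index_val_ub k' l))// -ltnS.
    case: forallP => [kk|]; rewrite ?mulr0//; exfalso.
    move/eqP : tt'; apply; apply/val_inj => /=.
    rewrite -(mdeg_index_val k) -(mdeg_index_val k'); congr mpoly.mdeg.
    by apply/mpoly.mnmP => l; rewrite (eqP (kk l)).
  rewrite (bigD1 k)//= [X in _ + X]big1 ?addr0; last first.
    move=> k' kk'; rewrite H; last 2 first.
    - by move=> l; rewrite ltnS (leq_trans (index_val_ub k l)).
    - by move=> l; rewrite ltnS (leq_trans (index_val_ub k' l)).
    case: forallP => [kl|]; rewrite ?mulr0//; exfalso.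
    move/eqP : kk'; apply; apply/index_val_inj.
    by apply/mpoly.mnmP => l; rewrite (eqP (kl l)).
  rewrite H; last 2 first.
  - by move=> l; rewrite ltnS (leq_trans (index_val_ub k l)).
  - by move=> l; rewrite ltnS (leq_trans (index_val_ub k l)).
  case: forallP => [kl|/existsNP[l /negP]]; first by rewrite mulr1.
  by rewrite eqxx.
under eq_bigr do (under eq_bigr do rewrite mulr_sumr; rewrite exchange_big).
rewrite exchange_big /=; apply: eq_bigr => j _.
rewrite summxE mulr_sumr; apply: eq_bigr => t' _; rewrite !mxE mulr_sumr.
by apply: eq_bigr => k' _; rewrite monomialsE mulrCA.
Qed.

Lemma monomials_free s n (M N : forall t, 'M[R]_(n, nb t)) :
  (forall x, \sum_(t < s.+1) M t *m monomials t x =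
             \sum_(t < s.+1) N t *m monomials t x) ->
  forall t, (t <= s)%N -> M t = N t.
Proof.
move=> MN t ts; have [J [pt [w H]]] := coef_from_values s.
apply/matrixP => i k; rewrite (H _ M)// (H _ N)//.
by under eq_bigr do rewrite MN.
Qed.

Lemma sum_triangular (V : nmodType) s (F : nat -> V) n : (s <= n)%N ->
  \sum_(t < s.+1) F t = \sum_(t < n.+1) (if (t <= s)%N then F t else 0).
Proof.
move=> sn; rewrite (big_ord_widen n.+1)// -big_mkcond /=.
by apply: eq_bigl => t; rewrite ltnS.
Qed.

(** A matrix acting on a single degree s, seen as a family indexed by all the
    degrees t; the cast transports it along s = t. *)
Lemma homogeneous_sum s n (M : 'M[R]_(n, nb s)) x :
  \sum_(t < s.+1) (if s =P t is ReflectT e then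
     ecast t 'M[R]_(n, nb t) e M else 0) *m monomials t x = M *m monomials s x.
Proof.
rewrite (bigD1 ord_max)//= [X in _ + X]big1 ?addr0 => [|t ts].
  by case: eqP => // e; rewrite (eq_axiomK e).
case: eqP => [e|_]; last by rewrite mul0mx.
by move/eqP: ts; case; apply/val_inj.
Qed.

Lemma monomials_freeh s n (M N : 'M[R]_(n, nb s)) :
  (forall x, M *m monomials s x = N *m monomials s x) -> M = N.
Proof.
move=> MN.
have := @monomials_free s n
  (fun t => if s =P t is ReflectT e then ecast t 'M[R]_(n, nb t) e M else 0)
  (fun t => if s =P t is ReflectT e then ecast t 'M[R]_(n, nb t) e N else 0).
move=> /(_ _ s (leqnn s)); case: eqP => // e; rewrite (eq_axiomK e) /=; apply.
by move=> x; rewrite !homogeneous_sum.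
Qed.

Lemma sym_mx1 s : sym_mx s 1%:M = 1%:M :> 'M[R]_(nb s).
Proof. by apply: monomials_freeh => x; rewrite -sym_mxE !mul1mx. Qed.

Lemma sym_mxM s (a b : 'M[R]_d) : sym_mx s (a *m b) = sym_mx s a *m sym_mx s b.
Proof.
by apply: monomials_freeh => x; rewrite -sym_mxE -!mulmxA !sym_mxE.
Qed.

Lemma monomials0 (x : 'cV[R]_d) : monomials 0 x = const_mx 1.
Proof.
apply/colP => k; rewrite !mxE big1// => i _.
by have := index_val_ub k i; rewrite leqn0 => /eqP ->.
Qed.

Lemma sym_mx0 (a : 'M[R]_d) : sym_mx 0 a = 1%:M.
Proof.
by apply: monomials_freeh => x; rewrite -sym_mxE !monomials0 mul1mx.
Qed.

Lemma cvg_sum_seq (I : finType) (f : I -> nat -> R) (l : I -> R) :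
  (forall i, f i n @[n --> \oo] --> l i) ->
  \sum_i f i n @[n --> \oo] --> \sum_i l i.
Proof.
by move=> fl; apply: cvg_big => [|i _]; [exact: add_continuous|exact: fl].
Qed.

Lemma cvg_prod_seq (I : finType) (f : I -> nat -> R) (l : I -> R) :
  (forall i, f i n @[n --> \oo] --> l i) ->
  \prod_i f i n @[n --> \oo] --> \prod_i l i.
Proof.
by move=> fl; apply: cvg_big => [|i _]; [exact: mul_continuous|exact: fl].
Qed.

(** Entries of sym_mx are values of a polynomial map of positive degree at the
    matrix, so that they inherit convergence to 0. *)
Lemma cvg_sym_mx s (b : nat -> 'M[R]_d) : (0 < s)%N ->
  (forall (x : 'cV[R]_d) i, (b n *m x) i 0 @[n --> \oo] --> 0) ->
  forall k l, sym_mx s (b n) k l @[n --> \oo] --> 0.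
Proof.
move=> s0 b0 k l; have [J [pt [w H]]] := coef_from_values s.
pose M n t : 'M[R]_(nb s, nb t) := if s =P t is ReflectT e then
  ecast t 'M[R]_(nb s, nb t) e (sym_mx s (b n)) else 0.
have E n : sym_mx s (b n) k l = \sum_j w s l j * monomials s (b n *m pt j) k 0.
  transitivity (M n s k l).
    by rewrite /M; case: eqP => // e; rewrite (eq_axiomK e).
  rewrite (H _ (M n))//; apply: eq_bigr => j _.
  by rewrite homogeneous_sum -sym_mxE.
under eq_fun do rewrite E.
(* It is enough that each monomial of positive degree tends to 0 along b n *m pt j. *)
have /(_ (fun j n => w s l j * monomials s (b n *m pt j) k 0) (fun j => w s l j * 0)) :=
  @cvg_sum_seq J.
rewrite (_ : \sum_j w s l j * 0 = 0); last by rewrite big1// => j _; rewrite mulr0.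
apply=> j; apply: cvgMl_tmp.
under eq_fun do rewrite monomialsE.
have [i i0] : exists i, (0 < index_val k i)%N.
  apply/not_existsP => k0; move: s0; rewrite -(mdeg_index_val k) mpoly.mdegE.
  by rewrite big1// => i _; apply/eqP; rewrite -leqn0 leqNgt; exact/negP/k0.
have /(_ (fun i n => (b n *m pt j) i 0 ^+ index_val k i) (fun i => 0 ^+ index_val k i)) :=
  @cvg_prod_seq 'I_d.
rewrite (_ : \prod_i 0 ^+ index_val k i = 0 :> R); last first.
  by rewrite (bigD1 i)//= expr0n -leqn0 leqNgt i0 mul0r.
apply=> i'.
exact: (continuous_cvg _ (@exprn_continuous R (index_val k i') 0) (b0 (pt j) i')).
Qed.

End monomials_independence.

(** * Affine maps and the cocycle of shift matrices *)

Section affine_group.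
Context {R : realType} {d : nat}.
Implicit Types (u w : affine R d) (a g : 'M[R]_d) (x : 'cV[R]_d).

Definition aff1 : affine R d := (0, 1%:M).

Lemma aff_actM u w x : aff_act (aff_mul u w) x = aff_act u (aff_act w x).
Proof. by rewrite /aff_act /= mulmxDr mulmxA -addrA [u.1 + _]addrC. Qed.

Lemma aff_act1 x : aff_act aff1 x = x.
Proof. by rewrite /aff_act mul1mx addr0. Qed.

Lemma aff_mulA u w v : aff_mul u (aff_mul w v) = aff_mul (aff_mul u w) v.
Proof. by rewrite /aff_mul /= mulmxDr !mulmxA addrA. Qed.

Lemma aff_mul1 u : aff_mul aff1 u = u.
Proof. by case: u => l g; rewrite /aff_mul /= !mul1mx add0r. Qed.

Lemma aff_mulr1 u : aff_mul u aff1 = u.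
Proof. by case: u => l g; rewrite /aff_mul /= mulmx0 mulmx1 addr0. Qed.

Lemma aff_mulV u : u.2 \in unitmx -> aff_mul u (aff_inv u) = aff1.
Proof.
by move=> uu; rewrite /aff_mul /aff_inv /= mulmxN mulKVmx// mulmxV// subrr.
Qed.

Lemma aff_mulVl u : u.2 \in unitmx -> aff_mul (aff_inv u) u = aff1.
Proof.
by move=> uu; rewrite /aff_mul /aff_inv /= mulVmx// addrC subrr.
Qed.

Lemma aff_act_inv u x : aff_act (aff_inv u) x = invmx u.2 *m (x - u.1).
Proof. by rewrite /aff_act /aff_inv /= mulmxBr. Qed.

Lemma aff_actK u x : u.2 \in unitmx -> aff_act (aff_inv u) (aff_act u x) = x.
Proof. by move=> uu; rewrite -aff_actM aff_mulVl// aff_act1. Qed.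

Lemma aff_actVK u x : u.2 \in unitmx -> aff_act u (aff_act (aff_inv u) x) = x.
Proof. by move=> uu; rewrite -aff_actM aff_mulV// aff_act1. Qed.

Lemma aff_conj_act a u x : a \in unitmx ->
  aff_act (aff_conj a u) (a *m x) = a *m aff_act u x.
Proof.
move=> au; rewrite /aff_conj !aff_actM aff_act_inv /= subr0 mulKmx//.
by rewrite /aff_act /= !addr0.
Qed.

Lemma aff_inv_unique u w : u.2 \in unitmx -> aff_mul u w = aff1 -> aff_inv u = w.
Proof. by move=> uu uw; rewrite -[LHS]aff_mulr1 -uw aff_mulA aff_mulVl// aff_mul1. Qed.

Lemma aff_inv_div u w : u.2 \in unitmx -> w.2 \in unitmx ->
  aff_inv (aff_mul u (aff_inv w)) = aff_mul w (aff_inv u).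
Proof.
move=> uu wu; apply: aff_inv_unique; first by rewrite unitmx_mul uu unitmx_inv.
rewrite -aff_mulA [aff_mul (aff_inv w) _]aff_mulA aff_mulVl// aff_mul1.
exact: aff_mulV.
Qed.

Lemma aff_invK u : u.2 \in unitmx -> aff_inv (aff_inv u) = u.
Proof.
move=> uu; apply: aff_inv_unique; first by rewrite /aff_inv /= unitmx_inv.
exact: aff_mulVl.
Qed.

End affine_group.

Section shift_cocycle.
Context {R : realType} {d : nat}.
Implicit Types (u w : affine R d) (x : 'cV[R]_d).
Local Notation nb := (nb_index d).

Lemma shift_mx_isoE s u x : monomials s (aff_act (aff_inv u) x) =
  \sum_(t < s.+1) shift_mx_iso s t u *m monomials t x.
Proof.
rewrite aff_act_inv sym_mxE shift_mxE mulmx_sumr.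
by apply: eq_bigr => t _; rewrite mulmxA.
Qed.

(** The cocycle relation: compare the coefficients of X_[s] at the point
    (u w)^-1 x = w^-1 (u^-1 x). *)
Lemma shift_mx_isoM s t u w : u.2 \in unitmx -> w.2 \in unitmx -> (t <= s)%N ->
  shift_mx_iso s t (aff_mul u w) =
  \sum_(r < s.+1) shift_mx_iso s r w *m
     (if (t <= r)%N then shift_mx_iso r t u else 0).
Proof.
move=> uu wu ts; pose N t := \sum_(r < s.+1) shift_mx_iso s r w *m
     (if (t <= r)%N then shift_mx_iso r t u else 0).
apply: (@monomials_free R d s (nb s) (fun t => shift_mx_iso s t (aff_mul u w)) N) => // x.
rewrite -shift_mx_isoE.
transitivity (monomials s (aff_act (aff_inv w) (aff_act (aff_inv u) x))).
  have uwu : (aff_mul u w).2 \in unitmx by rewrite unitmx_mul uu.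
  congr monomials; rewrite -[in LHS](aff_actVK x uu).
  by rewrite -[X in aff_act u X](aff_actVK _ wu) -(aff_actM u w) (aff_actK _ uwu).
rewrite shift_mx_isoE; under [RHS]eq_bigr do rewrite mulmx_suml.
rewrite exchange_big /=; apply: eq_bigr => r _.
rewrite shift_mx_isoE mulmx_sumr (@sum_triangular _ r
  (fun t => shift_mx_iso s r w *m (shift_mx_iso r t u *m monomials t x)) s)//; last first.
  by rewrite -ltnS.
apply: eq_bigr => t' _; case: ifP => _; rewrite ?mulmx0 ?mul0mx ?mulmxA//.
Qed.

Lemma shift_mx_isoM_diag s u w : u.2 \in unitmx -> w.2 \in unitmx ->
  shift_mx_iso s s (aff_mul u w) = shift_mx_iso s s w *m shift_mx_iso s s u.
Proof.
move=> uu wu; rewrite shift_mx_isoM// big_ord_recr/= leqnn big1 ?add0r// => r _.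
by rewrite leqNgt ltn_ord mulmx0.
Qed.

Lemma monomialsZ s (c : R) x : monomials s (c *: x) = c ^+ s *: monomials s x.
Proof.
apply/colP => k; rewrite !mxE; under eq_bigr do rewrite mxE exprMn.
rewrite big_split /= prodrXr; congr (_ ^+ _ * _).
by rewrite -[RHS](mdeg_index_val k) mpoly.mdegE.
Qed.

Lemma shift_mx_iso1 s t : (t <= s)%N ->
  shift_mx_iso s t (@aff1 R d) = if s =P t is ReflectT e then
    ecast t 'M[R]_(nb s, nb t) e 1%:M else 0.
Proof.
move=> ts; apply: (@monomials_free R d s (nb s) (fun t => shift_mx_iso s t aff1)
  (fun t => if s =P t is ReflectT e then
    ecast t 'M[R]_(nb s, nb t) e 1%:M else 0)) => // x.
rewrite -shift_mx_isoE homogeneous_sum mul1mx; congr monomials.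
by rewrite -[in LHS](aff_act1 x) aff_actK//= unitmx1.
Qed.

(** By homogeneity Q(2l) = Q(l), while Q(2l) is the square of Q(l) by the
    cocycle relation; so the invertible matrix Q(l) is the identity. *)
Lemma shift_mx_iso_diag s (l : 'cV[R]_d) : shift_mx_iso s s (l, 1%:M) = 1%:M.
Proof.
have Q2 : shift_mx_iso s s (2 *: l, 1%:M) = shift_mx_iso s s (l, 1%:M).
  have := @monomials_free R d s (nb s)
    (fun t => (2 ^+ t) *: shift_mx_iso s t (2 *: l, 1%:M))
    (fun t => (2 ^+ s) *: shift_mx_iso s t (l, 1%:M)).
  move=> /(_ _ s (leqnn s)) H; apply: (@scalerI _ _ (2 ^+ s)).
    by rewrite expf_neq0// pnatr_eq0.
  apply: H => x; transitivity (monomials s (aff_act (aff_inv (2 *: l, 1%:M)) (2 *: x))).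
    rewrite shift_mx_isoE; apply: eq_bigr => t _.
    by rewrite monomialsZ -scalemxAl scalemxAr.
  rewrite aff_act_inv /= -scalerBr -scalemxAr monomialsZ.
  rewrite -(aff_act_inv (l, 1%:M)) shift_mx_isoE scaler_sumr.
  by apply: eq_bigr => t _; rewrite scalemxAl.
have QM (l1 l2 : 'cV[R]_d) : shift_mx_iso s s (l1 + l2, 1%:M) =
    shift_mx_iso s s (l2, 1%:M) *m shift_mx_iso s s (l1, 1%:M).
  have := @shift_mx_isoM_diag s (l1, 1%:M) (l2, 1%:M) (unitmx1 _ _) (unitmx1 _ _).
  by rewrite /aff_mul /= !mul1mx.
have Q0 : shift_mx_iso s s (0, 1%:M) = 1%:M :> 'M[R]_(nb s).
  by rewrite shift_mx_iso1//; case: eqP => // e; rewrite (eq_axiomK e).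
have := QM l (- l); rewrite subrr Q0 => QV.
have := QM l l; rewrite -mulr2n -scaler_nat Q2 => /(congr1 (mulmx (shift_mx_iso s s (- l, 1%:M)))).
by rewrite mulmxA -QV mul1mx.
Qed.

Implicit Types v : mpoly.multinom d -> R[i].

(** The cocycle relation applied to v: under right multiplication the columns
    of Y obey the translation law of the monomials. *)
Lemma ysubM v s u w : u.2 \in unitmx -> w.2 \in unitmx ->
  ysub v s (aff_mul u w) =
  \sum_(r < s.+1) toC (shift_mx_iso s r w) *m ysub v r u.
Proof.
move=> uu wu; rewrite /ysub.
pose F (t r : nat) := toC (shift_mx_iso s r w *m
  (if (t <= r)%N then shift_mx_iso r t u else 0)) *m vsub v t.
transitivity (\sum_(t < s.+1) \sum_(r < s.+1) F t r).
  apply: eq_bigr => t _; rewrite shift_mx_isoM//; last by rewrite -ltnS.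
  by rewrite /toC raddf_sum mulmx_suml.
rewrite exchange_big /=; apply: eq_bigr => r _.
rewrite mulmx_sumr (@sum_triangular _ r (fun t => toC (shift_mx_iso s r w) *m
  (toC (shift_mx_iso r t u) *m vsub v t)) s); last by rewrite -ltnS.
apply: eq_bigr => t _; rewrite /F; case: ifP => _.
  by rewrite /toC map_mxM mulmxA.
by rewrite mulmx0 /toC raddf0 mul0mx.
Qed.

Lemma ysub0 v u k : ysub v 0 u k 0 = v (@mpoly.mnm0 d).
Proof.
have Q0 : shift_mx_iso 0 0 u = 1%:M.
  apply: monomials_freeh => x; have := shift_mx_isoE 0 u x.
  by rewrite big_ord1 /= !monomials0 mul1mx => <-.
rewrite /ysub big_ord1 /= Q0 /toC map_mx1 mul1mx mxE; congr v.
apply/mpoly.mnmP => i; rewrite mpoly.mnm0E.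
by apply/eqP; rewrite -leqn0; exact: index_val_ub.
Qed.

Lemma ysubZ v (c : R[i]) s u : ysub (fun m => c * v m) s u = c *: ysub v s u.
Proof.
rewrite /ysub scaler_sumr; apply: eq_bigr => t _.
by rewrite scalemxAr; congr (_ *m _); apply/colP => k; rewrite !mxE.
Qed.

End shift_cocycle.

(** * Modulus of complex numbers *)

Section complex_modulus.
Context {R : realType}.
Implicit Types z w : R[i].

(** The real-valued modulus, with which the distance L1dist is defined. *)
Definition cmod z : R := complex.Re `|z|.

Lemma cmodE z : `|z| = (cmod z)%:C%C.
Proof. by rewrite /cmod; apply/eqP; rewrite eq_complex /= !eqxx. Qed.

Lemma cmod_ge0 z : 0 <= cmod z.
Proof. by rewrite -ler0c -cmodE. Qed.

Lemma cmodD z w : cmod (z + w) <= cmod z + cmod w.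
Proof. by rewrite -lecR rmorphD /= -!cmodE ler_normD. Qed.

Lemma cmodM z w : cmod (z * w) = cmod z * cmod w.
Proof. by apply: complexI; rewrite rmorphM /= -!cmodE normrM. Qed.

Lemma cmodN z : cmod (- z) = cmod z.
Proof. by rewrite /cmod normrN. Qed.

Lemma cmod0 : cmod 0 = 0.
Proof. by rewrite /cmod normr0. Qed.

Lemma cmod_eq0 z : (cmod z == 0) = (z == 0).
Proof. by rewrite -[RHS]normr_eq0 cmodE -(inj_eq (@complexI R)). Qed.

Lemma cmod_real (x : R) : cmod x%:C%C = `|x|.
Proof. by rewrite /cmod normc_def /= expr0n addr0 sqrtr_sqr. Qed.

Lemma Re_le_cmod z : `|complex.Re z| <= cmod z.
Proof.
rewrite /cmod normc_def /=; case: z => a b /=.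
by rewrite -sqrtr_sqr ler_sqrt ?addr_ge0 ?sqr_ge0// lerDl sqr_ge0.
Qed.

Lemma Im_le_cmod z : `|complex.Im z| <= cmod z.
Proof.
rewrite /cmod normc_def /=; case: z => a b /=.
by rewrite -sqrtr_sqr ler_sqrt ?addr_ge0 ?sqr_ge0// lerDr sqr_ge0.
Qed.

End complex_modulus.

(** * Powers of the inverse of an expansive matrix *)

Section expansive.
Context {R : realType}.

(** Once h is small, each step multiplies e by rho up to a small error, and the
    errors add up to a convergent geometric series. *)
Lemma cvg_contraction (rho : R) (e h : nat -> R) : 0 <= rho < 1 ->
  (forall n, 0 <= e n) -> (forall n, e n.+1 <= rho * (e n + h n)) ->
  h n @[n --> \oo] --> 0 -> e n @[n --> \oo] --> 0.
Proof.
move=> /andP[r0 r1] e0 eh /cvgrPdist_le h0; apply/cvgrPdist_le => eps eps0.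
have r2 : 0 < 1 - rho by rewrite subr_gt0.
(* With this bound on h the errors accumulate to at most rho eps / 2. *)
pose eta := (1 - rho) * (eps / 2).
have eta0 : 0 < eta by rewrite mulr_gt0// divr_gt0.
have [N _ hN] := h0 _ eta0.
have H k : e (N + k)%N <= rho ^+ k * e N + eps / 2.
  elim: k => [|k IH]; first by rewrite addn0 expr0 mul1r lerDl ltW// divr_gt0.
  rewrite addnS (le_trans (eh _))//.
  have hk : h (N + k)%N <= eta.
    have := hN (N + k)%N (leq_addr _ _); rewrite sub0r normrN.
    by apply: le_trans; exact: ler_norm.
  rewrite (le_trans (ler_wpM2l r0 (lerD IH hk)))// exprS -mulrA !mulrDr -addrA lerD2l.
  rewrite -mulrDr /eta -[X in X + _]mul1r -mulrDl.
  have -> : 1 + (1 - rho) = 2 - rho by rewrite addrA.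
  rewrite mulrA -[leRHS]mul1r ler_pM2r ?divr_gt0//.
  by rewrite -subr_ge0 (_ : _ - _ = (rho - 1) ^+ 2) ?sqr_ge0//; ring.
have r1' : `|rho| < 1 by rewrite ger0_norm.
have eN0 : 0 < e N + 1 by rewrite ltr_wpDl.
have [K _ HK] := (iffLR (cvgrPdist_le _ _) (cvg_expr r1')) (eps / 2 / (e N + 1))
  ltac:(by rewrite !divr_gt0).
exists (N + K)%N => // n /= Kn.
have -> : n = (N + (n - N))%N by rewrite subnKC// (leq_trans _ Kn)// leq_addr.
rewrite sub0r normrN ger0_norm// (le_trans (H _))// [leRHS]splitr lerD2r.
have := HK (n - N)%N; rewrite /= leq_subRL ?(leq_trans (leq_addr _ _) Kn)//.
move=> /(_ Kn); rewrite sub0r normrN ger0_norm ?exprn_ge0// ler_pdivlMr//.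
apply: le_trans; rewrite ler_wpM2l ?exprn_ge0// lerDl ler01//.
Qed.

Lemma expansive_unit d (a : 'M[R]_d) : expansive a -> a \in unitmx.
Proof.
move=> ea; rewrite -(map_unitmx (real_complex R)) -row_free_unit -kermx_eq0.
apply/negPn/negP => a0; have := ea 0; rewrite /eigenvalue /eigenspace.
by rewrite (raddf0 (scalar_mx)) subr0 normr0 ltr10 => /(_ a0).
Qed.

(** By the Cayley-Hamilton theorem every vector is annihilated by a product of
    factors a - z with |z| > 1. Removing one factor at a time, W n = a^-n w
    satisfies z W (n+1) = W n - U (n+1), where U n = a^-n (a - z) w tends to 0. *)
Lemma expansive_cvg d (a : 'M[R]_d) : expansive a ->
  forall (x : 'cV[R]_d) i, ((invmx a ^+ n) *m x) i 0 @[n --> \oo] --> 0.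
Proof.
case: d a => [|d] a ea x i; first by case: i.
have au := expansive_unit ea.
pose A := map_mx (real_complex R) a.
have Au : A \in unitmx by rewrite map_unitmx.
suff H (zs : seq R[i]) : (forall z, z \in zs -> 1 < `|z|) ->
    forall w : 'cV[R[i]]_d.+1, horner_mx A (\prod_(z <- zs) ('X - z%:P)) *m w = 0 ->
    cmod ((invmx A ^+ n *m w) i 0) @[n --> \oo] --> 0.
  have [r] := closed_field_poly_normal (char_poly A).
  rewrite (monicP (char_poly_monic _)) scale1r => rE.
  have : cmod ((invmx A ^+ n *m toC x) i 0) @[n --> \oo] --> 0.
    apply: (H r); last by rewrite -rE Cayley_Hamilton mul0mx.
    move=> z zr; apply: ea; rewrite eigenvalue_root_char rE.
    by rewrite root_prod_XsubC.
  move=> {}H; apply/cvgrPdist_le => e e0.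
  have [N _ HN] := (iffLR (cvgrPdist_le _ _) H) e e0; exists N => // n Nn.
  have := HN n Nn; rewrite !sub0r !normrN /A -map_invmx /toC.
  by rewrite -rmorphXn -map_mxM mxE cmod_real normr_id.
elim: zs => [_ w|z zs IH zzs w].
  rewrite big_nil rmorph1 mul1mx => ->.
  by under eq_fun do rewrite mulmx0 mxE cmod0; exact: cvg_cst.
rewrite big_cons mulrC rmorphM /= -mulmxE -mulmxA rmorphB /= horner_mx_X horner_mx_C => wz.
have z1 : 1 < `|z| by apply: zzs; rewrite inE eqxx.
have zc1 : 1 < cmod z by rewrite -ltcR -cmodE.
have z0 : z != 0 by rewrite -normr_gt0 (lt_trans _ z1).
have zzs' z' : z' \in zs -> 1 < `|z'| by move=> z'zs; apply: zzs; rewrite inE z'zs orbT.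
have Uc := IH zzs' _ wz.
pose U n := (invmx A ^+ n *m ((A - z%:M) *m w)) i 0.
pose W n := (invmx A ^+ n *m w) i 0.
have E n : z * W n.+1 = W n - U n.+1.
  rewrite /U /W mulmxBl mul_scalar_mx mulmxBr -scalemxAr.
  rewrite [in invmx A ^+ _ *m (A *m _)]exprSr -mulmxE !mulmxA mulmxKV//.
  by rewrite !mxE opprB addrC subrK exprSr.
apply: (@cvg_contraction (cmod z)^-1 _ (fun n => cmod (U n.+1))).
- by rewrite invr_ge0 cmod_ge0 invf_lt1// (lt_trans ltr01).
- by move=> n; exact: cmod_ge0.
- move=> n; rewrite ler_pdivlMl ?(lt_trans ltr01)// -cmodM E.
  by rewrite (le_trans (cmodD _ _))// cmodN.
- by rewrite (cvg_shiftS (fun n => cmod (U n))).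
Qed.

End expansive.

(** * Borel sets of the space of column vectors *)

Section cV_topology.
Context {R : realType} {d : nat}.
Implicit Types (x : 'cV[R]_d) (A : set 'cV[R]_d).

Definition cube (r : R) : set 'cV[R]_d := [set x | forall i, `|x i 0| < r].

Lemma nbhs_cV x A : nbhs x A ->
  exists2 e : R, 0 < e & forall y : 'cV[R]_d, (forall i, `|x i 0 - y i 0| < e) -> A y.
Proof.
move=> /nbhs_ballP[e /= e0 eA]; exists e => // y xy; apply: eA.
by split => // i j; rewrite ord1; exact: xy.
Qed.

(** Compactness of a product of segments is known for row vectors; transposition
    is continuous. *)
Lemma closed_cube_compact (r : R) :
  compact [set x : 'cV[R]_d | forall i, `|x i 0| <= r].
Proof.
have -> : [set x : 'cV[R]_d | forall i, `|x i 0| <= r] =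
    trmx @` [set v : 'rV[R]_d | forall i, `[- r, r]%classic (v ord0 i)].
  apply/seteqP; split => [x xr|_ [v vr <-] i].
    exists x^T; last by rewrite trmxK.
    by move=> i; rewrite /= mxE in_itv /= -ler_norml.
  by rewrite mxE ler_norml; have := vr i; rewrite /= in_itv.
apply: continuous_compact; last first.
  by apply: (rV_compact (A := fun=> `[- r, r]%classic)) => i; exact: segment_compact.
apply: continuous_subspaceT => v B [P vP PB].
exists (fun i j => P j i) => [i j|w wP].
  by have := vP j i; rewrite mxE.
by apply: PB => i j; rewrite mxE; exact: wP.
Qed.

Lemma bounded_cube A : bounded_set A -> exists2 n : nat, (0 < n)%N & A `<=` cube n%:R.
Proof.
move=> [M [_ MA]].
pose n := (Num.trunc `|M + 1|).+1; exists n => // x Ax i.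
have : `|x| <= M + 1 by apply: MA => //; rewrite ltrDl.
move=> xM; rewrite (le_lt_trans (le_trans _ (le_trans xM (ler_norm _))))//; last first.
  exact: truncnS_gt.
rewrite [leRHS]/Num.Def.normr /= mx_normrE.
exact: (le_bigmax _ (fun ij : 'I_d * 'I_1 => `|x ij.1 ij.2|) (i, 0)).
Qed.

Lemma compact_cube A : compact A -> exists2 n : nat, (0 < n)%N & A `<=` cube n%:R.
Proof. by move=> /compact_bounded; exact: bounded_cube. Qed.

Lemma cube_cover : \bigcup_n cube n%:R = [set: 'cV[R]_d].
Proof.
apply/seteqP; split => // x _.
have [n _ H] := compact_cube (@compact_set1 _ x).
by exists n => //; exact: H.
Qed.

Lemma sub_cube (r s : R) : r <= s -> cube r `<=` cube s.
Proof. by move=> rs x xr i; rewrite (lt_le_trans (xr i)). Qed.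

Definition box (A : 'I_d -> set R) : set 'cV[R]_d := [set x | forall i, A i (x i 0)].

Lemma measurable_box (A : 'I_d -> set R) : (forall i, measurable (A i)) ->
  measurable (box A).
Proof.
move=> mA; rewrite (_ : box _ = \bigcap_(i in setT) (cV_coord i @^-1` A i)).
  apply: fin_bigcap_measurable => // i _; rewrite -[X in measurable X]setTI.
  by apply: measurable_cV_coord => //; exact: mA.
by apply/seteqP; split => [x Ax i _|x Ax i]; exact: Ax.
Qed.

Lemma cubeE (r : R) : cube r = box (fun=> `]- r, r[%classic).
Proof.
by apply/seteqP; split => x xr i; have := xr i; rewrite /= in_itv /= ltr_norml.
Qed.

Lemma measurable_cube (r : R) : measurable (cube r).
Proof. by rewrite cubeE; apply: measurable_box => i. Qed.

(** An open set is the union of the cubes that it contains and that have a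
    rational centre and an inverse integer as half side. *)
Lemma open_measurable_cV A : open A -> measurable A.
Proof.
move=> oA.
pose C (q : 'cV[rat]_d) (n : nat) : set 'cV[R]_d :=
  [set x | forall i, `|ratr (q i 0) - x i 0| < n.+1%:R^-1].
have mC q n : measurable (C q n).
  rewrite (_ : C q n = box (fun i => ball (ratr (q i 0) : R) n.+1%:R^-1)).
    apply: measurable_box => i; apply: open_measurable; apply: ball_open.
  by apply/seteqP; split => x.
have -> : A = \bigcup_q \bigcup_(n in [set n | C q n `<=` A]) C q n.
  apply/seteqP; split => [x Ax|x [q _ [n /= CA]]]; last exact: CA.
  have /nbhs_cV[e e0 eA] : nbhs x A by exact: open_nbhs_nbhs.
  have [n ne] : exists n : nat, n.+1%:R^-1 < e / 2.
    exists (Num.trunc (e / 2)^-1); rewrite invf_plt ?posrE//; last first.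
      by rewrite divr_gt0.
    by rewrite truncnS_gt.
  have H i : exists q : rat, `|ratr q - x i 0| < n.+1%:R^-1.
    have : x i 0 - n.+1%:R^-1 < x i 0 + n.+1%:R^-1.
      by rewrite ltrD2l gtrN// invr_gt0.
    move=> /rat_in_itvoo[q]; rewrite in_itv /= => /andP[q1 q2]; exists q.
    by rewrite ltr_norml ltrBrDr addrC q1 /= ltrBlDl.
  pose q : 'cV[rat]_d := \col_i projT1 (cid (H i)).
  have qx i : `|ratr (q i 0) - x i 0| < n.+1%:R^-1.
    by rewrite mxE; case: cid.
  exists q => //; exists n => // y yC; apply: eA => i.
  rewrite (splitr e) -(subrKA (ratr (q i 0))) (le_lt_trans (ler_normD _ _))//.
  by rewrite distrC ltrD// (lt_trans _ ne).
apply: countable_bigcupT_measurable; first exact: countableP.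
by move=> q; apply: bigcup_measurable => n _; exact: mC.
Qed.

Lemma closed_measurable_cV A : closed A -> measurable A.
Proof.
move=> cA; rewrite -[A]setCK; apply: measurableC; apply: open_measurable_cV.
exact: closed_openC.
Qed.

Lemma compact_measurable_cV A : compact A -> measurable A.
Proof.
move=> cA; apply: closed_measurable_cV; exact: compact_closed.
Qed.

Lemma g_sigma_algebra_open_boxes :
  @measurable _ 'cV[R]_d = <<s [set box A | A in [set A | forall i, open (A i)]] >>.
Proof.
apply/seteqP; split; last first.
  apply: smallest_sub; first exact: sigma_algebra_measurable.
  by move=> _ [A oA <-]; apply: measurable_box => i; exact: open_measurable (oA i).
apply: smallest_sub; first exact: smallest_sigma_algebra.
rewrite -bigcup_seq; apply: bigcup_sub => i _.
set G := (X in <<s X >>).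
suff : measurable_fun [set: g_sigma_algebraType G]
    (cV_coord i : g_sigma_algebraType G -> measurableTypeR R).
  by move=> mf _ [B mB <-]; exact: mf.
apply: (measurability _ (RGenOpens.measurableE R)) => _ [_ [a [b ->] <-]].
rewrite setTI; apply: sub_sigma_algebra.
exists (fun j => if j == i then `]a, b[%classic else setT).
  by move=> j; case: ifP => _; [exact: interval_open|exact: openT].
apply/seteqP; split => [x /(_ i)|x xab j]; first by rewrite eqxx.
by case: eqP => [->|].
Qed.

(** The open boxes are a generating class stable under intersections. *)
Lemma cV_measure_unique (m1 m2 : {measure set 'cV[R]_d -> \bar R}) :
  (forall A : 'I_d -> set R, (forall i, open (A i)) -> m1 (box A) = m2 (box A)) ->
  (forall n : nat, m1 (cube n%:R) < +oo)%E ->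
  forall X, measurable X -> m1 X = m2 X.
Proof.
move=> m12 m1oo X mX.
apply: (measure_unique [set box A | A in [set A | forall i, open (A i)]]
  (fun n => cube n%:R)) => //.
- exact: g_sigma_algebra_open_boxes.
- move=> _ _ [A oA <-] [B oB <-]; exists (fun i => A i `&` B i).
    by move=> i; exact: openI.
  by apply/seteqP; split => [x AB|x [Ax Bx] i//]; split => i; case: (AB i).
- move=> n; rewrite cubeE; exists (fun=> `]- n%:R, n%:R[%classic) => //.
- exact: cube_cover.
- by move=> _ [A oA <-]; exact: m12.
Qed.

Lemma measurable_mulmx (M : 'M[R]_d) : measurable_fun setT (fun x => M *m x).
Proof.
apply: measurable_fun_cV => i.
rewrite (_ : _ \o _ = fun x : 'cV[R]_d => \sum_j M i j * cV_coord j x); last first.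
  by apply/funext => x; rewrite /cV_coord /= mxE.
apply: measurable_sum => j.
apply: measurable_funM; first exact: measurable_cst.
exact: measurable_cV_coord.
Qed.

Lemma measurable_affine u : measurable_fun setT (@aff_act R d u).
Proof.
apply: measurable_fun_cV => i.
rewrite (_ : _ \o _ = fun x : 'cV[R]_d => cV_coord i (u.2 *m x) + u.1 i 0); last first.
  by apply/funext => x; rewrite /cV_coord /= !mxE.
apply: measurable_funD; last exact: measurable_cst.
by apply: measurableT_comp; [exact: measurable_cV_coord|exact: measurable_mulmx].
Qed.

Lemma measurable_translation (t : 'cV[R]_d) : measurable_fun setT (fun x => x + t).
Proof.
have := measurable_affine (t, 1%:M); congr measurable_fun.
by apply/funext => x; rewrite /aff_act mul1mx.
Qed.

End cV_topology.

(** * Uniqueness of the translation invariant measure *)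

Section translation_invariance.
Context {R : realType}.

Lemma lebesgue_measure_translation (s : R) (A : set R) : measurable A ->
  lebesgue_measure ((fun y => y + s) @^-1` A) = lebesgue_measure A.
Proof.
move=> mA.
have ms : measurable_fun setT (fun y : measurableTypeR R => (y + s : measurableTypeR R)).
  by apply: measurable_funD => //; exact: measurable_cst.
pose m : {measure set (measurableTypeR R) -> \bar R} :=
  measure_function_pushforward__canonical__measure_function_Measure (@lebesgue_measure R) ms.
apply/esym; apply: (lebesgue_measure_unique (mu := m)) => // _ [[a b] _ <-] /=.
rewrite /pushforward (_ : _ @^-1` _ = `]a - s, b - s]%classic); last first.
  by apply/seteqP; split => y /=; rewrite !in_itv /= ltrBlDr lerBrDr.
rewrite !lebesgue_measure_itv /= !lte_fin ltrD2r; case: ifPn => // _.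
by rewrite -!EFinB opprB addrA subrK.
Qed.

Context {d : nat}.
Local Notation lam := (lebesgue_cV d : {sigma_finite_measure set 'cV[R]_d -> \bar R}).

Definition aff_pushforward (m : {measure set 'cV[R]_d -> \bar R}) (u : affine R d)
  : {measure set 'cV[R]_d -> \bar R} :=
  measure_function_pushforward__canonical__measure_function_Measure m
    (measurable_affine u).

Lemma lebesgue_cube (r : R) : 0 < r -> lam (cube r) = ((2 * r) ^+ d)%:E.
Proof.
move=> r0; rewrite cubeE lebesgue_cV_box//.
rewrite (eq_bigr (fun=> (2 * r)%:E)) => [|i _]; last first.
  rewrite lebesgue_measure_itv /= lte_fin gtrN// -EFinB opprK.
  by congr EFin; ring.
by rewrite prodEFin big_const_ord iter_mulr_1.
Qed.

Lemma lebesgue_cube_fin (r : R) : (lam (cube r) < +oo)%E.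
Proof.
rewrite (@le_lt_trans _ _ (lam (cube (`|r| + 1))))//.
  apply: le_measure; rewrite ?inE; [exact: measurable_cube|exact: measurable_cube|].
  by apply: sub_cube; rewrite (le_trans (ler_norm r))// lerDl.
by rewrite lebesgue_cube ?ltry// ltr_wpDl.
Qed.

Lemma lebesgue_cV_translation t (A : set 'cV[R]_d) : measurable A ->
  lam (aff_act (t, 1%:M) @^-1` A) = lam A.
Proof.
have E (B : 'I_d -> set R) : (forall i, open (B i)) ->
    lam (aff_act (t, 1%:M) @^-1` (box B)) = lam (box B).
  move=> oB; have mB i : measurable (B i) by exact: open_measurable (oB i).
  rewrite (_ : _ @^-1` _ = box (fun i => (fun y => y + t i 0) @^-1` (B i))); last first.
    by apply/seteqP; split => x Bx i; have := Bx i; rewrite /aff_act /= mul1mx mxE.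
  rewrite !lebesgue_cV_box//; last first.
    move=> i; rewrite -[X in measurable X]setTI.
    have ms : measurable_fun setT (fun y : measurableTypeR R => (y + t i 0 : measurableTypeR R)).
      by apply: measurable_funD => //; exact: measurable_cst.
    by apply: ms => //; exact: mB.
  by apply: eq_bigr => i _; rewrite lebesgue_measure_translation.
apply: (cV_measure_unique (m1 := aff_pushforward lam (t, 1%:M))).
  exact: E.
move=> n; rewrite /= /pushforward cubeE E -?cubeE ?lebesgue_cube_fin//.
Qed.

Section uniqueness.
Variable mu : {measure set 'cV[R]_d -> \bar R}.
Hypothesis mu_translation : forall t A, measurable A ->
  mu (aff_act (t, 1%:M) @^-1` A) = mu A.
Hypothesis mu_cube : forall n : nat, (mu (cube n%:R) < +oo)%E.

Let mu_sigma_finite : sigma_finite setT mu.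
Proof.
exists (fun n => cube n%:R); first by rewrite cube_cover.
by move=> n; split; [exact: measurable_cube|exact: mu_cube].
Qed.

Let muS : set 'cV[R]_d -> \bar R := mu.

HB.instance Definition _ := Measure.on muS.
HB.instance Definition _ := Measure_isSigmaFinite.Build _ _ _ muS mu_sigma_finite.

Lemma tonelli_sections (S : set ('cV[R]_d * 'cV[R]_d)) : measurable S ->
  (\int[mu]_x lam (xsection S x) = \int[lam]_y mu (ysection S y))%E.
Proof.
move=> mS.
have : (muS \x lam)%E S = (muS \x^ lam)%E S.
  by apply: product_measure_unique => //= ? ? ? ?; rewrite product_measure2E.
by [].
Qed.

(** Both sides compute the measure of the set of pairs (x, y) with x in A and
    x + y in B, once by columns and once by rows, after a change of variable
    that replaces x by x - y. *)
Lemma translation_invariant_swap (A B : set 'cV[R]_d) :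
  measurable A -> measurable B ->
  (mu A * lam B = mu B * lam [set y : 'cV[R]_d | A (- y)%R])%E.
Proof.
move=> mA mB.
pose S := [set z : 'cV[R]_d * 'cV[R]_d | A z.1 /\ B (z.1 + z.2)].
pose T := [set z : 'cV[R]_d * 'cV[R]_d | A (z.1 - z.2) /\ B z.1].
have mN : measurable_fun setT (fun x : 'cV[R]_d => - x).
  by have := measurable_mulmx (- 1%:M : 'M[R]_d); congr measurable_fun;
    apply/funext => x; rewrite mulNmx mul1mx.
have mp : measurable_fun setT (fun z : 'cV[R]_d * 'cV[R]_d => z.1 + z.2).
  apply: measurable_fun_cV => i.
  rewrite (_ : _ \o _ = fun z => cV_coord i z.1 + cV_coord i z.2); last first.
    by apply/funext => z; rewrite /cV_coord /= mxE.
  by apply: measurable_funD; apply: (measurableT_comp (measurable_cV_coord i)).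
have mm : measurable_fun setT (fun z : 'cV[R]_d * 'cV[R]_d => z.1 - z.2).
  apply: measurable_fun_cV => i.
  rewrite (_ : _ \o _ = fun z => cV_coord i z.1 - cV_coord i z.2); last first.
    by apply/funext => z; rewrite /cV_coord /= !mxE.
  by apply: measurable_funB; apply: (measurableT_comp (measurable_cV_coord i)).
have mS : measurable S.
  rewrite (_ : S = (fst @^-1` A) `&` ((fun z => z.1 + z.2) @^-1` B))//.
  apply: measurableI; rewrite -[X in measurable X]setTI; first exact: measurable_fst.
  exact: mp.
have mT : measurable T.
  rewrite (_ : T = ((fun z => z.1 - z.2) @^-1` A) `&` (fst @^-1` B))//.
  apply: measurableI; rewrite -[X in measurable X]setTI; first exact: mm.
  exact: measurable_fst.
have mA' : measurable [set y : 'cV[R]_d | A (- y)].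
  by rewrite -[X in measurable X]setTI; exact: mN.
transitivity (\int[mu]_x lam (xsection S x))%E.
  transitivity (\int[mu]_x ((\1_A x)%:E * lam B))%E.
    rewrite ge0_integralZr//.
    - by rewrite integral_indic// setIT.
    - exact: measurableT_comp.
  apply: eq_integral => x _; rewrite indicE.
  have [xA|xA] := boolP (x \in A); last first.
    rewrite mul0e (_ : xsection S x = set0) ?measure0//.
    apply/seteqP; split => // y; rewrite /xsection /= inE => -[Ax _].
    by move: xA; rewrite notin_setE.
  rewrite mul1e -(lebesgue_cV_translation x mB); congr (lebesgue_cV d _).
  apply/seteqP; split => y; rewrite /xsection /= /aff_act /= mul1mx addrC.
    by move=> By; rewrite inE; split => //; move: xA; rewrite inE.
  by rewrite inE => -[].
rewrite tonelli_sections//.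
(* On each row, translate the first coordinate by the second one. *)
transitivity (\int[lam]_y mu (ysection T y))%E.
  apply: eq_integral => y _; rewrite -(mu_translation y (A := ysection T y)); last first.
    exact: measurable_ysection.
  congr (mu _); apply/seteqP; split => x; rewrite /ysection /= /aff_act /= mul1mx !inE /S /T /=;
  by rewrite addrK.
rewrite -tonelli_sections//.
transitivity (\int[mu]_x ((\1_B x)%:E * lam [set y : 'cV[R]_d | A (- y)%R]))%E; last first.
  rewrite ge0_integralZr//.
  - by rewrite integral_indic// setIT.
  - exact: measurableT_comp.
apply: eq_integral => x _; rewrite indicE.
have [xB|xB] := boolP (x \in B); last first.
  rewrite mul0e (_ : xsection T x = set0) ?measure0//.
  apply/seteqP; split => // y; rewrite /xsection /= inE => -[_ Bx].
  by move: xB; rewrite notin_setE.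
rewrite mul1e -(lebesgue_cV_translation (- x) mA'); congr (lebesgue_cV d _).
apply/seteqP; split => y; rewrite /xsection /= /aff_act /= mul1mx opprB inE.
  by case.
by move=> Ay; split => //; move: xB; rewrite inE.
Qed.

End uniqueness.

(** The exchange formula for mu = lam and B a cube. *)
Lemma lebesgue_cV_opp (A : set 'cV[R]_d) : measurable A ->
  lam [set y : 'cV[R]_d | A (- y)] = lam A.
Proof.
move=> mA; have := @translation_invariant_swap lam lebesgue_cV_translation
  (fun n => lebesgue_cube_fin n%:R) A (cube 1) mA (measurable_cube 1).
rewrite !lebesgue_cube// mulr1 muleC => /(congr1 (fun x => ((2 ^+ d)^-1)%:E * x)%E).
by rewrite !muleA -!EFinM mulVf ?expf_neq0 ?pnatr_eq0// !mul1e => ->.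
Qed.

(** The exchange formula for B a fixed cube: its measure determines the
    constant. *)
Theorem translation_invariant_measure (mu : {measure set 'cV[R]_d -> \bar R}) :
  (forall t A, measurable A -> mu (aff_act (t, 1%:M) @^-1` A) = mu A) ->
  (forall n : nat, (mu (cube n%:R) < +oo)%E) ->
  exists2 c : R, 0 <= c & forall A, measurable A -> mu A = (c%:E * lam A)%E.
Proof.
move=> mut muc; exists (fine (mu (cube 1)) / 2 ^+ d).
  by rewrite divr_ge0 ?fine_ge0 ?exprn_ge0.
move=> A mA; have := translation_invariant_swap mut muc mA (measurable_cube 1).
rewrite lebesgue_cV_opp// lebesgue_cube// mulr1 [LHS]muleC.
move=> /(congr1 (fun x => ((2 ^+ d)^-1)%:E * x)%E).
rewrite !muleA -EFinM mulVf ?expf_neq0 ?pnatr_eq0// mul1e => ->.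
rewrite [in RHS]mulrC EFinM fineK// ge0_fin_numE//.
exact: (muc 1).
Qed.

End translation_invariance.

(** * Lebesgue measure under affine maps *)

Section affine_measure.
Context {R : realType} {d : nat}.
Implicit Types (u : affine R d) (A : set 'cV[R]_d).
Local Notation lam := (lebesgue_cV d : {sigma_finite_measure set 'cV[R]_d -> \bar R}).

Lemma measurable_affine_preimage u A : measurable A -> measurable (aff_act u @^-1` A).
Proof. by move=> mA; rewrite -[X in measurable X]setTI; exact: measurable_affine. Qed.

Lemma affine_cube u (n : nat) :
  exists2 m : nat, (0 < m)%N & forall x, cube n%:R x -> cube m%:R (aff_act u x).
Proof.
pose K := \sum_i (\sum_j `|u.2 i j| * n%:R + `|u.1 i 0|) : R.
exists (Num.trunc K).+1 => // x xn i.
rewrite (le_lt_trans _ (truncnS_gt K))// /aff_act !mxE.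
rewrite (le_trans (ler_normD _ _))// /K [leRHS](bigD1 i)//=; apply: ler_wpDr.
  by apply: sumr_ge0 => j _; rewrite addr_ge0// sumr_ge0// => k _; rewrite mulr_ge0.
rewrite lerD2r (le_trans (ler_norm_sum _ _ _))// ler_sum// => j _.
by rewrite normrM ler_wpM2l// ltW.
Qed.

Lemma lebesgue_setT_gt0 : (0 < lam setT)%E.
Proof.
rewrite (@lt_le_trans _ _ (lam (cube 1)))//.
  by rewrite lebesgue_cube// lte_fin exprn_gt0// mulr1.
by apply: le_measure; rewrite ?inE//; exact: measurable_cube.
Qed.

(** The image of the Lebesgue measure under an invertible affine map is again
    translation invariant and finite on bounded sets. *)
Lemma lebesgue_affine u : u.2 \in unitmx ->
  exists2 c : R, 0 < c & forall A, measurable A ->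
    lam (aff_act u @^-1` A) = (c%:E * lam A)%E.
Proof.
move=> uu.
have [] := @translation_invariant_measure R d (aff_pushforward lam u).
- move=> t A mA; rewrite /= /pushforward.
  rewrite -(lebesgue_cV_translation (invmx u.2 *m t) (A := aff_act u @^-1` A)); last first.
    exact: measurable_affine_preimage.
  congr (lebesgue_cV d _); apply/seteqP; split => x /=; rewrite /aff_act /= !mul1mx;
  by rewrite mulmxDr mulKVmx// addrAC.
- move=> n; rewrite /= /pushforward.
  have [m m0 H] := affine_cube (aff_inv u) n.
  apply: (@le_lt_trans _ _ (lam (cube m%:R))); last exact: lebesgue_cube_fin.
  apply: le_measure; rewrite ?inE.
  + by apply: measurable_affine_preimage; exact: measurable_cube.
  + exact: measurable_cube.
  + by move=> x /= /H; rewrite aff_actK.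
move=> c c0 H; exists c => //; rewrite lt_neqAle c0 andbT; apply/negP => /eqP c_eq0.
have := H setT measurableT; rewrite -c_eq0 mul0e /= /pushforward preimage_setT.
by move=> T0; have := lebesgue_setT_gt0; rewrite T0 ltxx.
Qed.

Lemma ae_affine u (P : 'cV[R]_d -> Prop) : u.2 \in unitmx ->
  {ae lam, forall x, P x} -> {ae lam, forall x, P (aff_act u x)}.
Proof.
move=> uu [N [mN N0 PN]]; exists (aff_act u @^-1` N); split.
- exact: measurable_affine_preimage.
- by have [c _ ->//] := lebesgue_affine uu; rewrite [X in (_ * X)%E]N0 mule0.
- by move=> x Px; apply: PN.
Qed.

End affine_measure.

Section integral_mrestr.
Context {d'} {T : measurableType d'} {R : realType}.
Local Open Scope ereal_scope.

Lemma integral_mrestr (m : {measure set T -> \bar R}) (U : set T) (mU : measurable U)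
    (f : T -> \bar R) : measurable_fun setT f -> (forall x, 0 <= f x) ->
  \int[mrestr m mU]_x f x = \int[m]_(x in U) f x.
Proof.
move=> mf f0; rewrite -(setUv U) ge0_integral_setU//; last 3 first.
- exact: measurableC.
- by rewrite setUv.
- by rewrite disj_set2E setICr.
rewrite [X in _ + X](_ : _ = 0) ?adde0; last first.
  apply: null_set_integral; first exact: measurableC.
    exact: measurable_funTS.
  by rewrite /= /mrestr setICl measure0.
by apply: eq_measure_integral => A mA AU; rewrite /= /mrestr setIidl.
Qed.

End integral_mrestr.

(** * Integration over a tile of a lattice *)

(** What integration over the torus needs to know of a lattice: an enumeration e,
    for sums over the lattice, and a tile U for integrals. *)
Record lattice_tiling {R : realType} {d : nat} (Lambda : set 'cV[R]_d)
    (e : nat -> 'cV[R]_d) (U : set 'cV[R]_d) := LatticeTiling {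
  tiling_bij : set_bij setT Lambda e ;
  tilingD : forall k l, Lambda k -> Lambda l -> Lambda (k + l) ;
  tilingN : forall k, Lambda k -> Lambda (- k) ;
  tiling_discrete : forall n : nat, finite_set (Lambda `&` cube n%:R) ;
  tiling_measurable : measurable U ;
  tiling_bounded : exists n : nat, U `<=` cube n%:R ;
  tiling_tile : forall x, exists2 k, Lambda k & U (x - k) /\
    forall l, Lambda l -> U (x - l) -> l = k }.

Section tiling.
Context {R : realType} {d : nat}.
Local Notation lam := (lebesgue_cV d : {sigma_finite_measure set 'cV[R]_d -> \bar R}).
Variables (Lambda : set 'cV[R]_d) (e : nat -> 'cV[R]_d) (U : set 'cV[R]_d).
Hypothesis tl : lattice_tiling Lambda e U.
Local Open Scope ereal_scope.

Let eB : set_bij setT Lambda e. Proof. exact: (tiling_bij tl). Qed.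
Let LambdaD k l : Lambda k -> Lambda l -> Lambda (k + l)%R.
Proof. exact: (tilingD tl). Qed.
Let LambdaN k : Lambda k -> Lambda (- k)%R.
Proof. exact: (tilingN tl). Qed.
Let Lambda_discrete (n : nat) : finite_set (Lambda `&` cube n%:R).
Proof. exact: (tiling_discrete tl). Qed.
Let mU : measurable U. Proof. exact: (tiling_measurable tl). Qed.
Let U_bounded : exists n : nat, U `<=` cube n%:R.
Proof. exact: (tiling_bounded tl). Qed.
Let U_tile x : exists2 k, Lambda k & U (x - k)%R /\
  forall l, Lambda l -> U (x - l)%R -> l = k.
Proof. exact: (tiling_tile tl). Qed.

Lemma tiling_enum n : Lambda (e n). Proof. by case: eB => + _ _; apply. Qed.
Local Notation eL := tiling_enum.

Lemma lattice_reindex (s : 'cV[R]_d -> 'cV[R]_d) (F : 'cV[R]_d -> \bar R) :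
  set_bij Lambda Lambda s -> (forall k, 0 <= F k) ->
  \sum_(n <oo) F (s (e n)) = \sum_(n <oo) F (e n).
Proof.
move=> sB F0; rewrite !nneseries_esumT//.
rewrite -(reindex_esum setT Lambda e (F \o s))// -(reindex_esum setT Lambda e F)//.
by rewrite [RHS](reindex_esum Lambda Lambda s).
Qed.

Lemma lattice_bijD k : Lambda k -> set_bij Lambda Lambda (fun l => l + k)%R.
Proof.
move=> Lk; split.
- by move=> l Ll; exact: LambdaD.
- by move=> l l' _ _; exact: addIr.
- by move=> l Ll; exists (l - k)%R; [exact/LambdaD/LambdaN|rewrite subrK].
Qed.

Lemma lattice_bijN : set_bij Lambda Lambda -%R.
Proof.
split.
- by move=> l Ll; exact: LambdaN.
- by move=> l l' _ _; exact: oppr_inj.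
- by move=> l Ll; exists (- l)%R; [exact: LambdaN|rewrite opprK].
Qed.

Lemma tile_sumB (c : \bar R) x : 0 <= c ->
  \sum_(n <oo) (c * (\1_U (x - e n)%R)%:E) = c.
Proof.
move=> c0; have H k : 0 <= c * (\1_U (x - k)%R)%:E by rewrite mule_ge0// lee_fin.
rewrite (nneseries_esumT (a := fun n => c * (\1_U (x - e n)%R)%:E))//.
rewrite -(reindex_esum setT Lambda e (fun k => c * (\1_U (x - k)%R)%:E))//.
have [k Lk [Uk kU]] := U_tile x.
rewrite (esumID [set k]); last by move=> l _.
rewrite [X in _ + X]esum1 ?adde0; last first.
  move=> l [Ll /= lk]; rewrite indicE memNset ?mule0// => Ul; apply: lk.
  exact: kU.
rewrite (_ : _ `&` _ = [set k]); last by apply/seteqP; split => [l []|l ->].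
by rewrite esum_set1// indicE mem_set// mule1.
Qed.

Lemma tile_sum (c : \bar R) x : 0 <= c ->
  \sum_(n <oo) (c * (\1_U (x + e n)%R)%:E) = c.
Proof.
move=> c0; rewrite -[RHS](tile_sumB x c0).
rewrite -(lattice_reindex (F := fun k => c * (\1_U (x - k)%R)%:E) lattice_bijN).
  by apply: eq_eseriesr => n _; rewrite opprK.
by move=> k; rewrite mule_ge0// lee_fin.
Qed.

Lemma ge0_integral_translation (t : 'cV[R]_d) (D : set 'cV[R]_d) (f : 'cV[R]_d -> \bar R) :
  measurable D -> measurable_fun setT f -> (forall x, 0 <= f x) ->
  \int[lam]_(x in D) f x =
  \int[lam]_(x in aff_act (t, 1%:M) @^-1` D) f (aff_act (t, 1%:M) x).
Proof.
move=> mD mf f0; have := @ge0_integral_pushforward _ _ _ _ _ _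
  (measurable_affine (t, 1%:M)) lam D f mD (measurable_funTS mf) (fun y _ => f0 y).
move=> <-; apply: (@eq_measure_integral _ _ _ _ (aff_pushforward lam (t, 1%:M)%R) lam).
by move=> A mA _; rewrite /= /pushforward lebesgue_cV_translation.
Qed.

Lemma integral_tile (f : 'cV[R]_d -> \bar R) :
  measurable_fun setT f -> (forall x, 0 <= f x) ->
  \int[lam]_x f x = \sum_(n <oo) \int[lam]_(x in U) f (x + e n)%R.
Proof.
move=> mf f0.
pose F n := aff_act (- e n, 1%:M)%R @^-1` U.
have mF n : measurable (F n) by exact: measurable_affine_preimage.
have FT : \bigcup_n F n = setT.
  apply/seteqP; split => // x _; have [k Lk [Uk _]] := U_tile x.
  have [_ _ /(_ _ Lk)[n _ nk]] := eB.
  by exists n => //; rewrite /F /= /aff_act /= mul1mx nk.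
rewrite -FT ge0_integral_bigcup//.
- apply: eq_eseriesr => n _; rewrite (ge0_integral_translation (e n) (mF n))//.
  rewrite (_ : _ @^-1` F n = U); last first.
    by apply/seteqP; split => x; rewrite /F /= /aff_act /= !mul1mx addrK.
  by apply: eq_integral => x _; rewrite /aff_act mul1mx.
- exact: measurable_funTS.
- apply/trivIsetP => i j _ _ ij; apply/seteqP; split => // x [].
  rewrite /F /= /aff_act /= !mul1mx => Ui Uj.
  have [k Lk [Uk H]] := U_tile x; have [_ eI _] := eB.
  move: ij; rewrite (eI i j) ?eqxx ?inE//.
  by rewrite (H _ (eL i) Ui) (H _ (eL j) Uj).
Qed.

(** The translated tile is again a tile, and the integral of a periodic function
    is the same over all tiles. *)
Lemma integral_periodic_translation (t : 'cV[R]_d) (f : 'cV[R]_d -> \bar R) :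
  measurable_fun setT f -> (forall x, 0 <= f x) ->
  (forall x k, Lambda k -> f (x + k)%R = f x) ->
  \int[lam]_(x in U) f (x + t)%R = \int[lam]_(x in U) f x.
Proof.
move=> mf f0 fper.
pose D := aff_act (- t, 1%:M)%R @^-1` U.
have mD : measurable D by exact: measurable_affine_preimage.
transitivity (\int[lam]_(x in D) f x).
  rewrite (ge0_integral_translation t mD)//.
  rewrite (_ : _ @^-1` D = U); last first.
    by apply/seteqP; split => x; rewrite /D /= /aff_act /= !mul1mx addrK.
  by apply: eq_integral => x _; rewrite /aff_act mul1mx.
rewrite integral_mkcond integral_tile//; last 2 first.
- exact/(measurable_restrictT _ mD)/measurable_funTS.
- by move=> x; rewrite patchE; case: ifP.
rewrite -integral_nneseries//; last 2 first.
- move=> n; apply: measurable_funTS.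
  have H : measurable_fun setT (f \_ D).
    by apply/(measurable_restrictT _ mD); exact: measurable_funTS.
  by apply: (measurableT_comp H); exact: measurable_translation.
- by move=> n x _; rewrite patchE; case: ifP.
apply: eq_integral => x _.
transitivity (\sum_(n <oo) (f x * (\1_U (x - t + e n)%R)%:E)).
  apply: eq_eseriesr => n _; rewrite patchE indicE.
  rewrite (_ : (x + e n \in D)%R = (x - t + e n \in U)%R); last first.
    by apply/idP/idP; rewrite !inE /D /= /aff_act /= mul1mx addrAC.
  by case: ifP => _; rewrite ?mule1 ?mule0// fper//; exact: tiling_enum.
exact: tile_sum.
Qed.

Lemma lebesgue_tile_fin : lam U < +oo.
Proof.
have [n Un] := U_bounded.
apply: (@le_lt_trans _ _ (lam (cube n%:R))); last exact: lebesgue_cube_fin.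
by apply: le_measure; rewrite ?inE//; exact: measurable_cube.
Qed.

(** Countably many translates of the tile cover the space. *)
Lemma lebesgue_tile_gt0 : 0 < lam U.
Proof.
rewrite lt_neqAle measure_ge0 andbT; apply/negP => /eqP U0.
have := integral_tile (f := cst 1) (measurable_cst _) (fun=> lee01).
rewrite integral_cst// mul1e; under eq_eseriesr do rewrite integral_cst// -U0 mule0.
by rewrite eseries0// => T0; have := @lebesgue_setT_gt0 R d; rewrite T0 ltxx.
Qed.

Section endomorphism.
Variable b : 'M[R]_d.
Hypothesis bu : b \in unitmx.
Hypothesis bL : forall k, Lambda k -> Lambda (b *m k)%R.

Let m n : {measure set 'cV[R]_d -> \bar R} := aff_pushforward (mrestr lam mU) (e n, b).

Let mE n A : m n A = lam (aff_act (e n, b) @^-1` A `&` U).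
Proof. by []. Qed.

(* M A is the integral over the tile of the number of lattice points k with
   b x + k in A. *)
Let M : {measure set 'cV[R]_d -> \bar R} := mseries m 0.

Let M_integral (A : set 'cV[R]_d) : measurable A ->
  M A = \int[lam]_(x in U) \sum_(n <oo) (\1_A (b *m x + e n)%R)%:E.
Proof.
move=> mA.
have mf n : measurable_fun setT (fun x : 'cV[R]_d => (\1_A (b *m x + e n)%R : R)%:E).
  apply/measurable_EFinP.
  have : measurable_fun setT (\1_(aff_act (e n, b) @^-1` A) : 'cV[R]_d -> R).
    by apply: measurable_indic; exact: measurable_affine_preimage.
  by [].
rewrite integral_nneseries//; last by move=> n; exact: measurable_funTS.
apply: eq_eseriesr => n _.
transitivity (\int[lam]_(x in U) (\1_(aff_act (e n, b) @^-1` A) x)%:E) => //.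
by rewrite integral_indic//; exact: measurable_affine_preimage.
Qed.

Let M_translation t A : measurable A -> M (aff_act (t, 1%:M)%R @^-1` A) = M A.
Proof.
move=> mA; rewrite !M_integral//; last exact: measurable_affine_preimage.
pose f x := \sum_(n <oo) (\1_A (b *m x + e n)%R)%:E : \bar R.
have f0 x : 0 <= f x by apply: nneseries_ge0 => n _; rewrite lee_fin.
rewrite -(integral_periodic_translation (invmx b *m t)%R (f := f))//.
- apply: eq_integral => x _; apply: eq_eseriesr => n _.
  rewrite /= mulmxDr mulKVmx// addrAC !indicE.
  by congr (_%:R%:E); congr nat_of_bool; apply/idP/idP; rewrite !inE /= /aff_act /= mul1mx.
- apply: ge0_emeasurable_sum => [n x _ _|n _]; first by rewrite lee_fin.
  apply/measurable_EFinP.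
  have : measurable_fun setT (\1_(aff_act (e n, b) @^-1` A) : 'cV[R]_d -> R).
    by apply: measurable_indic; exact: measurable_affine_preimage.
  by [].
- move=> x k Lk; rewrite /f.
  rewrite -[RHS](lattice_reindex (F := fun l => (\1_A (b *m x + l)%R)%:E)
    (lattice_bijD (bL Lk))); last by move=> l; rewrite lee_fin.
  by apply: eq_eseriesr => n _; rewrite mulmxDr addrAC addrA.
Qed.

Let M_tile : M U = lam U.
Proof.
rewrite M_integral//.
rewrite (eq_integral (cst 1)) ?integral_cst ?mul1e// => x _.
rewrite -[RHS](tile_sum (b *m x)%R lee01); apply: eq_eseriesr => n _.
by rewrite mul1e.
Qed.

Let M_cube (n : nat) : M (cube n%:R) < +oo.
Proof.
have [u Uu] := U_bounded.
have [v v0 bv] := affine_cube (0%R, b) u.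
have [eI eT] : {in setT &, injective e} /\ set_surj setT Lambda e by case: eB.
(* Only the lattice vectors of norm < n + v can move b U into the cube of half
   side n. *)
pose F := e @^-1` (Lambda `&` cube (n + v)%:R).
have finF : finite_set F.
  apply: finite_preimage => //.
  by move=> i j _ _; apply: eI; rewrite inE.
have [K FK] : exists K : nat, F `<=` `I_K.
  exists (\max_(i <- finmap.enum_fset (fset_set F)) i).+1 => i Fi /=; rewrite ltnS.
  have iF : i \in finmap.enum_fset (fset_set F) by rewrite in_fset_set// inE.
  exact: (@leq_bigmax_seq nat _ predT id i iF isT).
have m0 i : (K <= i)%N -> m i (cube n%:R) = 0.
  move=> Ki; rewrite mE (_ : _ `&` _ = set0) ?measure0//.
  apply/seteqP; split => // x [/= xn Ux].
  suff /FK : F i by rewrite /= ltnNge Ki.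
  split; first exact: eL.
  move=> j; rewrite natrD (_ : e i j 0 = aff_act (e i, b) x j 0 - aff_act (0, b) x j 0)%R.
    have /(_ j) xnj := xn; have /(_ j) bxj := bv _ (Uu _ Ux).
    by rewrite (le_lt_trans (ler_normB _ _))// ltrD.
  by rewrite /aff_act /= addr0 [in RHS]mxE addrAC subrr add0r.
rewrite [M _](_ : _ = \sum_(0 <= k <oo) m k (cube n%:R))// (nneseries_split 0 K)//.
rewrite eseries0; last by move=> i Ki _; exact: m0.
rewrite adde0 add0n; apply: lte_sum_pinfty => i _.
rewrite (le_lt_trans _ lebesgue_tile_fin)// mE le_measure ?inE//.
by apply: measurableI => //; apply: measurable_affine_preimage; exact: measurable_cube.
Qed.

(** The left-hand side defines a translation invariant measure, which agrees
    with the Lebesgue measure on the tile U. *)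
Theorem integral_tile_endomorphism (f : 'cV[R]_d -> \bar R) :
  measurable_fun setT f -> (forall x, 0 <= f x) ->
  \sum_(n <oo) \int[lam]_(x in U) f (b *m x + e n)%R = \int[lam]_x f x.
Proof.
move=> mf f0.
have [c c0 Mc] := translation_invariant_measure M_translation M_cube.
have c1 : c = 1%R.
  have fU : lam U \is a fin_num by rewrite ge0_fin_numE// lebesgue_tile_fin.
  have := Mc U mU; rewrite M_tile -(fineK fU) -EFinM => -[] H.
  apply: (@mulIf _ (fine (lam U))); last by rewrite mul1r -H.
  by rewrite gt_eqF// fine_gt0// lebesgue_tile_gt0 lebesgue_tile_fin.
transitivity (\int[M]_x f x); last first.
  by apply: eq_measure_integral => A mA _; rewrite Mc// c1 mul1e.
rewrite ge0_integral_measure_series//.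
apply: eq_eseriesr => n _.
rewrite ge0_integral_pushforward//; last exact: measurable_affine.
rewrite preimage_setT integral_mrestr//; last by move=> x; exact: f0.
by apply: (measurableT_comp mf); exact: measurable_affine.
Qed.

End endomorphism.
End tiling.

(** * Periodic functions and expanding endomorphisms *)

Section almost_everywhere.
Context {d'} {T : measurableType d'} {R : realType}.
Variable mu : {measure set T -> \bar R}.

Lemma ae_measure_eq (A B : set T) : measurable A -> measurable B ->
  {ae mu, forall x, A x <-> B x} -> mu A = mu B.
Proof.
move=> mA mB AB.
have I X : measurable X -> mu X = (\int[mu]_x (\1_X x)%:E)%E.
  by move=> mX; rewrite integral_indic// setIT.
rewrite !I//; apply: ge0_ae_eq_integral => //.
- exact/measurable_EFinP/measurable_indic.
- exact/measurable_EFinP/measurable_indic.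
apply: filterS AB => x ABx _; rewrite !indicE; congr (_%:R%:E); congr nat_of_bool.
by apply/idP/idP; rewrite !inE => /ABx.
Qed.

Lemma ae_countable (I : choiceType) (S : set I) (P : I -> T -> Prop) : countable S ->
  (forall i, S i -> {ae mu, forall x, P i x}) ->
  {ae mu, forall x, forall i, S i -> P i x}.
Proof.
move=> /pfcard_geP[->|[f]] SP; first by apply: aeW => x i [].
have H : {ae mu, forall x, forall n, P (f n) x}.
  by apply/ae_foralln => n; apply: SP; exact: funS.
apply: filterS H => x Px i Si.
have [n _ <-] := @surj _ _ _ _ f i Si.
exact: Px.
Qed.

End almost_everywhere.

Section periodic.
Context {R : realType} {d : nat}.
Local Notation lam := (lebesgue_cV d : {sigma_finite_measure set 'cV[R]_d -> \bar R}).
Variables (Lambda : set 'cV[R]_d) (e : nat -> 'cV[R]_d) (U : set 'cV[R]_d).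
Hypothesis tl : lattice_tiling Lambda e U.
Local Open Scope ereal_scope.

(** A linear endomorphism of the lattice induces a measure preserving map of the
    torus. *)
Lemma measure_tile_endomorphism (b : 'M[R]_d) (E : set 'cV[R]_d) :
  b \in unitmx -> (forall k, Lambda k -> Lambda (b *m k)%R) -> measurable E ->
  (forall k, Lambda k -> {ae lam, forall x, E (x + k)%R <-> E x}) ->
  lam (U `&` (mulmx b @^-1` E)) = lam (U `&` E).
Proof.
move=> bu bL mE perE; have mU := tiling_measurable tl.
have mb k : measurable_fun setT (fun x : 'cV[R]_d => b *m x + k)%R.
  exact: (measurable_affine (k, b)).
have mbE : measurable (mulmx b @^-1` E).
  have := measurable_affine_preimage (0%R, b) mE; congr measurable.
  by apply/seteqP; split => x; rewrite /= /aff_act addr0.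
have mUE : measurable_fun setT (fun x => (\1_(U `&` E) x : R)%:E).
  by apply/measurable_EFinP; apply: measurable_indic; exact: measurableI.
have := integral_tile_endomorphism tl bu bL mUE (fun x => _).
rewrite integral_indic//; last exact: measurableI.
rewrite setIT => <-; last by move=> x; rewrite lee_fin.
rewrite -integral_nneseries//; last first.
  move=> n; apply: measurable_funTS.
  exact: (measurableT_comp mUE (mb (e n))).
transitivity (\int[lam]_(x in U) (\1_(mulmx b @^-1` E) x)%:E).
  by rewrite integral_indic// setIC.
apply: ge0_ae_eq_integral => //.
- exact/measurable_funTS/measurable_EFinP/measurable_indic.
- apply: measurable_funTS; apply: ge0_emeasurable_sum => [n x _ _|n _].
    by rewrite lee_fin.
  exact: (measurableT_comp mUE (mb (e n))).
- by move=> x _; apply: nneseries_ge0 => n _; rewrite lee_fin.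
have H : {ae lam, forall x, forall n, E (b *m x + e n)%R <-> E (b *m x)%R}.
  apply/ae_foralln => n.
  have := ae_affine (u := (0%R, b)) bu (perE _ (tiling_enum tl n)).
  by apply: filterS => x; rewrite /aff_act addr0.
apply: filterS H => x Ex _.
rewrite -[LHS](tile_sum tl (b *m x)%R); last by rewrite lee_fin.
apply: eq_eseriesr => n _; rewrite -EFinM !indicE -natrM mulnb andbC in_setI.
congr (_%:R%:E); congr nat_of_bool; congr andb.
by apply/idP/idP; rewrite !inE => /Ex.
Qed.

(** The level sets of phi satisfy lam (U & [phi > s]) <= lam (U & [phi > 2 s]),
    because the torus map of b preserves the measure, while the measure of
    [phi > 2^n s] tends to 0. *)
Theorem periodic_contraction (b : 'M[R]_d) (phi : 'cV[R]_d -> R) :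
  b \in unitmx -> (forall k, Lambda k -> Lambda (b *m k)%R) ->
  measurable_fun setT phi ->
  (forall k, Lambda k -> {ae lam, forall x, phi (x + k)%R = phi x}) ->
  {ae lam, forall x, (2 * phi x <= phi (b *m x))%R} ->
  {ae lam, forall x, (phi x <= 0)%R}.
Proof.
move=> bu bL mphi perphi phib; have mU := tiling_measurable tl.
pose E (s : R) := [set x | (s < phi x)%R].
have mE s : measurable (E s).
  rewrite (_ : E s = phi @^-1` `]s, +oo[%classic); last first.
    by apply/seteqP; split => x; rewrite /E /= in_itv /= andbT.
  by rewrite -[X in measurable X]setTI; exact: mphi.
have perE s k : Lambda k -> {ae lam, forall x, E s (x + k)%R <-> E s x}.
  by move=> Lk; apply: filterS (perphi _ Lk) => x; rewrite /E /= => ->.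
have step s : lam (U `&` E s) <= lam (U `&` E (2 * s)%R).
  rewrite -[leRHS](measure_tile_endomorphism bu bL (mE _) (perE _)).
  have [N [mN N0 HN]] := phib.
  have mbE : measurable (mulmx b @^-1` E (2 * s)%R).
    have := measurable_affine_preimage (0%R, b) (mE (2 * s)%R); congr measurable.
    by apply/seteqP; split => x; rewrite /= /aff_act addr0.
  rewrite -[leRHS]adde0 -N0.
  apply: le_trans (measureU2 _ _ _); [|exact: measurableI|exact: mN].
  apply: le_measure; rewrite ?inE.
  - exact: measurableI.
  - by apply: measurableU => //; exact: measurableI.
  move=> x [Ux Es]; have [xN|xN] := pselect (N x); [by right|left; split => //].
  have /(_ x) := subsetC HN; rewrite setCK => /(_ xN).
  by apply: lt_le_trans; rewrite ltr_pM2l.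
have E0 s : (0 < s)%R -> lam (U `&` E s) = 0.
  move=> s0; pose F n := U `&` E (2 ^+ n * s)%R.
  have mF n : measurable (F n) by exact: measurableI.
  have F0 : \bigcap_n F n = set0.
    apply/seteqP; split => // x Fx.
    have [n] : exists n : nat, (phi x / s < 2 ^+ n)%R.
      exists (Num.trunc (phi x / s)).+1.
      rewrite (lt_trans (truncnS_gt _))// -natrX ltr_nat.
      exact: ltn_expl.
    rewrite ltr_pdivrMr// => phix; have [_] := Fx n I.
    by rewrite /E /= ltNge (ltW phix).
  have : lam \o F @ \oo --> lam (\bigcap_n F n).
    apply: nonincreasing_cvg_mu => //.
    - apply: (@le_lt_trans _ _ (lam U)); last exact: lebesgue_tile_fin tl.
      by apply: le_measure; rewrite ?inE//; exact: subIsetl.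
    - by rewrite F0.
    - apply/nonincreasing_seqP => n; apply/subsetPset => x [Ux Ex]; split => //.
      move: Ex; rewrite /E /= exprS; apply: le_lt_trans.
      by rewrite -mulrA ler_peMl ?mulr_ge0 ?exprn_ge0 ?ltW// ltr1n.
  rewrite F0 measure0 => F_cvg; apply/eqP; rewrite -measure_le0.
  rewrite -(cvg_lim _ F_cvg)//; apply: lime_ge; first by apply/cvg_ex; exists 0.
  apply: nearW => n /=.
  elim: n => [|n IH]; first by rewrite /F expr0 mul1r.
  by rewrite (le_trans IH)// /F exprS -mulrA; exact: step.
have E0' s : (0 < s)%R -> lam (E s) = 0.
  move=> s0; have mEs : measurable_fun setT (fun x => (\1_(E s) x : R)%:E).
    exact/measurable_EFinP/measurable_indic.
  have := integral_tile tl mEs (fun x => _).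
  rewrite integral_indic// setIT => ->; last by move=> x; rewrite lee_fin.
  rewrite eseries0// => n _ _.
  rewrite (ge0_ae_eq_integral (g := fun x => (\1_(E s) x)%:E))//.
  - by rewrite integral_indic// setIC E0.
  - apply: measurable_funTS; apply: (measurableT_comp mEs).
    exact: measurable_translation.
  - exact: measurable_funTS.
  apply: filterS (perE s _ (tiling_enum tl n)) => x Ex _.
  rewrite !indicE; congr (_%:R%:E); congr nat_of_bool.
  by apply/idP/idP; rewrite !inE => /Ex.
exists (\bigcup_n E n.+1%:R^-1%R); split.
- by apply: bigcupT_measurable => n; exact: mE.
- apply/negligibleP; first by apply: bigcupT_measurable => n; exact: mE.
  by apply: negligible_bigcup => n; apply/negligibleP => //; apply: E0'; rewrite invr_gt0.
- move=> x /negP; rewrite -ltNge => phi0.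
  exists (Num.trunc (phi x)^-1) => //; rewrite /E /= invf_plt ?posrE//.
  exact: truncnS_gt.
Qed.

End periodic.

(** * Functions invariant under a dense set of translations *)

Section ergodicity.
Context {R : realType} {d : nat}.
Local Notation lam := (lebesgue_cV d : {sigma_finite_measure set 'cV[R]_d -> \bar R}).
Variable D : set 'cV[R]_d.
Hypothesis D_dense : forall (x : 'cV[R]_d) (eps : R), 0 < eps ->
  exists2 t, D t & forall i, `|x i 0 - t i 0| < eps.
Local Open Scope ereal_scope.

Section invariant_set.
Variable E : set 'cV[R]_d.
Hypothesis mE : measurable E.
Hypothesis E_inv : forall t, D t -> {ae lam, forall x, E (x + t)%R <-> E x}.

Let translate (A : set 'cV[R]_d) (t : 'cV[R]_d) := [set x | A (x - t)%R].

Let mtranslate A t : measurable A -> measurable (translate A t).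
Proof.
move=> mA; have := measurable_affine_preimage (- t, 1%:M)%R mA; congr measurable.
by apply/seteqP; split => x; rewrite /= /aff_act mul1mx.
Qed.

Let translate_dense A t : measurable A -> D t ->
  lam (translate A t `&` E) = lam (A `&` E).
Proof.
move=> mA Dt; have mAt : measurable (translate A t) by exact: mtranslate.
rewrite -(lebesgue_cV_translation t (A := translate A t `&` E)); last exact: measurableI.
have mE' : measurable (aff_act (t, 1%:M)%R @^-1` E) by exact: measurable_affine_preimage.
rewrite (_ : _ @^-1` _ = A `&` (aff_act (t, 1%:M)%R @^-1` E)); last first.
  by apply/seteqP; split => x; rewrite /translate /= /aff_act /= !mul1mx addrK.
apply: ae_measure_eq; [exact: measurableI|exact: measurableI|].
apply: filterS (E_inv Dt) => x Ex; rewrite /= /aff_act /= mul1mx.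
by split => -[Ax /Ex].
Qed.

(* An open set is the union of these closed sets; a translation by a vector of D
   close to t carries shrink O n into O + t. *)
Let shrink (O : set 'cV[R]_d) (n : nat) : set 'cV[R]_d :=
  [set x | forall y : 'cV[R]_d, (forall i, `|x i 0 - y i 0| < n.+1%:R^-1)%R -> O y].

Let closed_shrink O n : closed (shrink O n).
Proof.
rewrite -[shrink O n]setCK; apply: open_closedC; rewrite openE => x.
move=> /existsNP[y /not_implyP[xy yO]].
exists (fun i j => [set z | `|z - y i 0| < n.+1%:R^-1]%R).
  move=> i j; rewrite ord1.
  have : open_nbhs (x i 0)%R [set z | `|z - y i 0| < n.+1%:R^-1]%R.
    split; last exact: xy.
    have := @ball_open R R (y i 0)%R n.+1%:R^-1%R; congr open.
    by apply/seteqP; split => z; rewrite /ball /= distrC.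
  exact: open_nbhs_nbhs.
move=> z H /(_ y) Oy; apply: yO; apply: Oy => i; exact: H.
Qed.

Let translate_open_le O t : open O -> lam (O `&` E) <= lam (translate O t `&` E).
Proof.
move=> oO; have mO := open_measurable_cV oO.
have mS n : measurable (shrink O n) by apply: closed_measurable_cV; exact: closed_shrink.
have H n : lam (shrink O n `&` E) <= lam (translate O t `&` E).
  have n0 : (0 < n.+1%:R^-1 :> R)%R by rewrite invr_gt0.
  have [t' Dt' tt'] := D_dense t n0.
  rewrite -(translate_dense (mS n) Dt'); apply: le_measure; rewrite ?inE.
  - by apply: measurableI => //; exact: mtranslate.
  - by apply: measurableI => //; exact: mtranslate.
  - move=> x [Sx Ex]; split => //; apply: Sx => i.
    rewrite (_ : _ - _ = t i 0 - t' i 0)%R ?tt'//.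
    by rewrite !mxE; ring.
have : lam \o (fun n => shrink O n `&` E) @ \oo --> lam (\bigcup_n (shrink O n `&` E)).
  apply: nondecreasing_cvg_mu.
  - by move=> n; exact: measurableI.
  - by apply: bigcupT_measurable => n; exact: measurableI.
  - apply/nondecreasing_seqP => n; apply/subsetPset => x [Sx Ex]; split => // y xy.
    apply: Sx => i; rewrite (lt_le_trans (xy i))// lef_pV2 ?posrE// ler_nat//.
rewrite -setI_bigcupl (_ : \bigcup_n shrink O n = O); last first.
  apply/seteqP; split => [x [n _]|x Ox]; first by apply => i; rewrite subrr normr0 invr_gt0.
  have /nbhs_cV[eps eps0 epsO] : nbhs x O by exact: open_nbhs_nbhs.
  exists (Num.trunc eps^-1) => // y xy; apply: epsO => i; rewrite (lt_trans (xy i))//.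
  by rewrite invf_plt ?posrE// truncnS_gt.
move=> O_cvg; rewrite -(cvg_lim _ O_cvg)//; apply: lime_le; first by apply/cvg_ex; exists (lam (O `&` E)).
by apply: nearW.
Qed.

Let translate_open O t : open O -> lam (translate O t `&` E) = lam (O `&` E).
Proof.
move=> oO; apply/eqP; rewrite eq_le translate_open_le// andbT.
have oOt : open (translate O t).
  rewrite openE => x Ox; have /nbhs_cV[eps eps0 epsO] : nbhs (x - t)%R O.
    exact: open_nbhs_nbhs.
  apply/nbhs_ballP; exists eps => //= y [_ xy]; apply: epsO => i.
  rewrite (_ : _ - _ = x i 0 - y i 0)%R; last by rewrite !mxE; ring.
  exact: (xy i 0%R).
have := translate_open_le (- t)%R oOt.
rewrite [X in _ <= lam (X `&` _)](_ : _ = O)//.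
by apply/seteqP; split => x; rewrite /translate /= opprK addrK.
Qed.

(** The restriction of the Lebesgue measure to E is invariant under a dense set
    of translations, hence, on open sets and then on all sets, under all of
    them; it is therefore a multiple c of the Lebesgue measure. Either c = 0, or
    the complement of E is null. *)
Lemma dense_invariant_set :
  {ae lam, forall x, E x} \/ {ae lam, forall x, ~ E x}.
Proof.
pose nu : {measure set 'cV[R]_d -> \bar R} := mrestr lam mE.
have nu_cube (n : nat) : nu (cube n%:R) < +oo.
  apply: (@le_lt_trans _ _ (lam (cube n%:R))); last exact: lebesgue_cube_fin.
  apply: le_measure; rewrite ?inE; [|exact: measurable_cube|exact: subIsetl].
  by apply: measurableI => //; exact: measurable_cube.
have nu_translation t A : measurable A -> nu (aff_act (t, 1%:M)%R @^-1` A) = nu A.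
  have H O : open O -> nu (aff_act (t, 1%:M)%R @^-1` O) = nu O.
    move=> oO; rewrite /nu /= /mrestr -[RHS](translate_open (- t)%R)//.
    congr (lebesgue_cV d (_ `&` _)).
    by apply/seteqP; split => x; rewrite /translate /= /aff_act mul1mx opprK.
  have H' A' : (forall i, open (A' i)) ->
      nu (aff_act (t, 1%:M)%R @^-1` (box A')) = nu (box A').
    move=> oA; apply: H; rewrite openE => x Ax.
    exists (fun i j => A' i) => [i j|y Ay i]; last exact: Ay.
    by rewrite ord1; apply: open_nbhs_nbhs; split => //; exact: Ax.
  apply: (cV_measure_unique (m1 := aff_pushforward nu (t, 1%:M)%R)) => //.
  move=> n; rewrite /= /pushforward cubeE H'; last by move=> i; exact: interval_open.
  by rewrite -cubeE; exact: nu_cube.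
have [c c0 nuc] := translation_invariant_measure nu_translation nu_cube.
have [c_eq0|c_neq0] := eqVneq c 0%R; [right|left].
  apply/negligibleP; first by rewrite setCK.
  rewrite setCK; have := nuc _ mE; rewrite c_eq0 mul0e /nu /= /mrestr setIid.
  by [].
apply/negligibleP; first exact: measurableC.
have := nuc _ (measurableC mE); rewrite /nu /= /mrestr setICl measure0.
move=> /esym/eqP; rewrite mule_eq0 eqe (negbTE c_neq0) /= => /eqP.
by [].
Qed.

End invariant_set.

Lemma ae_exists (P : 'cV[R]_d -> Prop) : {ae lam, forall x, P x} -> exists x, P x.
Proof.
move=> [N [mN N0 PN]]; apply: contrapT => /forallNP nP.
have := @lebesgue_setT_gt0 R d; rewrite (_ : setT = N) ?N0 ?ltxx//.
by apply/seteqP; split => // x _; apply: PN; exact: nP.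
Qed.

(** Each level set [g > q] is null or conull; g is almost everywhere the
    supremum of the q of the second kind. *)
Theorem dense_invariant_constant (g : 'cV[R]_d -> R) :
  measurable_fun setT g ->
  (forall t, D t -> {ae lam, forall x, g (x + t)%R = g x}) ->
  exists c : R, {ae lam, forall x, g x = c}.
Proof.
move=> mg ginv.
have dich (q : R) : {ae lam, forall x, (q < g x)%R} \/ {ae lam, forall x, (g x <= q)%R}.
  have mE : measurable [set x | (q < g x)%R].
    rewrite (_ : [set x | _] = g @^-1` `]q, +oo[%classic); last first.
      by apply/seteqP; split => x; rewrite /= in_itv /= andbT.
    by rewrite -[X in measurable X]setTI; exact: mg.
  have [|H|H] := @dense_invariant_set _ mE.
  - by move=> t Dt; apply: filterS (ginv t Dt) => x /= ->.
  - by left.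
  - by right; apply: filterS H => x /negP; rewrite -leNgt.
pose S := [set q : R | {ae lam, forall x, (q < g x)%R}].
have S0 : S !=set0.
  apply: contrapT => S0.
  have [x Hx] : exists x, forall n : nat, (g x <= - n%:R)%R.
    apply: ae_exists; apply/ae_foralln => n; have [Sn|//] := dich (- n%:R)%R.
    by case: S0; exists (- n%:R)%R.
  have := Hx (Num.trunc (- g x)).+1; rewrite lerNr leNgt.
  by rewrite truncnS_gt.
have [q0 Hq0] : exists q, {ae lam, forall x, (g x <= q)%R}.
  apply: contrapT => /forallNP H.
  have [x Hx] : exists x, forall n : nat, (n%:R < g x)%R.
    apply: ae_exists; apply/ae_foralln => n; have [//|Hn] := dich n%:R.
    by case: (H n%:R).
  by have := Hx (Num.trunc (g x)).+1; rewrite ltNge (ltW (truncnS_gt _)).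
have S_sup : has_sup S.
  split => //; exists q0 => q Sq; rewrite leNgt; apply/negP => q0q.
  have [x [Hx1 Hx2]] : exists x, (q < g x)%R /\ (g x <= q0)%R.
    by apply: ae_exists; apply: filterS2 Sq Hq0.
  by move: (lt_le_trans Hx1 Hx2); rewrite ltNge (ltW q0q).
exists (sup S).
have H : {ae lam, forall x, forall q : rat, [set: rat] q ->
    ((ratr q < sup S)%R -> (ratr q < g x)%R) /\ ((sup S < ratr q)%R -> (g x <= ratr q)%R)}.
  apply: ae_countable => [|q _]; first exact: countableP.
  have [Sq|Hq] := dich (ratr q).
    apply: filterS (Sq) => x qx; split => // cq.
    have : (ratr q <= sup S)%R by exact: (sup_upper_bound S_sup Sq).
    by rewrite leNgt cq.
  have [qc|qc] := ltP (ratr q) (sup S); last first.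
    by apply: filterS Hq => x xq; split => //; rewrite ltNge qc.
  have [s Ss qs] := sup_adherent (eps := sup S - ratr q)%R ltac:(by rewrite subr_gt0) S_sup.
  move: qs; rewrite opprB addrC subrK => qs.
  apply: filterS Ss => x sx; split => [_|cq]; first exact: lt_trans qs sx.
  by move: cq; rewrite ltNge (ltW qc).
apply: filterS H => x Hx; apply/eqP; rewrite eq_le; apply/andP; split; rewrite leNgt; apply/negP.
  move=> /rat_in_itvoo[q]; rewrite in_itv /= => /andP[q1 q2].
  by have [_ /(_ q1)] := Hx q I; rewrite leNgt q2.
move=> /rat_in_itvoo[q]; rewrite in_itv /= => /andP[q1 q2].
by have [/(_ q2) + _] := Hx q I; rewrite ltNge (ltW q1).
Qed.

End ergodicity.

(** * Crystal groups *)

Lemma fsbig_supported (V : nmodType) (I : choiceType) (S A : set I) (F : I -> V) :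
  finite_set A -> A `<=` S -> (forall i, S i -> ~ A i -> F i = 0) ->
  \sum_(i \in S) F i = \sum_(i <- finmap.enum_fset (fset_set A)) F i.
Proof.
move=> finA AS F0; rewrite -fsbig_finite//; apply/esym/fsbig_widen => // i [Si nAi].
exact: F0.
Qed.

Section crystal_group.
Context {R : realType} {d : nat}.
Variables (Gamma : set (affine R d)) (G : set 'M[R]_d) (Lambda : set 'cV[R]_d).
Hypothesis crystal : splitting_crystal_triple Gamma G Lambda.
Implicit Types (u w : affine R d) (g : 'M[R]_d) (k x : 'cV[R]_d).

Lemma crystalE u : Gamma u <-> Lambda u.1 /\ G u.2.
Proof. by case: crystal => _ _ _ ->. Qed.

Lemma crystal_point_finite : finite_set G.
Proof. by case: crystal => _ [? _ _ _ _]. Qed.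

Lemma crystal_point1 : G 1%:M.
Proof. by case: crystal => _ [_ ? _ _ _]. Qed.

Lemma crystal_point_unit g : G g -> g \in unitmx.
Proof.
by case: crystal => _ [_ _ _ _ GO] _ _ /GO/mulmx1_unit[].
Qed.

Lemma crystal_unit u : Gamma u -> u.2 \in unitmx.
Proof. by move=> /crystalE[_]; exact: crystal_point_unit. Qed.

Lemma crystal_lattice_mul g k : G g -> Lambda k -> Lambda (g *m k).
Proof.
by case: crystal => _ _ GL _ Gg Lk; rewrite -GL; exists g => //; exists k.
Qed.

Lemma lattice0 : Lambda 0.
Proof.
case: crystal => -[B _ ->] _ _ _; exists 0 => //.
by rewrite map_mx0 mulmx0.
Qed.

Lemma latticeD k l : Lambda k -> Lambda l -> Lambda (k + l).
Proof.
case: crystal => -[B _ ->] _ _ _ [z _ <-] [w _ <-]; exists (z + w) => //.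
by rewrite map_mxD mulmxDr.
Qed.

Lemma latticeN k : Lambda k -> Lambda (- k).
Proof.
case: crystal => -[B _ ->] _ _ _ [z _ <-]; exists (- z) => //.
by rewrite map_mxN mulmxN.
Qed.

Lemma crystal1 : Gamma aff1.
Proof. by apply/crystalE; split; [exact: lattice0|exact: crystal_point1]. Qed.

Lemma crystalM u w : Gamma u -> Gamma w -> Gamma (aff_mul u w).
Proof.
move=> /crystalE[Lu Gu] /crystalE[Lw Gw]; apply/crystalE; split => /=.
  by apply: latticeD => //; exact: crystal_lattice_mul.
by case: crystal => _ [_ _ GM _ _] _ _; exact: GM.
Qed.

Lemma crystalV u : Gamma u -> Gamma (aff_inv u).
Proof.
move=> /crystalE[Lu Gu]; have GV : G (invmx u.2).
  by case: crystal => _ [_ _ _ GV _] _ _; exact: GV.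
by apply/crystalE; split => //=; apply/latticeN/crystal_lattice_mul.
Qed.

Lemma crystal_translation k : Lambda k -> Gamma (k, 1%:M).
Proof. by move=> Lk; apply/crystalE; split => //; exact: crystal_point1. Qed.

Lemma lattice_countable : countable Lambda.
Proof.
case: crystal => -[B _ ->] _ _ _.
by apply: (card_le_trans (card_image_le _ _)); exact: countableP.
Qed.

Lemma crystal_countable : countable Gamma.
Proof.
case: crystal => _ _ _ ->; apply: countableX; first exact: lattice_countable.
exact/finite_set_countable/crystal_point_finite.
Qed.

Lemma crystal_set_bijMr w : Gamma w -> set_bij Gamma Gamma (fun u => aff_mul u w).
Proof.
move=> Gw; have wu := crystal_unit Gw; split.
- by move=> u Gu; exact: crystalM.
- move=> u v _ _ /= /(congr1 (fun z : affine R d => aff_mul z (aff_inv w))).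
  by rewrite -!aff_mulA aff_mulV// !aff_mulr1.
- move=> u Gu; exists (aff_mul u (aff_inv w)).
    by apply: crystalM => //; exact: crystalV.
  by rewrite -aff_mulA aff_mulVl// aff_mulr1.
Qed.

Lemma crystal_set_bij_div u : Gamma u ->
  set_bij Gamma Gamma (fun w => aff_mul u (aff_inv w)).
Proof.
move=> Gu; have uu := crystal_unit Gu; split.
- by move=> w Gw; apply: crystalM => //; exact: crystalV.
- move=> w v; rewrite !inE => Gw Gv /= wv.
  have K z : Gamma z -> aff_mul (aff_inv (aff_mul u (aff_inv z))) u = z.
    move=> Gz; have zu := crystal_unit Gz.
    by rewrite aff_inv_div// -aff_mulA aff_mulVl// aff_mulr1.
  by rewrite -(K _ Gw) wv K.
- move=> v Gv; have vu := crystal_unit Gv.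
  exists (aff_mul (aff_inv v) u); first by apply: crystalM => //; exact: crystalV.
  rewrite /= (aff_inv_unique (w := aff_mul (aff_inv u) v)).
  + by rewrite aff_mulA aff_mulV// aff_mul1.
  + by rewrite unitmx_mul unitmx_inv vu.
  + by rewrite -aff_mulA [aff_mul u _]aff_mulA aff_mulV// aff_mul1 aff_mulVl.
Qed.

Lemma finite_bounded_int (n : nat) :
  finite_set [set z : 'cV[int]_d | forall i, (`|z i 0%R| <= n)%N].
Proof.
pose F (phi : {ffun 'I_d -> 'I_(2 * n).+1}) : 'cV[int]_d :=
  \col_i ((phi i : nat)%:Z - n%:Z)%R.
apply: (@sub_finite_set _ _ (F @` setT)); last by apply: finite_image; exact: finite_finset.
move=> z zn; exists [ffun i => inord (absz (z i 0 + n%:Z))] => //.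
apply/colP => i; rewrite mxE ffunE inordK; have := zn i; lia.
Qed.

Lemma lattice_discrete (n : nat) : finite_set (Lambda `&` cube n%:R).
Proof.
case: crystal => -[B Bu ->] _ _ _.
have [m m0 H] := affine_cube (0, invmx B) n.
apply: (sub_finite_set _ (finite_image (fun z : 'cV[int]_d => B *m map_mx intr z)
  (finite_bounded_int m))).
move=> _ [[z _ <-] zn]; exists z => // i.
have := H _ zn i; rewrite /aff_act /= addr0 mulKmx// mxE.
by rewrite -intr_norm (_ : m%:R = m%:Z%:~R)// ltr_int; lia.
Qed.

(** If x and g x + k are bounded, so is k; and the lattice is discrete. *)
Lemma crystal_locally_finite (n m : nat) :
  finite_set [set u | Gamma u /\ exists2 x, cube n%:R x & cube m%:R (aff_act u x)].
Proof.
pose K g := projT1 (cid2 (@affine_cube R d (0, g) n)).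
have KP g x : cube n%:R x -> cube (K g)%:R (g *m x).
  by rewrite /K; case: cid2 => k _ H /= /H; rewrite /aff_act addr0.
apply: (@sub_finite_set _ _ (\bigcup_(g in G)
    ((Lambda `&` cube (m + K g)%:R) `*` [set g]))); last first.
  apply: bigcup_finite; first exact: crystal_point_finite.
  by move=> g Gg; apply: finite_setX => //; exact: lattice_discrete.
move=> [k g] [/crystalE[/= Lk Gg] [x xn kgx]]; exists g => //; split => //=; split => // i.
rewrite (_ : k i 0 = aff_act (k, g) x i 0 - (g *m x) i 0); last first.
  by rewrite /aff_act /= [in RHS]mxE addrAC subrr add0r.
have /(_ i) kgxi := kgx; have /(_ i) gxi := KP g x xn.
by rewrite natrD (le_lt_trans (ler_normB _ _))// ltrD.
Qed.

(** The image of the half-open unit cube under a basis of the lattice is a tile.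
    In dimension 0 the lattice would be finite. *)
Lemma lattice_tiling_exists : (0 < d)%N -> exists e U, lattice_tiling Lambda e U.
Proof.
move=> d0; have [B Bu LE] : is_lattice Lambda by case: crystal.
have [e eB] : exists e : nat -> 'cV[R]_d, set_bij setT Lambda e.
  apply/card_set_bijP; rewrite card_eq_sym; apply: eq_card_nat; first exact: lattice_countable.
  move=> finL; apply: infinite_nat.
  pose h (n : nat) : 'cV[R]_d := B *m map_mx intr (const_mx n%:Z).
  rewrite (_ : setT = h @^-1` Lambda); last first.
    by apply/seteqP; split => // n _; rewrite /= LE; exists (const_mx n%:Z).
  apply: finite_preimage => // m n _ _ /(congr1 (mulmx (invmx B))).
  rewrite !mulKmx// => /matrixP/(_ (Ordinal d0) 0); rewrite !mxE.
  by move=> /(@intr_inj R) [].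
exists e, (aff_act (0, invmx B) @^-1` box (fun=> `[0, 1[%classic)).
split.
- exact: eB.
- exact: latticeD.
- exact: latticeN.
- exact: lattice_discrete.
- by apply: measurable_affine_preimage; apply: measurable_box => i; exact: measurable_itv.
- have [m _ H] := affine_cube (0, B) 1.
  exists m => x xU; have := H (invmx B *m x); rewrite /aff_act /= addr0 mulKVmx//; apply.
  move=> i; have := xU i; rewrite /aff_act /= addr0 in_itv /= => /andP[x0 x1].
  by rewrite ger0_norm.
move=> x; pose z : 'cV[int]_d := \col_i Num.floor ((invmx B *m x) i 0).
exists (B *m map_mx intr z); first by rewrite LE; exists z.
have E l : (invmx B *m (x - B *m l)) = invmx B *m x - l.
  by rewrite mulmxBr mulKmx.
split.
  move=> i; rewrite /aff_act /= addr0 E in_itv /= !mxE subr_ge0 ltrBlDl.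
  by rewrite floor_le /= (lt_le_trans (floorD1_gt _))// intrD.
move=> l; rewrite LE => -[w _ <-] wU; congr (_ *m map_mx _ _); apply/colP => i.
have wx : 0 <= (invmx B *m x) i 0 - (w i 0)%:~R < 1.
  by have := wU i; rewrite /aff_act /= addr0 E in_itv /= !mxE.
rewrite subr_ge0 ltrBlDl in wx.
by rewrite /z [RHS]mxE; apply/esym/floor_def; rewrite intrD.
Qed.

End crystal_group.

(** * Measurable complex functions *)

Section complex_measurable.
Context {R : realType} {d : nat}.
Implicit Types (f g : 'cV[R]_d -> R[i]) (D : set 'cV[R]_d).

Definition cmeasurable f := measurable_fun setT (fun x => complex.Re (f x)) /\
  measurable_fun setT (fun x => complex.Im (f x)).

Lemma cmeasurableD f g : cmeasurable f -> cmeasurable g ->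
  cmeasurable (fun x => f x + g x).
Proof.
move=> [f1 f2] [g1 g2]; split.
  under eq_fun do rewrite (raddfD (@complex.Re R)); exact: measurable_funD.
under eq_fun do rewrite (raddfD (@complex.Im R)); exact: measurable_funD.
Qed.

Lemma cmeasurableM (c : R[i]) f : cmeasurable f -> cmeasurable (fun x => c * f x).
Proof.
case: c => p q [f1 f2]; split.
  rewrite (_ : (fun _ => _) = fun x => p * complex.Re (f x) - q * complex.Im (f x)); last first.
    by apply/funext => x; case: (f x).
  by apply: measurable_funB; apply: measurable_funM => //; exact: measurable_cst.
rewrite (_ : (fun _ => _) = fun x => p * complex.Im (f x) + q * complex.Re (f x)); last first.
  by apply/funext => x; case: (f x).
by apply: measurable_funD; apply: measurable_funM => //; exact: measurable_cst.
Qed.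

Lemma cmeasurable0 : cmeasurable (fun=> 0).
Proof. by split; exact: measurable_cst. Qed.

Lemma cmeasurable_sum (I : Type) (r : seq I) (F : I -> 'cV[R]_d -> R[i]) :
  (forall i, cmeasurable (F i)) -> cmeasurable (fun x => \sum_(i <- r) F i x).
Proof.
move=> mF; elim: r => [|i r IH].
  by under eq_fun do rewrite big_nil; exact: cmeasurable0.
by under eq_fun do rewrite big_cons; exact: cmeasurableD.
Qed.

Lemma cmeasurable_affine f u : cmeasurable f -> cmeasurable (fun x => f (aff_act u x)).
Proof.
by move=> [f1 f2]; split;
  [exact: (measurableT_comp f1 (measurable_affine u))
  |exact: (measurableT_comp f2 (measurable_affine u))].
Qed.

Lemma cmeasurable_real (h : 'cV[R]_d -> R) : measurable_fun setT h ->
  cmeasurable (fun x => (h x)%:C%C).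
Proof. by move=> mh; split => //=; exact: measurable_cst. Qed.

Lemma measurable_cmod f : cmeasurable f -> measurable_fun setT (fun x => cmod (f x)).
Proof.
move=> [f1 f2].
rewrite (_ : (fun _ => _) = fun x => Num.sqrt (complex.Re (f x) ^+ 2 + complex.Im (f x) ^+ 2)).
  apply: measurableT_comp.
    by apply: continuous_measurable_fun; exact: sqrt_continuous.
  by apply: measurable_funD; exact: measurable_funX.
by apply/funext => x; rewrite /cmod normc_def /=; case: (f x).
Qed.

Lemma measurable_monom (m : 'I_d -> nat) : measurable_fun setT (@monom R d m).
Proof.
rewrite /monom; apply: measurable_prod => i _; apply: measurable_funX.
exact: measurable_cV_coord.
Qed.

(** What makes locally finite sums measurable: the space is a countable union of
    cubes. *)
Lemma cmeasurable_local f (g : nat -> 'cV[R]_d -> R[i]) :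
  (forall n, cmeasurable (g n)) ->
  (forall n x, cube n%:R x -> f x = g n x) -> cmeasurable f.
Proof.
move=> mg fg; have H (Q : R[i] -> R) :
    (forall n, measurable_fun setT (fun x => Q (g n x))) ->
    measurable_fun setT (fun x => Q (f x)).
  move=> mQ; rewrite -cube_cover; apply/measurable_fun_bigcup => n.
    exact: measurable_cube.
  apply: (@eq_measurable_fun _ _ _ _ _ (fun x => Q (g n x))).
    by move=> x; rewrite inE => xn; rewrite (fg n).
  exact: measurable_funTS.
by split; apply: H => n; case: (mg n).
Qed.

End complex_measurable.

(** * Series of translates *)

Section translate_sums.
Context {R : realType} {d : nat}.
Variables (Gamma : set (affine R d)) (G : set 'M[R]_d) (Lambda : set 'cV[R]_d).
Hypothesis crystal : splitting_crystal_triple Gamma G Lambda.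
Variables (f : 'cV[R]_d -> R[i]) (n0 : nat).
Hypothesis f_supp : forall x, f x != 0 -> cube n0%:R x.
Local Notation lam := (lebesgue_cV d : {sigma_finite_measure set 'cV[R]_d -> \bar R}).
Implicit Types (b : affine R d -> R[i]) (u w : affine R d).

Definition tsum b x : R[i] := \sum_(u \in Gamma) b u * f (aff_act u x).

(** As f vanishes off the cube of half side n0, the sums over Gamma below reduce,
    on the cube of half side n, to sums over this finite set. *)
Definition active (n : nat) : set (affine R d) :=
  [set u | Gamma u /\ exists2 x, cube n%:R x & cube n0%:R (aff_act u x)].

Lemma active_finite n : finite_set (active n).
Proof. exact: crystal_locally_finite crystal n n0. Qed.

Definition active_seq n := finmap.enum_fset (fset_set (active n)).

Lemma mem_active n u : u \in active_seq n -> Gamma u.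
Proof.
by rewrite /active_seq in_fset_set ?inE; [case|exact: active_finite].
Qed.

Lemma activeP n x u : cube n%:R x -> Gamma u -> ~ active n u -> f (aff_act u x) = 0.
Proof.
move=> xn Gu; apply: contra_notP => /eqP /f_supp fu.
by split => //; exists x.
Qed.

Lemma active_sum (V : nmodType) n x (F : affine R d -> V) : cube n%:R x ->
  (forall u, f (aff_act u x) = 0 -> F u = 0) ->
  \sum_(u \in Gamma) F u = \sum_(u <- active_seq n) F u.
Proof.
move=> xn F0; rewrite (@fsbig_supported _ _ _ (active n))//.
- exact: active_finite.
- by move=> u [].
- by move=> u Gu nu; apply: F0; exact: activeP nu.
Qed.

Lemma tsum_local n b x : cube n%:R x ->
  tsum b x = \sum_(u <- active_seq n) b u * f (aff_act u x).
Proof. by move=> xn; apply: active_sum => // u ->; rewrite mulr0. Qed.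

Lemma tsum_pt x : exists r : seq (affine R d), forall b,
  tsum b x = \sum_(u <- r) b u * f (aff_act u x).
Proof.
have [n _ xn] : (\bigcup_n cube n%:R) x by rewrite cube_cover.
by exists (active_seq n) => b; exact: tsum_local.
Qed.

Lemma eq_tsum b b' x : (forall u, Gamma u -> b u = b' u) -> tsum b x = tsum b' x.
Proof. by move=> bb'; apply: eq_fsbigr => u; rewrite inE => /bb' ->. Qed.

Lemma tsum_sum (I : Type) (r : seq I) (P : pred I) (F : I -> affine R d -> R[i]) x :
  tsum (fun u => \sum_(i <- r | P i) F i u) x = \sum_(i <- r | P i) tsum (F i) x.
Proof.
have [s sE] := tsum_pt x; rewrite sE.
under [RHS]eq_bigr do rewrite sE.
rewrite exchange_big /=; apply: eq_bigr => u _.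
by rewrite mulr_suml.
Qed.

Lemma tsumZ (c : R[i]) b x : tsum (fun u => c * b u) x = c * tsum b x.
Proof. by rewrite /tsum mulr_fsumr; apply: eq_fsbigr => u _; rewrite mulrA. Qed.

Lemma tsumB b b' x : tsum (fun u => b u - b' u) x = tsum b x - tsum b' x.
Proof.
have [s sE] := tsum_pt x; rewrite !sE -sumrB; apply: eq_bigr => u _.
by rewrite mulrBl.
Qed.

Lemma tsum_act b w x : Gamma w ->
  tsum b (aff_act w x) = tsum (fun u => b (aff_mul u (aff_inv w))) x.
Proof.
move=> Gw; have wu := crystal_unit crystal Gw; rewrite /tsum.
rewrite [RHS](reindex_fsbig (fun u => aff_mul u w) Gamma Gamma); last first.
  exact: (crystal_set_bijMr crystal Gw).
apply: eq_fsbigr => u _.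
by rewrite -aff_mulA aff_mulV// aff_mulr1 aff_actM.
Qed.

Hypothesis mf : cmeasurable f.

Lemma tsum_measurable b : cmeasurable (tsum b).
Proof.
apply: (@cmeasurable_local _ _ _ (fun n x => \sum_(u <- active_seq n) b u * f (aff_act u x))).
  by move=> n; apply: cmeasurable_sum => u; apply: cmeasurableM; exact: cmeasurable_affine.
by move=> n x xn; exact: tsum_local.
Qed.

Section refinement.
Variables (a : 'M[R]_d) (Gamma' : set (affine R d)) (c : affine R d -> R[i]).
Hypothesis adm_a : admissible Gamma a.
Hypothesis fin_Gamma' : finite_set Gamma'.
Hypothesis sub_Gamma' : Gamma' `<=` Gamma.
Hypothesis c0 : forall u, ~ Gamma' u -> c u = 0.
Hypothesis ref_f : refinable Gamma' c a f.

Lemma admissible_unit : a \in unitmx.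
Proof. by apply: expansive_unit; case: adm_a. Qed.
Let au := admissible_unit.

Lemma admissible_conj u : Gamma u -> Gamma (aff_conj a u).
Proof. by move=> Gu; case: adm_a => _; apply; exists u. Qed.

Lemma admissible_lattice k : Lambda k -> Lambda (a *m k).
Proof.
move=> Lk; have /(crystalE crystal)[] := admissible_conj (crystal_translation crystal Lk).
by rewrite /aff_conj /aff_mul /= !mulmx0 oppr0 mulmx0 addr0 add0r.
Qed.

Lemma aff_conj_inj : injective (aff_conj a).
Proof.
move=> u w uw; have E x : aff_act u x = aff_act w x.
  apply: (can_inj (mulKmx au)); rewrite -!aff_conj_act// uw//.
case: u w uw E => [k g] [l h] _ E; have kl : k = l.
  by have := E 0; rewrite /aff_act !mulmx0 !add0r.
rewrite kl in E *; congr pair; apply/matrixP => i j.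
have := E (delta_mx j 0); rewrite /aff_act /= => /addIr.
by rewrite -!colE => /colP/(_ i); rewrite !mxE.
Qed.

(** The entry at w of the row vector b L. *)
Definition refine_coef b w : R[i] :=
  \sum_(u \in Gamma) refinement_mx c a u w * b u.

(* The rows u that meet the column w of L. *)
Let column w : set (affine R d) :=
  [set u | Gamma u /\ Gamma' (aff_mul (aff_conj a u) (aff_inv w))].

Let column_finite w : Gamma w -> finite_set (column w).
Proof.
move=> Gw; have wu := crystal_unit crystal Gw.
apply: (@sub_finite_set _ _ ((fun u => aff_mul (aff_conj a u) (aff_inv w)) @^-1` Gamma')).
  by move=> u [].
apply: finite_preimage => // u v _ _ /(congr1 (fun z : affine R d => aff_mul z w)).
by rewrite -!(aff_mulA _ (aff_inv w) w) aff_mulVl// !aff_mulr1 => /aff_conj_inj.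
Qed.

Lemma refine_coef_sum (A : set (affine R d)) b w : Gamma w -> finite_set A ->
  A `<=` Gamma -> column w `<=` A ->
  refine_coef b w =
  \sum_(u <- finmap.enum_fset (fset_set A)) refinement_mx c a u w * b u.
Proof.
move=> Gw finA AG wA; apply: fsbig_supported => // u Gu nAu.
by rewrite /refinement_mx c0 ?mul0r// => G'u; apply/nAu/wA.
Qed.

Lemma row_mulE n (Y : affine R d -> 'cV[R[i]]_n) w k : Gamma w ->
  Defs.row_mul Gamma Y (refinement_mx c a) w k 0 = refine_coef (fun u => Y u k 0) w.
Proof.
move=> Gw; rewrite (refine_coef_sum (A := column w))//; last 2 first.
- exact: column_finite.
- by move=> u [].
rewrite /Defs.row_mul (@fsbig_supported _ _ _ (column w)).
- by rewrite summxE; apply: eq_bigr => u _; rewrite mxE.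
- exact: column_finite.
- by move=> u [].
- move=> u Gu nu; rewrite /refinement_mx c0 ?scale0r// => G'u.
  exact: nu.
Qed.

(** The refinement equation at u x, reindexed by w |-> (a u a^-1) w^-1. *)
Lemma refinement_act u x : Gamma u ->
  f (aff_act u x) = \sum_(w \in Gamma') c w * f (aff_act (aff_inv w) (a *m aff_act u x)) ->
  f (aff_act u x) = \sum_(w \in Gamma) refinement_mx c a u w * f (aff_act w (a *m x)).
Proof.
move=> Gu ->; have Gu' := admissible_conj Gu.
rewrite (@fsbig_widen _ _ _ _ Gamma' Gamma)//; last first.
  by move=> w [_ nw] /=; rewrite c0// mul0r.
rewrite (reindex_fsbig (fun w => aff_mul (aff_conj a u) (aff_inv w)) Gamma Gamma); last first.
  exact: (crystal_set_bij_div crystal Gu').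
apply: eq_fsbigr => w; rewrite inE => Gw; congr (_ * f _).
have wu := crystal_unit crystal Gw; have uu := crystal_unit crystal Gu'.
rewrite -aff_conj_act// -aff_actM; congr aff_act.
by rewrite aff_inv_div// -aff_mulA aff_mulVl// aff_mulr1.
Qed.

Lemma ae_refinement : {ae lam, forall x, forall u, Gamma u ->
  f (aff_act u x) = \sum_(w \in Gamma) refinement_mx c a u w * f (aff_act w (a *m x))}.
Proof.
apply: ae_countable; first exact: crystal_countable crystal.
move=> u Gu; have := ae_affine (crystal_unit crystal Gu) ref_f.
by apply: filterS => x; exact: refinement_act.
Qed.

(** Substitute the refinement equation in each term and exchange the two sums,
    which are finite at each point. *)
Lemma tsum_refine b : {ae lam, forall x, tsum b x = tsum (refine_coef b) (a *m x)}.
Proof.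
apply: filterS ae_refinement => x Hx.
have [n _ xn] : (\bigcup_n cube n%:R) (a *m x) by rewrite cube_cover.
have [m _ xm] : (\bigcup_n cube n%:R) x by rewrite cube_cover.
pose A := active m `|` \bigcup_(w in active n) column w.
have finA : finite_set A.
  rewrite finite_setU; split; first exact: active_finite.
  by apply: bigcup_finite; [exact: active_finite|move=> w [Gw _]; exact: column_finite].
have AG : A `<=` Gamma by move=> u [[]//|[w _ []]].
rewrite /tsum (fsbig_supported finA AG); last first.
  move=> u Gu nA; rewrite (activeP xm Gu) ?mulr0// => au'; apply: nA; left.
  exact: au'.
transitivity (\sum_(u <- finmap.enum_fset (fset_set A))
    \sum_(w <- active_seq n) refinement_mx c a u w * b u * f (aff_act w (a *m x))).
  rewrite big_seq [RHS]big_seq; apply: eq_bigr => u.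
  rewrite in_fset_set// inE => /AG Gu.
  rewrite (Hx u Gu) (active_sum xn); last by move=> w ->; rewrite mulr0.
  by rewrite mulr_sumr; apply: eq_bigr => w _; rewrite mulrA [b u * _]mulrC.
rewrite exchange_big (active_sum xn) /=; last by move=> w ->; rewrite mulr0.
rewrite big_seq [RHS]big_seq; apply: eq_bigr => w wn.
have Gw := mem_active wn.
rewrite (refine_coef_sum _ Gw finA AG) ?mulr_suml// => u wu; right.
by exists w => //; move: wn; rewrite /active_seq in_fset_set ?inE//; exact: active_finite.
Qed.

End refinement.
End translate_sums.

(** * Sums over the crystal group and integrals *)

Section periodization.
Context {R : realType} {d : nat}.
Local Notation lam := (lebesgue_cV d : {sigma_finite_measure set 'cV[R]_d -> \bar R}).
Variables (Gamma : set (affine R d)) (G : set 'M[R]_d) (Lambda : set 'cV[R]_d).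
Hypothesis crystal : splitting_crystal_triple Gamma G Lambda.
Variables (e : nat -> 'cV[R]_d) (U : set 'cV[R]_d).
Hypothesis tl : lattice_tiling Lambda e U.

Definition point_order : nat := size (finmap.enum_fset (fset_set G)).
Local Notation N := point_order.

Lemma point_order_gt0 : (0 < N)%N.
Proof.
rewrite /N -has_predT; apply/hasP; exists 1%:M => //.
by rewrite in_fset_set ?inE; [exact: crystal_point1 crystal|exact: crystal_point_finite crystal].
Qed.

Lemma esum_crystal (t : affine R d -> \bar R) : (forall u, 0 <= t u)%E ->
  (\esum_(u in Gamma) t u = \sum_(g <- finmap.enum_fset (fset_set G)) \sum_(n <oo) t (e n, g))%E.
Proof.
move=> t0; rewrite (reindex_esum (G `*`` (fun=> Lambda)) Gamma (fun p => (p.2, p.1))); last first.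
  split.
  - by move=> [g k] [Gg Lk]; apply/(crystalE crystal).
  - by move=> [g k] [g' k'] _ _ [-> ->].
  - by move=> [k g] /(crystalE crystal)[Lk Gg]; exists (g, k).
rewrite -(esum_esum (a := fun g k => t (k, g)))// esum_fset; last 2 first.
- exact: crystal_point_finite crystal.
- by move=> g _; apply: esum_ge0.
rewrite fsbig_finite; last exact: crystal_point_finite crystal.
apply: eq_bigr => g _; rewrite nneseries_esumT//.
exact: (reindex_esum setT Lambda e (fun k => t (k, g)) (tiling_bij tl)).
Qed.

Section bounded_support.
Variables (n0 m : nat) (chi : 'cV[R]_d -> R).
Hypothesis Um : U `<=` cube m%:R.
Hypothesis chi_supp : forall x, chi x != 0 -> cube n0%:R x.
Hypothesis chi0 : forall x, 0 <= chi x.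
Hypothesis mchi : measurable_fun setT chi.
Local Notation act := (active_seq Gamma n0 m).

(** The terms of linear part g add up to the integral of chi, since g induces a
    measure preserving map of the torus. *)
Lemma integral_periodization :
  (\int[lam]_(x in U) (\sum_(u <- act) chi (aff_act u x))%:E =
   N%:R%:E * \int[lam]_x (chi x)%:E)%E.
Proof.
have mU := tiling_measurable tl.
have mEchi : measurable_fun setT (EFin \o chi) by exact/measurable_EFinP.
have mu u : measurable_fun setT (fun x => (chi (aff_act u x))%:E).
  by apply: (measurableT_comp mEchi); exact: measurable_affine.
transitivity (\sum_(u <- act) \int[lam]_(x in U) (chi (aff_act u x))%:E)%E.
  rewrite -ge0_integral_sum//.
  - by apply: eq_integral => x _; rewrite -sumEFin.
  - by move=> u; exact: measurable_funTS.
  - by move=> u x _; rewrite lee_fin.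
pose t u := (\int[lam]_(x in U) (chi (aff_act u x))%:E)%E.
have t0 u : (0 <= t u)%E by apply: integral_ge0 => x _; rewrite lee_fin.
transitivity (\esum_(u in Gamma) t u)%E.
  rewrite (esumID (active Gamma n0 m))//.
  rewrite [X in (_ + X)%E]esum1 ?adde0; last first.
    move=> u [Gu nu]; apply: integral0_eq => x Ux; congr EFin.
    apply/eqP; apply: contrapT => /negP /chi_supp cx; apply: nu; split => //.
    by exists x => //; exact: Um.
  rewrite setIidr; last by move=> u [].
  have fin := active_finite crystal n0 m.
  by rewrite esum_fset// fsbig_finite.
rewrite esum_crystal//.
rewrite (eq_big_seq (fun=> \int[lam]_x (chi x)%:E)%E) => [|g]; last first.
  rewrite in_fset_set; last exact: crystal_point_finite crystal.
  rewrite inE => Gg; rewrite -(integral_tile_endomorphism tl (b := g) _ _ mEchi)//.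
  - exact: (crystal_point_unit crystal Gg).
  - by move=> k Lk; exact: (crystal_lattice_mul crystal Gg Lk).
rewrite big_const_seq /N -[in RHS]count_predT.
elim: (count _ _) => [|n IH]; first by rewrite mul0e.
by rewrite iterS IH -[n.+1%:R]natr1 addrC EFinD ge0_muleDl ?mul1e// lee_fin.
Qed.

End bounded_support.

(** Apply integral_periodization to the positive and negative parts, and
    integrate the constant over the tile. *)
Lemma constant_periodization (n0 : nat) (psi : 'cV[R]_d -> R) (r : R) :
  (forall x, psi x != 0 -> cube n0%:R x) ->
  lam.-integrable setT (EFin \o psi) ->
  (forall m : nat, {ae lam, forall x, cube m%:R x ->
     \sum_(u <- active_seq Gamma n0 m) psi (aff_act u x) = r}) ->
  r * fine (lam U) = N%:R * \int[lam]_x psi x.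
Proof.
move=> psi_supp ipsi sum_r; have mU := tiling_measurable tl.
have [m Um] := tiling_bounded tl.
pose pp x := Num.max (psi x) 0; pose pn x := Num.max (- psi x) 0.
have mpsi : measurable_fun setT psi by apply/measurable_EFinP; exact: measurable_int ipsi.
have mpp : measurable_fun setT pp by apply: measurable_maxr => //; exact: measurable_cst.
have mpn : measurable_fun setT pn.
  by apply: measurable_maxr; [exact: measurable_funN|exact: measurable_cst].
have pp0 x : 0 <= pp x by rewrite le_max lexx orbT.
have pn0 x : 0 <= pn x by rewrite le_max lexx orbT.
have psiE x : psi x = pp x - pn x.
  rewrite /pp /pn; have [p0|p0] := leP 0 (psi x).
    by rewrite max_r ?subr0// oppr_le0.
  by rewrite max_l ?opprK ?add0r// oppr_ge0 ltW.
have pp_supp x : pp x != 0 -> cube n0%:R x.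
  move=> px; apply: psi_supp; apply: contra_neq px => p0.
  by rewrite /pp p0 maxxx.
have pn_supp x : pn x != 0 -> cube n0%:R x.
  move=> px; apply: psi_supp; apply: contra_neq px => p0.
  by rewrite /pn p0 oppr0 maxxx.
have Ep : (\int[lam]_x (pp x)%:E = \int[lam]_x ((EFin \o psi)^\+ x))%E.
  by apply: eq_integral => x _; rewrite funeposE /= EFin_max.
have En : (\int[lam]_x (pn x)%:E = \int[lam]_x ((EFin \o psi)^\- x))%E.
  by apply: eq_integral => x _; rewrite funenegE /= EFin_max EFinN.
have fp := integrable_pos_fin_num measurableT ipsi.
have fn := integrable_neg_fin_num measurableT ipsi.
pose Sp x := \sum_(u <- active_seq Gamma n0 m) pp (aff_act u x).
pose Sn x := \sum_(u <- active_seq Gamma n0 m) pn (aff_act u x).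
have IP : (\int[lam]_(x in U) (Sp x)%:E = N%:R%:E * \int[lam]_x (pp x)%:E)%E.
  exact: integral_periodization.
have IN : (\int[lam]_(x in U) (Sn x)%:E = N%:R%:E * \int[lam]_x (pn x)%:E)%E.
  exact: integral_periodization.
have mS (q : 'cV[R]_d -> R) : measurable_fun setT q -> measurable_fun setT
    (fun x => (\sum_(u <- active_seq Gamma n0 m) q (aff_act u x))).
  move=> mq; apply: measurable_sum => u; apply: (measurableT_comp mq).
  exact: measurable_affine.
have mES (q : 'cV[R]_d -> R) : measurable_fun setT q -> measurable_fun U
    (EFin \o (fun x => (\sum_(u <- active_seq Gamma n0 m) q (aff_act u x)))).
  by move=> mq; apply: measurable_funTS; apply/measurable_EFinP; exact: mS.
have Sn0 x : 0 <= Sn x by apply: sumr_ge0.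
have Sp0 x : 0 <= Sp x by apply: sumr_ge0.
have Ufin : (lam U \is a fin_num) by rewrite ge0_fin_numE// (lebesgue_tile_fin tl).
have iSn : lam.-integrable U (EFin \o Sn).
  apply/integrableP; split; first exact: mES.
  under eq_integral do rewrite /= ger0_norm//.
  by rewrite IN En -(fineK fn) -EFinM ltry.
have icst : lam.-integrable U (EFin \o cst r).
  apply/integrableP; split; first (apply: measurable_funTS; apply/measurable_EFinP; exact: measurable_cst).
  rewrite (eq_integral (cst `|r|%:E))// integral_cst// -(fineK Ufin) -EFinM ltry//.
have : (\int[lam]_(x in U) (Sp x)%:E = \int[lam]_(x in U) ((EFin \o cst r) x + (EFin \o Sn) x))%E.
  apply: ae_eq_integral => //.
  - exact: mES.
  - apply: emeasurable_funD; first (apply: measurable_funTS; apply/measurable_EFinP; exact: measurable_cst).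
    exact: mES.
  apply: filterS (sum_r m) => x /[swap] Ux /(_ (Um _ Ux)) <-; rewrite /= -EFinD; congr EFin.
  by rewrite /Sp /Sn -big_split /=; apply: eq_bigr => u _; rewrite psiE subrK.
have Ic : (\int[lam]_(x in U) (EFin \o cst r) x = r%:E * lam U)%E.
  exact: (integral_cst lam mU r%:E).
rewrite integralD// IP IN Ic Ep En -(fineK fp) -(fineK fn) -(fineK Ufin) -!EFinM -EFinD.
move=> [] H; rewrite /Rintegral integralE fineB// mulrBr H.
by rewrite [fine _%:E]/= addrK.
Qed.

End periodization.

(** * Condition (II) makes the translates reproduce the monomials *)

Section reproduction.
Context {R : realType} {d : nat}.
Local Notation lam := (lebesgue_cV d : {sigma_finite_measure set 'cV[R]_d -> \bar R}).
Local Notation nb := (nb_index d).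
Variables (Gamma : set (affine R d)) (G : set 'M[R]_d) (Lambda : set 'cV[R]_d).
Hypothesis crystal : splitting_crystal_triple Gamma G Lambda.
Variables (e : nat -> 'cV[R]_d) (U : set 'cV[R]_d).
Hypothesis tl : lattice_tiling Lambda e U.
Variables (f : 'cV[R]_d -> R[i]) (n0 : nat).
Hypothesis f_supp : forall x, f x != 0 -> cube n0%:R x.
Hypothesis int_f : integrableC f.
Variable a : 'M[R]_d.
Hypothesis adm_a : admissible Gamma a.
Implicit Types (v : mpoly.multinom d -> R[i]) (u w : affine R d) (x : 'cV[R]_d).
Local Notation T := (tsum Gamma f).

Let au : a \in unitmx := admissible_unit adm_a.

Lemma integrableC_measurable : cmeasurable f.
Proof.
by case: int_f => i1 i2; split; apply/measurable_EFinP;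
  [exact: measurable_int i1|exact: measurable_int i2].
Qed.
Let mf := integrableC_measurable.

Lemma expr_unitmx n : a ^+ n \in unitmx.
Proof.
elim: n => [|n IH]; first by rewrite expr0 unitmx1.
by rewrite exprS unitmx_mul au.
Qed.

Lemma expr_lattice n k : Lambda k -> Lambda (a ^+ n *m k).
Proof.
move=> Lk; elim: n => [|n IH]; first by rewrite expr0 mul1mx.
by rewrite exprS -mulmxA; exact: (admissible_lattice crystal adm_a IH).
Qed.

Lemma expr_invmxK n : invmx a ^+ n *m a ^+ n = 1%:M.
Proof.
elim: n => [|n IH]; first by rewrite !expr0 mul1mx.
by rewrite exprSr exprS -mulmxE -mulmxA mulKmx.
Qed.

Lemma ae_expr n (P : 'cV[R]_d -> Prop) :
  {ae lam, forall x, P x} -> {ae lam, forall x, P (a ^+ n *m x)}.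
Proof.
move=> aeP; have := ae_affine (u := (0, a ^+ n)) (expr_unitmx n) aeP.
by apply: filterS => x; rewrite /aff_act addr0.
Qed.

(** The points a^-n k form a dense set because a^-n tends to 0: approximate
    a^n x by a lattice point. *)
Lemma dilated_lattice_dense x (eps : R) : 0 < eps ->
  exists2 t, (exists n, exists2 k, Lambda k & t = invmx a ^+ n *m k) &
    forall i, `|x i 0 - t i 0| < eps.
Proof.
move=> eps0; have [m Um] := tiling_bounded tl.
have [ea _] := adm_a.
have H : \sum_i \sum_j `|(invmx a ^+ n) i j| * m%:R @[n --> \oo] --> (0 : R).
  have := @cvg_sum_seq R 'I_d (fun i n => \sum_j `|(invmx a ^+ n) i j| * m%:R) (fun=> 0).
  rewrite big1//; apply=> i.
  have := @cvg_sum_seq R 'I_d (fun j n => `|(invmx a ^+ n) i j| * m%:R) (fun=> 0).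
  rewrite big1//; apply=> j.
  rewrite -(mul0r (m%:R : R)) -(normr0 R); apply: cvgMr_tmp; apply: cvg_norm.
  have := expansive_cvg ea (delta_mx j 0) i.
  by under eq_fun do rewrite -colE mxE.
have [n _ Hn] := (iffLR (cvgrPdist_lt _ _) H) _ eps0.
have [k Lk [Uk _]] := tiling_tile tl (a ^+ n *m x).
exists (invmx a ^+ n *m k); first by exists n, k.
move=> i; rewrite (_ : _ - _ = (invmx a ^+ n *m (a ^+ n *m x - k)) i 0); last first.
  by rewrite mulmxBr mulmxA expr_invmxK mul1mx !mxE.
apply: le_lt_trans (Hn n (leqnn n)); rewrite sub0r normrN.
rewrite [leRHS]ger0_norm; last by apply: sumr_ge0 => ? _; apply: sumr_ge0 => ? _; rewrite mulr_ge0.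
rewrite mxE (le_trans (ler_norm_sum _ _ _))// [leRHS](bigD1 i)//=.
apply: ler_wpDr; first by apply: sumr_ge0 => ? _; apply: sumr_ge0 => ? _; rewrite mulr_ge0.
by apply: ler_sum => j _; rewrite normrM ler_wpM2l// ltW//; exact: Um.
Qed.

(** A measurable function that is periodic and invariant under the dilation is
    invariant under translation by a^-n k, hence constant. *)
Lemma periodic_dilation_constant (g : 'cV[R]_d -> R) :
  measurable_fun setT g ->
  (forall x k, Lambda k -> g (x + k) = g x) ->
  {ae lam, forall x, g (a *m x) = g x} ->
  exists c, {ae lam, forall x, g x = c}.
Proof.
move=> mg gper ga.
have gan n : {ae lam, forall x, g (a ^+ n *m x) = g x}.
  elim: n => [|n IH]; first by apply: aeW => x; rewrite expr0 mul1mx.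
  apply: filterS2 IH (ae_expr n ga) => x <- <-.
  by rewrite exprS -mulmxA.
apply: (dense_invariant_constant dilated_lattice_dense mg) => t [n [k Lk ->]].
have H : {ae lam, forall x, g (a ^+ n *m (x + invmx a ^+ n *m k)) = g (x + invmx a ^+ n *m k)}.
  have := ae_affine (u := (invmx a ^+ n *m k, 1%:M)) (unitmx1 _ _) (gan n).
  by apply: filterS => x; rewrite /aff_act mul1mx.
apply: filterS2 H (gan n) => x <- <-; rewrite mulmxDr mulmxA.
rewrite (_ : a ^+ n *m invmx a ^+ n = 1%:M) ?mul1mx ?gper//.
by apply: mulmx1C; exact: expr_invmxK.
Qed.

Lemma tsum1_act w x : Gamma w -> T (fun=> 1) (aff_act w x) = T (fun=> 1) x.
Proof. by move=> Gw; rewrite (tsum_act crystal). Qed.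

Lemma tsum1_constant : {ae lam, forall x, T (fun=> 1) (a *m x) = T (fun=> 1) x} ->
  exists kappa : R[i], {ae lam, forall x, T (fun=> 1) x = kappa}.
Proof.
move=> Ta; have [mr mi] := tsum_measurable crystal f_supp mf (fun=> 1).
have per x k : Lambda k -> T (fun=> 1) (x + k) = T (fun=> 1) x.
  move=> Lk; rewrite -(tsum1_act x (crystal_translation crystal Lk)).
  by rewrite /aff_act mul1mx.
have [p Hp] := periodic_dilation_constant mr (fun x k Lk => congr1 _ (per x k Lk))
  (filterS (fun x Hx => congr1 _ Hx) Ta).
have [q Hq] := periodic_dilation_constant mi (fun x k Lk => congr1 _ (per x k Lk))
  (filterS (fun x Hx => congr1 _ Hx) Ta).
exists (Complex p q); apply: filterS2 Hp Hq => x <- <-.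
by case: (T _ x).
Qed.

(** Compute the integral of T 1 over the tile in two ways. *)
Lemma tsum1_integral (kappa : R[i]) : {ae lam, forall x, T (fun=> 1) x = kappa} ->
  kappa * (fine (lam U))%:C%C = (point_order G)%:R * integralC f.
Proof.
move=> Tk; case: int_f => i1 i2.
have E (Q : {additive R[i] -> R}) (m : nat) : {ae lam, forall x, cube m%:R x ->
    \sum_(u <- active_seq Gamma n0 m) Q (f (aff_act u x)) = Q kappa}.
  apply: filterS Tk => x <- xm; rewrite (tsum_local crystal f_supp _ xm) raddf_sum.
  by apply: eq_bigr => u _; rewrite mul1r.
have HR := constant_periodization crystal tl (psi := fun x => complex.Re (f x))
  (r := complex.Re kappa) _ i1 (E (@complex.Re R)).
have HI := constant_periodization crystal tl (psi := fun x => complex.Im (f x))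
  (r := complex.Im kappa) _ i2 (E (@complex.Im R)).
rewrite !mulr_natl in HR HI *.
apply/eqP; rewrite eq_complex; apply/andP; split; rewrite [eqbRHS]raddfMn /integralC /=.
  rewrite -HR; last by move=> x fx; apply: f_supp; apply: contraNneq fx => ->.
  by case: (kappa) => p q /=; rewrite mulr0 subr0.
rewrite -HI; last by move=> x fx; apply: f_supp; apply: contraNneq fx => ->.
by case: (kappa) => p q /=; rewrite mulr0 add0r.
Qed.

(** The vector Y_[s] F. *)
Definition gvec v s x : 'cV[R[i]]_(nb s) := \col_k T (fun u => ysub v s u k 0) x.

Lemma gvec_act v s w x : Gamma w -> gvec v s (aff_act w x) =
  \sum_(t < s.+1) toC (shift_mx_iso s t (aff_inv w)) *m gvec v t x.
Proof.
move=> Gw; have Gw' := crystalV crystal Gw.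
apply/colP => k; rewrite mxE (tsum_act crystal)// summxE.
rewrite (@eq_tsum _ _ _ _ _ (fun u => \sum_(t < s.+1) \sum_l
    toC (shift_mx_iso s t (aff_inv w)) k l * ysub v t u l 0)); last first.
  move=> u Gu; rewrite ysubM ?(crystal_unit crystal)// summxE.
  by apply: eq_bigr => t _; rewrite mxE.
rewrite (tsum_sum crystal f_supp); apply: eq_bigr => t _.
rewrite (tsum_sum crystal f_supp) mxE; apply: eq_bigr => l _.
by rewrite tsumZ; congr (_ * _); rewrite mxE.
Qed.

(** The law of gvec_act, for the monomials themselves. *)
Lemma monomials_act s w x : Gamma w -> toC (monomials s (aff_act w x)) =
  \sum_(t < s.+1) toC (shift_mx_iso s t (aff_inv w)) *m toC (monomials t x).
Proof.
move=> Gw; have wu := crystal_unit crystal Gw.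
rewrite -[in LHS](aff_invK wu) shift_mx_isoE /toC raddf_sum; apply: eq_bigr => t _.
exact: map_mxM.
Qed.

Section refinement.
Variables (Gamma' : set (affine R d)) (c : affine R d -> R[i]) (p : nat).
Hypothesis fin_Gamma' : finite_set Gamma'.
Hypothesis sub_Gamma' : Gamma' `<=` Gamma.
Hypothesis c0 : forall u, ~ Gamma' u -> c u = 0.
Hypothesis ref_f : refinable Gamma' c a f.
Variable v : mpoly.multinom d -> R[i].
Hypothesis condII : conditionII Gamma c a f p v.

(** Condition (ii) turns the refinement of T into the dilation law of X_[s]. *)
Lemma gvec_dilation s : (s < p)%N ->
  {ae lam, forall x, gvec v s (a *m x) = toC (sym_mx s a) *m gvec v s x}.
Proof.
move=> sp; have [_ /(_ s sp) Y] := condII.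
have H : {ae lam, forall x, forall l : 'I_(nb s),
    T (fun u => ysub v s u l 0) x =
    T (refine_coef Gamma a c (fun u => ysub v s u l 0)) (a *m x)}.
  have := @ae_countable _ _ _ lam _ [set: 'I_(nb s)] (fun l x =>
    T (fun u => ysub v s u l 0) x =
    T (refine_coef Gamma a c (fun u => ysub v s u l 0)) (a *m x)).
  move=> /(_ (countableP _)) H; have := H _; move=> {}H.
  apply: filterS (H _) => [x Hx l|l _]; first exact: Hx.
  exact: (tsum_refine crystal f_supp adm_a fin_Gamma' sub_Gamma' c0 ref_f).
apply: filterS H => x Hx; apply/colP => k; rewrite mxE [RHS]mxE.
rewrite (@eq_tsum _ _ _ _ _ (fun w => \sum_l toC (sym_mx s a) k l *
    refine_coef Gamma a c (fun u => ysub v s u l 0) w)); last first.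
  move=> w Gw; rewrite (Y w Gw) mxE; apply: eq_bigr => l _.
  by rewrite (row_mulE crystal adm_a fin_Gamma' c0).
rewrite (tsum_sum crystal f_supp); apply: eq_bigr => l _.
by rewrite tsumZ -Hx; congr (_ * _); rewrite mxE.
Qed.

Let v0 := v (@mpoly.mnm0 d).

Lemma gvec0 x k : gvec v 0 x k 0 = v0 * T (fun=> 1) x.
Proof.
rewrite mxE -tsumZ; apply: eq_tsum => u _.
by rewrite ysub0 mulr1.
Qed.

(** In degree 0 the function Y_[0] F is v_0 T 1, which is constant; the value K is
    the constant by which Y_[s] F and X_[s] differ in all degrees. *)
Lemma gvec0_constant : (0 < p)%N -> exists K : R[i],
  K * (fine (lam U))%:C%C = v0 * ((point_order G)%:R * integralC f) /\
  {ae lam, forall x, gvec v 0 x = K *: toC (monomials 0 x)}.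
Proof.
move=> p0; have v0_neq0 : v0 != 0.
  by case: condII => /eqP; rewrite mulf_eq0 negb_or => /andP[].
have [k0 _] := index_val_surj (@mpoly.mdeg0 d).
have Ta : {ae lam, forall x, T (fun=> 1) (a *m x) = T (fun=> 1) x}.
  apply: filterS (gvec_dilation p0) => x.
  rewrite sym_mx0 /toC map_mx1 mul1mx => /colP/(_ k0).
  by rewrite !gvec0 => /(mulfI v0_neq0).
have [kappa Tk] := tsum1_constant Ta.
exists (v0 * kappa); split; first by rewrite -mulrA (tsum1_integral Tk).
apply: filterS Tk => x Tx; apply/colP => k.
by rewrite gvec0 Tx monomials0 !mxE rmorph1 mulr1.
Qed.

Section induction.
Variables (K : R[i]) (s : nat).
Hypothesis s0 : (0 < s)%N.
Hypothesis sp : (s < p)%N.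
Hypothesis IH : forall t, (t < s)%N ->
  {ae lam, forall x, gvec v t x = K *: toC (monomials t x)}.

(* The terms of lower degree in the translation laws cancel, so that h is periodic. *)
Let h x := gvec v s x - K *: toC (monomials s x).

Let h_periodic k : Lambda k -> {ae lam, forall x, h (x + k) = h x}.
Proof.
move=> Lk; have Gk := crystal_translation crystal Lk.
have IH' : {ae lam, forall x, forall t, [set t | (t < s)%N] t ->
    gvec v t x = K *: toC (monomials t x)}.
  by apply: ae_countable => [|t ts]; [exact: countableP|exact: IH].
apply: filterS IH' => x IHx; rewrite /h.
have -> : x + k = aff_act (k, 1%:M) x by rewrite /aff_act mul1mx.
rewrite gvec_act// monomials_act// scaler_sumr -sumrB big_ord_recr /= big1 ?add0r => [|t _].
  by rewrite scalemxAr -mulmxBr /aff_inv invmx1 shift_mx_iso_diag /toC map_mx1 mul1mx.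
by rewrite scalemxAr -mulmxBr (IHx t) ?subrr ?mulmx0//=.
Qed.

Let h_dilation n : {ae lam, forall x, h (a ^+ n *m x) = toC (sym_mx s (a ^+ n)) *m h x}.
Proof.
have h1 : {ae lam, forall x, h (a *m x) = toC (sym_mx s a) *m h x}.
  apply: filterS (gvec_dilation sp) => x Hx.
  by rewrite /h Hx sym_mxE /toC map_mxM mulmxBr scalemxAr.
elim: n => [|n IHn].
  by apply: aeW => x; rewrite expr0 mul1mx sym_mx1 /toC map_mx1 mul1mx.
apply: filterS2 IHn (ae_expr n h1) => x Hn.
by rewrite mulmxA mulmxE -exprS Hn mulmxA exprS sym_mxM /toC map_mxM.
Qed.

(* An equivalent of the modulus, for which real matrices are easily estimated. *)
Let psi (z : R[i]) : R := `|complex.Re z| + `|complex.Im z|.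
Let phi x := \sum_k psi (h x k 0).

Let psi_le n (M : 'M[R]_n) (z : 'cV[R[i]]_n) k :
  psi ((toC M *m z) k 0) <= \sum_l `|M k l| * psi (z l 0).
Proof.
rewrite mxE /psi !raddf_sum (le_trans (lerD (ler_norm_sum _ _ _) (ler_norm_sum _ _ _)))//.
rewrite -big_split /=; apply: ler_sum => l _; rewrite mxE mulrDr.
by case: (z l 0) => p' q' /=; rewrite !mul0r subr0 addr0 !normrM.
Qed.

Let phi_contraction : exists n, {ae lam, forall x, 2 * phi x <= phi (a ^+ n *m x)}.
Proof.
have [ea _] := adm_a.
have H : \sum_(kl : 'I_(nb s) * 'I_(nb s)) `|sym_mx s (invmx a ^+ n) kl.1 kl.2|
    @[n --> \oo] --> (0 : R).
  have := @cvg_sum_seq R _ (fun (kl : 'I_(nb s) * 'I_(nb s)) n =>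
    `|sym_mx s (invmx a ^+ n) kl.1 kl.2|) (fun=> 0).
  rewrite big1//; apply=> -[k l] /=; rewrite -(normr0 R); apply: cvg_norm.
  exact: (cvg_sym_mx s0 (expansive_cvg ea)).
have half0 : 0 < 2^-1 :> R by rewrite invr_gt0.
have [n _ Hn] := (iffLR (cvgrPdist_lt _ _) H) _ half0.
exists n; apply: filterS (h_dilation n) => x hx.
set M := sym_mx s (invmx a ^+ n).
have hE : h x = toC M *m h (a ^+ n *m x).
  by rewrite hx mulmxA /toC -map_mxM -sym_mxM expr_invmxK sym_mx1 map_mx1 mul1mx.
have psi0 z : 0 <= psi z by rewrite addr_ge0.
have phi0 y : 0 <= phi y by apply: sumr_ge0.
have Mn : \sum_k \sum_l `|M k l| <= 2^-1.
  rewrite pair_big /=; have := Hn n (leqnn n).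
  by rewrite sub0r normrN => /ltW; apply: le_trans; exact: ler_norm.
have : phi x <= 2^-1 * phi (a ^+ n *m x).
  apply: le_trans (ler_wpM2r (phi0 _) Mn).
  rewrite mulr_suml; apply: ler_sum => k _; rewrite hE (le_trans (psi_le _ _ _))//.
  rewrite mulr_suml; apply: ler_sum => l _; apply: ler_wpM2l => //.
  by rewrite /phi (bigD1 l)//= lerDl sumr_ge0.
by rewrite ler_pdivlMl.
Qed.

Let phi_measurable : measurable_fun setT phi.
Proof.
have mh k : cmeasurable (fun x => h x k 0).
  have mg := tsum_measurable crystal f_supp mf (fun u => ysub v s u k 0).
  have mm := cmeasurable_real (@measurable_monom R d (index_val k)).
  have := cmeasurableD mg (cmeasurableM (- K) mm); congr cmeasurable.
  by apply/funext => x; rewrite !mxE mulNr.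
apply: measurable_sum => k; have [m1 m2] := mh k.
by apply: measurable_funD; apply: measurableT_comp.
Qed.

(** The function phi, which measures the size of h, is periodic and at least
    doubled by a power of a: it vanishes by periodic_contraction. *)
Lemma gvec_step : {ae lam, forall x, gvec v s x = K *: toC (monomials s x)}.
Proof.
have [n phin] := phi_contraction.
have phi_per k : Lambda k -> {ae lam, forall x, phi (x + k) = phi x}.
  by move=> Lk; apply: filterS (h_periodic Lk) => x; rewrite /phi => ->.
have := periodic_contraction tl (expr_unitmx n) (fun k => @expr_lattice n k) phi_measurable
  phi_per phin.
have psi0 z : 0 <= psi z by rewrite addr_ge0.
apply: filterS => x phix; apply/subr0_eq/colP => k; rewrite -/(h x) [RHS]mxE.
have : psi (h x k 0) <= 0.
  by apply: le_trans phix; rewrite /phi (bigD1 k)//= lerDl sumr_ge0.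
rewrite le_eqVlt ltNge psi0 orbF /psi paddr_eq0// !normr_eq0.
by case: (h x k 0) => p' q' /= /andP[/eqP -> /eqP ->].
Qed.

End induction.

Theorem gvec_monomials : (0 < p)%N -> exists K : R[i],
  K * (fine (lam U))%:C%C = v0 * ((point_order G)%:R * integralC f) /\
  forall s, (s < p)%N -> {ae lam, forall x, gvec v s x = K *: toC (monomials s x)}.
Proof.
move=> p0; have [K [KU K0]] := gvec0_constant p0; exists K; split => // s.
elim/ltn_ind: s => -[//|s] IH sp; apply: gvec_step => // t ts.
exact: IH (ltn_trans ts sp).
Qed.

End refinement.
End reproduction.

(** * Closedness of finite dimensional spaces in the mean *)

Section L1_distance.
Context {R : realType} {d : nat}.
Local Notation lam := (lebesgue_cV d : {sigma_finite_measure set 'cV[R]_d -> \bar R}).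
Variable D : set 'cV[R]_d.
Hypothesis mD : measurable D.
Implicit Types (f g h : 'cV[R]_d -> R[i]).
Local Open Scope ereal_scope.

Lemma L1distE f g : L1dist D f g = \int[lam]_(x in D) (cmod (f x - g x))%:E.
Proof. by []. Qed.

Lemma cmeasurableB f g : cmeasurable f -> cmeasurable g ->
  cmeasurable (fun x => f x - g x)%R.
Proof.
move=> mf mg; have := cmeasurableD mf (cmeasurableM (-1)%R mg); congr cmeasurable.
by apply/funext => x; rewrite mulN1r.
Qed.

Let mcB f g : cmeasurable f -> cmeasurable g ->
  measurable_fun D (fun x => (cmod (f x - g x))%:E).
Proof.
move=> mf mg; apply: measurable_funTS; apply/measurable_EFinP.
by apply: measurable_cmod; exact: cmeasurableB.
Qed.

Lemma L1dist_triangle g f h : cmeasurable f -> cmeasurable g -> cmeasurable h ->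
  L1dist D f h <= L1dist D f g + L1dist D g h.
Proof.
move=> mf mg mh; rewrite !L1distE -ge0_integralD//; last 4 first.
- by move=> x _; rewrite lee_fin cmod_ge0.
- exact: mcB.
- by move=> x _; rewrite lee_fin cmod_ge0.
- exact: mcB.
apply: ge0_le_integral => //.
- by move=> x _; rewrite lee_fin cmod_ge0.
- exact: mcB.
- by apply: emeasurable_funD; exact: mcB.
move=> x _; rewrite -EFinD lee_fin (_ : f x - h x = (f x - g x) + (g x - h x))%R.
  exact: cmodD.
by rewrite addrA subrK.
Qed.

Lemma L1distC f g : L1dist D f g = L1dist D g f.
Proof. by apply: eq_integral => x _; rewrite distrC. Qed.

Lemma L1distZ (c : R[i]) f g : cmeasurable f -> cmeasurable g ->
  L1dist D (fun x => c * f x)%R (fun x => c * g x)%R = (cmod c)%:E * L1dist D f g.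
Proof.
move=> mf mg; rewrite !L1distE -ge0_integralZl//.
- by apply: eq_integral => x _; rewrite -mulrBr cmodM EFinM.
- exact: mcB.
- by move=> x _; rewrite lee_fin cmod_ge0.
- by rewrite lee_fin cmod_ge0.
Qed.

Lemma L1dist_eq0 f g : cmeasurable f -> cmeasurable g ->
  L1dist D f g = 0 -> {ae lam, forall x, D x -> f x = g x}.
Proof.
move=> mf mg; rewrite L1distE => H.
have : \int[lam]_(x in D) `|(cmod (f x - g x))%:E| = 0.
  by rewrite -[RHS]H; apply: eq_integral => x _; rewrite gee0_abs// lee_fin cmod_ge0.
move/(ae_eq_integral_abs lam mD (mcB mf mg)); apply: filterS => x H' Dx.
by have := H' Dx; move=> [] /eqP; rewrite cmod_eq0 subr_eq0 => /eqP.
Qed.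

Lemma ae_eq_L1dist f g f' g' : cmeasurable f -> cmeasurable g ->
  cmeasurable f' -> cmeasurable g' ->
  {ae lam, forall x, D x -> (f x - g x = f' x - g' x)%R} -> L1dist D f g = L1dist D f' g'.
Proof.
move=> mf mg mf' mg' H; rewrite !L1distE; apply: ge0_ae_eq_integral => //.
- exact: mcB.
- exact: mcB.
- by move=> x _; rewrite lee_fin cmod_ge0.
- by move=> x _; rewrite lee_fin cmod_ge0.
by apply: filterS H => x Hx Dx; rewrite Hx.
Qed.

End L1_distance.

(** The supremum of the left ends x n - eta n lies in every interval. *)
Lemma common_point {R : realType} (x eta : nat -> R) :
  (forall n m, `|x n - x m| <= eta n + eta m) ->
  exists y, forall n, `|x n - y| <= eta n.
Proof.
move=> H; pose S := [set x n - eta n | n in [set: nat]].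
have ubS m : ubound S (x m + eta m).
  move=> _ [n _ <-]; rewrite lerBlDr -addrA -lerBlDl [eta m + _]addrC.
  exact: le_trans (ler_norm _) (H n m).
have S_sup : has_sup S.
  by split; [exists (x 0 - eta 0); exists 0%N|exists (x 0%N + eta 0%N); exact: ubS].
exists (sup S) => n; rewrite ler_norml; apply/andP; split.
  rewrite lerBrDr addrC lerBlDr; apply: ge_sup; first by case: S_sup.
  exact: ubS.
rewrite lerBlDr -lerBlDl; apply: (sup_upper_bound S_sup).
by exists n.
Qed.

Section closed_span.
Context {R : realType} {d : nat}.
Local Notation lam := (lebesgue_cV d : {sigma_finite_measure set 'cV[R]_d -> \bar R}).
Variable D : set 'cV[R]_d.
Hypothesis mD : measurable D.
Variables (I : eqType) (F : I -> 'cV[R]_d -> R[i]).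
Hypothesis mF : forall i, cmeasurable (F i).
Hypothesis F_fin : forall i, (L1dist D (F i) (fun=> 0%R) < +oo)%E.

Let span (r : seq I) (b : I -> R[i]) (x : 'cV[R]_d) := \sum_(i <- r) b i * F i x.

Let mspan r b : cmeasurable (span r b).
Proof. by apply: cmeasurable_sum => i; exact: cmeasurableM. Qed.

Let span_cons i r b x : span (i :: r) b x = b i * F i x + span r b x.
Proof. by rewrite /span big_cons. Qed.

Let span_upd i r b t x : i \notin r ->
  span (i :: r) (fun j => if j == i then t else b j) x = t * F i x + span r b x.
Proof.
move=> ir; rewrite span_cons eqxx; congr (_ + _).
rewrite /span; apply: eq_big_seq => j jr; case: eqP => // ji.
by move: ir; rewrite -ji jr.
Qed.

Let L1dist_ge0 f g : (0 <= L1dist D f g)%E.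
Proof. by apply: integral_ge0 => x _; rewrite lee_fin cmod_ge0. Qed.

Let cmeasurable_scale c i : cmeasurable (fun x => c * F i x).
Proof. exact: cmeasurableM. Qed.

(* If the vector F i stays at distance delta from the span of r, the
   coefficients of F i in approximations of h form a Cauchy sequence. *)
Let coefficient_limit i r h (delta : R) (b : nat -> I -> R[i]) (eta : nat -> R) :
  cmeasurable h -> 0 < delta ->
  (forall b, (delta%:E <= L1dist D (F i) (span r b))%E) ->
  (forall n, (L1dist D h (span (i :: r) (b n)) < (eta n)%:E)%E) ->
  exists t, forall n, cmod (b n i - t) <= 2 * (eta n / delta).
Proof.
move=> mh delta0 Hdelta Hb.
have H n m : cmod (b n i - b m i) <= eta n / delta + eta m / delta.
  have [->|nm] := eqVneq (b n i) (b m i).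
    rewrite subrr cmod0 -mulrDl divr_ge0 ?(ltW delta0)// addr_ge0//.
      by rewrite -lee_fin (le_trans (L1dist_ge0 _ _) (ltW (Hb n))).
    by rewrite -lee_fin (le_trans (L1dist_ge0 _ _) (ltW (Hb m))).
  set c := b n i - b m i; have c0 : c != 0 by rewrite subr_eq0.
  rewrite -mulrDl ler_pdivlMr// -lee_fin EFinM.
  pose b' j := (b m j - b n j) / c.
  apply: (@le_trans _ _ ((cmod c)%:E * L1dist D (F i) (span r b'))%E).
    by rewrite lee_pmul// ?lee_fin ?cmod_ge0 ?(ltW delta0).
  rewrite -(L1distZ mD c (mF i) (mspan r b')).
  have -> : L1dist D (fun x => c * F i x) (fun x => c * span r b' x) =
      L1dist D (span (i :: r) (b n)) (span (i :: r) (b m)).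
    apply: eq_integral => x _; congr ((complex.Re `| _ |)%:E).
    rewrite !span_cons /span mulr_sumr /c.
    rewrite (_ : \sum_(j <- r) _ = \sum_(j <- r) b m j * F j x - \sum_(j <- r) b n j * F j x).
      ring.
    rewrite -sumrB; apply: eq_bigr => j _.
    by rewrite /b' mulrA mulrCA mulfV// mulr1 mulrBl.
  apply: le_trans (L1dist_triangle mD (g := h) _ _ _) _ => //.
  by rewrite EFinD leeD// ltW// L1distC.
have Hre n m : `|complex.Re (b n i) - complex.Re (b m i)| <= eta n / delta + eta m / delta.
  by rewrite -raddfB; apply: le_trans (Re_le_cmod _) (H n m).
have Him n m : `|complex.Im (b n i) - complex.Im (b m i)| <= eta n / delta + eta m / delta.
  by rewrite -raddfB; apply: le_trans (Im_le_cmod _) (H n m).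
have [p Hp] := common_point Hre; have [q Hq] := common_point Him.
exists (Complex p q) => n; rewrite mulr_natl mulr2n.
apply: le_trans (lerD (Hp n) (Hq n)).
rewrite [b n i - _]complexE; apply: le_trans (cmodD _ _) _.
by rewrite cmodM !cmod_real (_ : cmod 'i%C = 1) ?mul1r ?raddfB//
  /cmod normc_def /= expr0n expr1n add0r sqrtr1.
Qed.

(** By induction on the spanning sequence. A vector F i in the closure of the span
    of the others may be dropped; otherwise its coefficients in approximations
    of h converge, and subtracting the limit reduces to the others. *)
Lemma closed_span r h : uniq r -> cmeasurable h ->
  (forall eps : R, 0 < eps -> exists b, (L1dist D h (span r b) < eps%:E)%E) ->
  exists b, {ae lam, forall x, D x -> h x = span r b x}.
Proof.
elim: r h => [|i r IH] h.
  move=> _ mh H; exists (fun=> 0%R).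
  have H0 : L1dist D h (fun=> 0%R) = 0%E.
    apply/eqP; rewrite eq_le L1dist_ge0 andbT; apply/lee_addgt0Pr => eps eps0.
    rewrite add0e; have [b Hb] := H _ eps0; apply: le_trans (ltW Hb).
    rewrite le_eqVlt; apply/orP; left; apply/eqP; apply: eq_integral => x _.
    by rewrite /span big_nil.
  apply: filterS (L1dist_eq0 mD mh cmeasurable0 H0) => x Hx Dx.
  by rewrite (Hx Dx) /span big_nil.
rewrite cons_uniq => /andP[ir ur] mh H.
have [near|] := pselect (forall eps : R, 0 < eps ->
    exists b, (L1dist D (F i) (span r b) < eps%:E)%E).
  have [gam Hgam] := IH _ ur (mF i) near.
  have [eps eps0|b Hb] := IH h ur mh.
    have [b Hb] := H _ eps0; exists (fun j => b j + b i * gam j).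
    rewrite (ae_eq_L1dist mD (f' := h) (g' := span (i :: r) b)) ?mh//.
    apply: filterS Hgam => x Hx Dx; congr (_ - _).
    rewrite span_cons (Hx Dx) /span mulr_sumr -big_split /=; apply: eq_bigr => j _.
    by rewrite mulrDl addrC mulrA.
  exists (fun j => if j == i then 0 else b j); apply: filterS Hb => x Hx Dx.
  by rewrite span_upd// mul0r add0r; exact: Hx.
move=> /existsNP[delta /not_implyP[delta0 /forallNP far]].
have {}far b : (delta%:E <= L1dist D (F i) (span r b))%E.
  by rewrite leNgt; exact/negP/far.
pose eta (n : nat) : R := n.+1%:R^-1.
have eta0 n : 0 < eta n by rewrite invr_gt0.
pose b n := projT1 (cid (H _ (eta0 n))).
have Hb n : (L1dist D h (span (i :: r) (b n)) < (eta n)%:E)%E by rewrite /b; case: cid.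
have [t Ht] := coefficient_limit mh delta0 far Hb.
pose h' x := h x - t * F i x.
have mh' : cmeasurable h' by exact: cmeasurableB.
have [eps eps0|b' Hb'] := IH h' ur mh'; last first.
  exists (fun j => if j == i then t else b' j); apply: filterS Hb' => x Hx Dx.
  by rewrite span_upd// -(Hx Dx) /h' addrC subrK.
pose A := fine (L1dist D (F i) (fun=> 0%R)).
have AE : L1dist D (F i) (fun=> 0%R) = A%:E.
  by rewrite fineK// ge0_fin_numE.
have A0 : 0 <= A by rewrite fine_ge0.
have [n Hn] : exists n, eta n * (1 + 2 * A / delta) < eps.
  have B0 : 0 < 1 + 2 * A / delta.
    by rewrite ltr_wpDr// divr_ge0 ?(ltW delta0)// mulr_ge0.
  exists (Num.trunc ((eps / (1 + 2 * A / delta))^-1)).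
  rewrite -ltr_pdivlMr// /eta invf_plt ?posrE ?divr_gt0//.
  exact: truncnS_gt.
exists (b n).
pose g x := span r (b n) x + (b n i - t) * F i x.
have mg : cmeasurable g by exact: cmeasurableD.
apply: le_lt_trans (L1dist_triangle mD (g := g) _ _ _) _ => //.
have -> : L1dist D h' g = L1dist D h (span (i :: r) (b n)).
  apply: eq_integral => x _; congr ((complex.Re `| _ |)%:E).
  by rewrite /h' /g span_cons; ring.
have -> : L1dist D g (span r (b n)) = ((cmod (b n i - t))%:E * A%:E)%E.
  rewrite -AE -(L1distZ mD _ (mF i) cmeasurable0).
  apply: eq_integral => x _; congr ((complex.Re `| _ |)%:E).
  by rewrite /g; ring.
apply: lt_le_trans (_ : (eta n)%:E + (2 * (eta n / delta) * A)%:E <= _)%E.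
  rewrite lte_leD// ?lee_fin ?ler_wpM2r//.
rewrite -EFinD lee_fin; apply: le_trans (ltW Hn).
by rewrite le_eqVlt; apply/orP; left; apply/eqP; ring.
Qed.

End closed_span.

(** * Nested affine subspaces of a countable product *)

Section nested_affine.
Context {K : fieldType} {I : choiceType}.
Variables (C : set I) (S : nat -> set (I -> K)).
Hypothesis C_countable : countable C.
Hypothesis S_neq0 : forall n, S n !=set0.
Hypothesis S_decr : forall n m, (n <= m)%N -> S m `<=` S n.
Hypothesis S_affine : forall n b b' t, S n b -> S n b' ->
  S n (fun i => (1 - t) * b i + t * b' i).
Hypothesis S_local : forall n, exists A : set I,
  [/\ finite_set A, A `<=` C &
   forall b b', S n b -> (forall i, A i -> b i = b' i) -> S n b'].

(** A nested sequence of nonempty affine subspaces of a countable product, each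
    of which constrains finitely many coordinates, has a common point. Fix the
    coordinates one at a time: the values that a coordinate takes on the members
    of the sequence form a decreasing sequence of affine subspaces of the line,
    each one a point or the whole line. *)
Lemma nested_affine_subspaces : exists b, forall n, S n b.
Proof.
move: C_countable => /pfcard_geP[C0|[e]].
  have [b Sb] := S_neq0 0; exists b => n.
  have [A [_ AC H]] := S_local n; have [b' Sb'] := S_neq0 n.
  by apply: H Sb' _ => i /AC; rewrite C0.
(* s prescribes the values at the first coordinates of the enumeration e; as e
   need not be injective, a coordinate may be prescribed several times. *)
pose extends (s : seq K) (b : I -> K) := forall j, (j < size s)%N -> b (e j) = nth 0 s j.
pose good s := forall n, exists2 b, S n b & extends s b.
have extends_rcons s t b : extends s b -> b (e (size s)) = t -> extends (rcons s t) b.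
  move=> sb bt j; rewrite size_rcons ltnS nth_rcons leq_eqVlt => /orP[/eqP ->|js].
    by rewrite ltnn eqxx.
  by rewrite js; exact: sb.
have step s : good s -> exists t, good (rcons s t).
  move=> gs; have [[n [z nz]]|nz] := pselect (exists n, exists z, forall b,
      S n b -> extends s b -> b (e (size s)) = z).
    exists z => m; have [b Sb sb] := gs (maxn n m); exists b.
      exact: S_decr (leq_maxr n m) _ Sb.
    apply: extends_rcons => //; apply: nz => //.
    exact: S_decr (leq_maxl n m) _ Sb.
  (* Each S n now takes two values at the new coordinate, hence all of them. *)
  exists 0 => n; have [b Sb sb] := gs n.
  have [b' [Sb' sb' bb']] : exists b', [/\ S n b', extends s b' &
      b' (e (size s)) <> b (e (size s))].
    apply: contra_notP nz => H; exists n, (b (e (size s))) => b' Sb' sb'.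
    by apply: contra_notP H => H; exists b'.
  set y := b (e (size s)) in bb'; set z := b' (e (size s)) in bb'.
  have yz : y - z != 0 by rewrite subr_eq0 eq_sym; exact/eqP.
  exists (fun i => (1 - y / (y - z)) * b i + y / (y - z) * b' i).
    exact: S_affine.
  apply: extends_rcons => [j js|]; first by rewrite sb// sb'//; ring.
  by rewrite -/y -/z; field.
have [F [F0 FS]] : {F : nat -> seq K | F 0%N = [::] /\
    forall k, good (F k) -> exists2 t, F k.+1 = rcons (F k) t & good (F k.+1)}.
  apply: (@dependent_choice _ (fun s s' => good s -> exists2 t, s' = rcons s t & good s')).
  move=> s; apply: cid; have [/step[t gt]|] := pselect (good s); last by exists s.
  by exists (rcons s t) => _; exists t.
have gF k : good (F k).
  elim: k => [|k /FS[]//]; rewrite F0 => n.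
  by have [b Sb] := S_neq0 n; exists b.
have sF k : size (F k) = k.
  by elim: k => [|k IH]; [rewrite F0|have [t -> _] := FS _ (gF k); rewrite size_rcons IH].
pose beta j := nth 0 (F j.+1) j.
have betaE k j : (j < k)%N -> nth 0 (F k) j = beta j.
  elim: k => // k IH; rewrite ltnS leq_eqVlt => /orP[/eqP ->//|jk].
  by have [t -> _] := FS _ (gF k); rewrite nth_rcons sF jk IH.
have [idx idxE] : exists idx : I -> nat, forall i, C i -> e (idx i) = i.
  have H i : exists j, C i -> e j = i.
    have [Ci|] := pselect (C i); last by exists 0%N.
    by have [j _ je] := @surj _ _ _ _ e i Ci; exists j.
  by exists (fun i => projT1 (cid (H i))) => i; case: cid.
exists (beta \o idx) => n; have [A [finA AC H]] := S_local n.
pose M := \max_(i <- finmap.enum_fset (fset_set A)) idx i.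
have [b Sb sb] := gF M.+1 n; apply: H Sb _ => i Ai /=.
have iM : (idx i < M.+1)%N.
  by rewrite ltnS; apply: leq_bigmax_seq => //; rewrite in_fset_set// inE.
rewrite -[in LHS](idxE i (AC _ Ai)) sb ?sF//; exact: betaE.
Qed.
End nested_affine.

(** * Elements of the translate space are series of translates *)

Section locally_integrable_translates.
Context {R : realType} {d : nat}.
Local Notation lam := (lebesgue_cV d : {sigma_finite_measure set 'cV[R]_d -> \bar R}).
Implicit Types (f : 'cV[R]_d -> R[i]) (u : affine R d).

Lemma integral_affine_fin u (g : 'cV[R]_d -> \bar R) : u.2 \in unitmx ->
  measurable_fun setT g -> (forall x, 0 <= g x)%E ->
  (\int[lam]_x g x < +oo)%E -> (\int[lam]_x g (aff_act u x) < +oo)%E.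
Proof.
move=> uu mg g0 gfin; have [c c0 Hc] := lebesgue_affine uu.
have := @ge0_integral_pushforward _ _ _ _ _ _
  (measurable_affine u) lam setT g measurableT mg (fun y _ => g0 y).
rewrite preimage_setT /comp => <-.
pose k := NngNum (ltW c0).
rewrite (@eq_measure_integral _ _ _ setT (mscale k lam) (aff_pushforward lam u)).
  rewrite ge0_integral_mscale//; exact: lte_mul_pinfty.
by move=> A mA _; rewrite /= /pushforward /mscale /=; exact: Hc.
Qed.

Lemma L1dist_translate_fin f u (D : set 'cV[R]_d) : measurable D -> integrableC f ->
  u.2 \in unitmx -> (L1dist D (fun x => f (aff_act u x)) (fun=> 0%R) < +oo)%E.
Proof.
move=> mD int_f uu; have mf := integrableC_measurable int_f.
have mc : measurable_fun setT (fun x => (cmod (f x))%:E).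
  by apply/measurable_EFinP; exact: measurable_cmod.
apply: le_lt_trans (_ : (\int[lam]_x (cmod (f (aff_act u x)))%:E < +oo)%E).
  rewrite L1distE; under eq_integral do rewrite subr0.
  apply: ge0_subset_integral => //.
    apply/measurable_EFinP; apply: measurable_cmod; exact: cmeasurable_affine.
  by move=> x _; rewrite lee_fin cmod_ge0.
apply: (integral_affine_fin (g := fun x => (cmod (f x))%:E)) => //.
  by move=> x; rewrite lee_fin cmod_ge0.
case: int_f => /integrableP[mr ir] /integrableP[mi ii].
apply: le_lt_trans (lte_add_pinfty ir ii).
rewrite -ge0_integralD//; [|exact: measurableT_comp..].
apply: ge0_le_integral => //.
- by move=> x _; rewrite lee_fin cmod_ge0.
- by apply: emeasurable_funD; exact: measurableT_comp.
move=> x _; rewrite /= -EFinD lee_fin [f x in leLHS]complexE.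
apply: le_trans (cmodD _ _) _; rewrite cmodM !cmod_real (_ : cmod 'i%C = 1) ?mul1r//.
by rewrite /cmod normc_def /= expr0n expr1n add0r sqrtr1.
Qed.

End locally_integrable_translates.

Section translate_space_series.
Context {R : realType} {d : nat}.
Local Notation lam := (lebesgue_cV d : {sigma_finite_measure set 'cV[R]_d -> \bar R}).
Variables (Gamma : set (affine R d)) (G : set 'M[R]_d) (Lambda : set 'cV[R]_d).
Hypothesis crystal : splitting_crystal_triple Gamma G Lambda.
Variables (f : 'cV[R]_d -> R[i]) (n0 : nat).
Hypothesis f_supp : forall x, f x != 0 -> cube n0%:R x.
Hypothesis int_f : integrableC f.
Let mf := integrableC_measurable int_f.
Local Notation T := (tsum Gamma f).

Let D (n : nat) : set 'cV[R]_d := [set x | forall i, `|x i 0| <= n%:R].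

Let D_cube n : D n `<=` cube n.+1%:R.
Proof. by move=> x Dx i; rewrite (le_lt_trans (Dx i))// ltr_nat. Qed.

Let mD n : measurable (D n).
Proof. by apply: compact_measurable_cV; exact: closed_cube_compact. Qed.

Let act n := active_seq Gamma n0 n.+1.

(* On a cube only finitely many translates matter, and their span is closed. *)
Let local_series h n : cmeasurable h -> translate_space Gamma f h ->
  exists b, {ae lam, forall x, D n x -> h x = T b x}.
Proof.
move=> mh hf.
pose F u x := if `[< Gamma u >] then f (aff_act u x) else 0.
have mF u : cmeasurable (F u).
  by rewrite /F; case: asboolP => _; [exact: cmeasurable_affine|exact: cmeasurable0].
have F_fin u : (L1dist (D n) (F u) (fun=> 0%R) < +oo)%E.
  rewrite /F; case: asboolP => [Gu|_].
    exact: (L1dist_translate_fin (@mD n) int_f (crystal_unit crystal Gu)).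
  rewrite L1distE; under eq_integral do rewrite subr0 cmod0.
  by rewrite integral0.
have FE x b : D n x -> \sum_(u <- act n) b u * F u x = T b x.
  move=> /D_cube xn; rewrite (tsum_local crystal f_supp _ xn) big_seq [RHS]big_seq.
  apply: eq_bigr => u /(mem_active crystal) Gu; rewrite /F.
  by case: asboolP.
have [||eps eps0|b Hb] := closed_span (@mD n) mF F_fin (r := act n) (h := h).
- exact: finmap.fset_uniq.
- exact: mh.
- have [A [b [finA AG Hb]]] := hf (D n) (@closed_cube_compact R d n%:R) _ eps0.
  exists (fun u => if `[< A u >] then b u else 0); apply: le_lt_trans Hb.
  rewrite le_eqVlt; apply/orP; left; apply/eqP; apply: eq_integral => x.
  rewrite inE => Dx; rewrite FE// /tsum (fsbig_supported finA AG); last first.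
    by move=> u _ nAu; case: asboolP => // _; rewrite mul0r.
  congr ((complex.Re `| _ - _ |)%:E); rewrite fsbig_finite//= big_seq [RHS]big_seq.
  apply: eq_bigr => u; rewrite in_fset_set// inE => Au.
  by case: asboolP.
by exists b; apply: filterS Hb => x Hx Dx; rewrite Hx// FE.
Qed.

(** Membership in the closure of the combinations of finitely many translates
    amounts to being a possibly infinite combination of translates: the latter
    are locally finite sums. *)
Lemma translate_space_series h : cmeasurable h -> translate_space Gamma f h ->
  exists b, {ae lam, forall x, h x = T b x}.
Proof.
move=> mh hf.
pose S n := [set b : affine R d -> R[i] | {ae lam, forall x, D n x -> h x = T b x}].
have [||||b Hb] := @nested_affine_subspaces _ _ Gamma S (crystal_countable crystal).
- by move=> n; exact: local_series.
- move=> n m nm b; apply: filterS => x Hx Dx; apply: Hx => i.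
  by rewrite (le_trans (Dx i))// ler_nat.
- move=> n b b' t; apply: filterS2 => x Hx Hx' Dx.
  have {Hx}Hx := Hx Dx; have {Hx'}Hx' := Hx' Dx.
  rewrite (_ : (fun _ => _) = fun u => (1 - t) * b u - (- t) * b' u); last first.
    by apply/funext => u; ring.
  rewrite (tsumB crystal f_supp (fun u => (1 - t) * b u) (fun u => - t * b' u)) !tsumZ.
  by rewrite -Hx -Hx'; ring.
- move=> n; exists (active Gamma n0 n.+1); split.
  + exact: (active_finite crystal).
  + by move=> u [].
  + move=> b b' Hb bb'; apply: filterS Hb => x Hx Dx; rewrite Hx//.
    rewrite !(tsum_local crystal f_supp _ (D_cube Dx)) big_seq [RHS]big_seq.
    apply: eq_bigr => u; rewrite /active_seq in_fset_set ?inE => [au|].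
      by rewrite bb'.
    exact: (active_finite crystal).
exists b; have := ae_foralln Hb; apply: filterS => x Hx.
have [n _ xn] : (\bigcup_n cube n%:R) x by rewrite cube_cover.
by apply: (Hx n) => i; rewrite ltW.
Qed.

End translate_space_series.

(** * Accuracy implies condition (II) *)

Section polynomials_in_translate_space.
Context {R : realType} {d : nat}.
Implicit Types (Gamma : set (affine R d)) (f : 'cV[R]_d -> R[i]).

Lemma poly_funX (m : mpoly.multinom d) (x : 'cV[R]_d) :
  poly_fun (mpoly.mpolyX R[i] m) x = (monom m x)%:C%C.
Proof.
rewrite /poly_fun mpoly.mevalX /monom rmorph_prod.
by apply: eq_bigr => i _; rewrite rmorphXn.
Qed.

Lemma accuracy_monom Gamma f p (m : mpoly.multinom d) :
  (p%:R%:E <= accuracy Gamma f)%E -> (mpoly.mdeg m < p)%N ->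
  translate_space Gamma f (fun x => (monom m x)%:C%C).
Proof.
case: p => // p pacc mp.
have /ereal_sup_gt[_ [n Hn <-]] : (p%:R%:E < accuracy Gamma f)%E.
  by apply: lt_le_trans pacc; rewrite lte_fin ltr_nat.
rewrite lte_fin ltr_nat => pn.
have := Hn (mpoly.mpolyX R[i] m); rewrite mpoly.msizeX => /(_ (leq_trans mp pn)).
by rewrite (_ : poly_fun _ = fun x => (monom m x)%:C%C)//; apply/funext => x; exact: poly_funX.
Qed.

End polynomials_in_translate_space.

Section necessity.
Context {R : realType} {d : nat}.
Local Notation lam := (lebesgue_cV d : {sigma_finite_measure set 'cV[R]_d -> \bar R}).
Local Notation nb := (nb_index d).
Variables (Gamma : set (affine R d)) (G : set 'M[R]_d) (Lambda : set 'cV[R]_d).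
Hypothesis crystal : splitting_crystal_triple Gamma G Lambda.
Variables (e : nat -> 'cV[R]_d) (U : set 'cV[R]_d).
Hypothesis tl : lattice_tiling Lambda e U.
Variables (f : 'cV[R]_d -> R[i]) (n0 : nat).
Hypothesis f_supp : forall x, f x != 0 -> cube n0%:R x.
Hypothesis int_f : integrableC f.
Variable a : 'M[R]_d.
Hypothesis adm_a : admissible Gamma a.
Variables (Gamma' : set (affine R d)) (c : affine R d -> R[i]) (p : nat).
Hypothesis fin_Gamma' : finite_set Gamma'.
Hypothesis sub_Gamma' : Gamma' `<=` Gamma.
Hypothesis c0 : forall u, ~ Gamma' u -> c u = 0.
Hypothesis ref_f : refinable Gamma' c a f.
Hypothesis p0 : (0 < p)%N.
Hypothesis ind_f : independent_translates Gamma f.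
Hypothesis acc_f : (p%:R%:E <= accuracy Gamma f)%E.
Local Notation T := (tsum Gamma f).

Let au : a \in unitmx := admissible_unit adm_a.

Let tsum_inj b b' : {ae lam, forall x, T b x = T b' x} ->
  forall u, Gamma u -> b u = b' u.
Proof.
move=> bb' u Gu; apply/subr0_eq.
have [+ _] := ind_f (fun u => b u - b' u); apply => //.
by apply: filterS bb' => x Hx; rewrite -/(T _ x) (tsumB crystal f_supp) Hx subrr.
Qed.

Section series_coefficients.
Variable z : mpoly.multinom d -> affine R d -> R[i].
Hypothesis zE : forall m : mpoly.multinom d, (mpoly.mdeg m < p)%N ->
  {ae lam, forall x, (monom m x)%:C%C = T (z m) x}.

Let v m := z m (@aff1 R d).
Let Z s u : 'cV[R[i]]_(nb s) := \col_k z (index_val k) u.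

Let ae_monomials : {ae lam, forall x, forall s, (s < p)%N ->
  toC (monomials s x) = \col_k T (fun u => Z s u k 0) x}.
Proof.
apply: ae_countable => [|s sp]; first exact: countableP.
have H : {ae lam, forall x, forall k : 'I_(nb s), [set: 'I_(nb s)] k ->
    (monom (index_val k) x)%:C%C = T (z (index_val k)) x}.
  apply: ae_countable => [|k _]; first exact: countableP.
  by apply: zE; rewrite mdeg_index_val.
apply: filterS H => x Hx; apply/colP => k; rewrite [LHS]mxE monomialsE [RHS]mxE (Hx k)//.
by apply: eq_tsum => u _; rewrite mxE.
Qed.

(* Two expansions of X_[s](w^-1 x) in translates: act by w^-1 on the expansion of
   X_[s], or combine the expansions of the X_[t]. Compare them at the identity. *)
Let Z_ysub s w : (s < p)%N -> Gamma w -> Z s w = ysub v s w.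
Proof.
move=> sp Gw; have Gw' := crystalV crystal Gw; have wu := crystal_unit crystal Gw.
apply/colP => k; pose b u : R[i] := Z s (aff_mul u w) k 0.
pose b' u : R[i] := \sum_(t < s.+1) \sum_l toC (shift_mx_iso s t w) k l * Z t u l 0.
have bb' : {ae lam, forall x, T b x = T b' x}.
  have := ae_affine (crystal_unit crystal Gw') ae_monomials.
  apply: filterS2 ae_monomials => x Hx Hwx.
  have := Hwx s sp; rewrite shift_mx_isoE /toC raddf_sum => /colP/(_ k).
  rewrite [RHS]mxE (tsum_act crystal)// summxE => H.
  transitivity (T (fun u => Z s (aff_mul u (aff_inv (aff_inv w))) k 0) x).
    by apply: eq_tsum => u _; rewrite /b aff_invK.
  rewrite -H (tsum_sum crystal f_supp); apply: eq_bigr => t _.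
  have tp : (t < p)%N by rewrite (leq_trans _ sp)// ltnS -ltnS.
  rewrite (tsum_sum crystal f_supp). rewrite /= map_mxM mxE; apply: eq_bigr => l _.
  by rewrite tsumZ; congr (_ * _); have /colP/(_ l) := Hx t tp; rewrite [RHS]mxE => <-.
have := tsum_inj bb' (crystal1 crystal); rewrite /b /b' aff_mul1 => ->.
rewrite /ysub summxE; apply: eq_bigr => t _; rewrite [RHS]mxE.
by apply: eq_bigr => l _; congr (_ * _); rewrite !mxE.
Qed.

(* Two expansions of X_[s](a x): substitute a x, or multiply by a_[s] and refine. *)
Let Z_refine s w : (s < p)%N -> Gamma w ->
  Z s w = toC (sym_mx s a) *m \col_l refine_coef Gamma a c (fun u => Z s u l 0) w.
Proof.
move=> sp Gw; apply/colP => k.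
pose b' w : R[i] := \sum_l toC (sym_mx s a) k l * refine_coef Gamma a c (fun u => Z s u l 0) w.
have bb' : {ae lam, forall x, T (fun u => Z s u k 0) (a *m x) = T b' (a *m x)}.
  have H : {ae lam, forall x, forall l : 'I_(nb s), [set: 'I_(nb s)] l ->
      T (fun u => Z s u l 0) x =
      T (refine_coef Gamma a c (fun u => Z s u l 0)) (a *m x)}.
    apply: ae_countable => [|l _]; first exact: countableP.
    exact: (tsum_refine crystal f_supp adm_a fin_Gamma' sub_Gamma' c0 ref_f).
  have := ae_expr adm_a 1 ae_monomials; rewrite expr1 => H'.
  apply: filterS3 H ae_monomials H' => x Hx Mx Max.
  have := Max s sp; rewrite sym_mxE /toC map_mxM => /colP/(_ k).
  rewrite [RHS]mxE => <-; rewrite mxE (tsum_sum crystal f_supp).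
  apply: eq_bigr => l _; rewrite tsumZ -Hx//; congr (_ * _).
  by have /colP/(_ l) := Mx s sp; rewrite [RHS]mxE => <-.
have {}bb' : {ae lam, forall x, T (fun u => Z s u k 0) x = T b' x}.
  have := ae_affine (u := (0, invmx a)) _ bb'; rewrite unitmx_inv => /(_ au).
  by apply: filterS => x; rewrite /aff_act addr0 mulKVmx.
rewrite (tsum_inj bb' Gw) mxE; apply: eq_bigr => l _.
by congr (_ * _); rewrite mxE.
Qed.

(* Integrate 1 = v_0 T 1 over the tile. *)
Let v0_neq0 : v (@mpoly.mnm0 d) * integralC f <> 0.
Proof.
have [k0 _] := index_val_surj (@mpoly.mdeg0 d).
have T1 : {ae lam, forall x, 1 = v (@mpoly.mnm0 d) * T (fun=> 1) x}.
  apply: filterS ae_monomials => x /(_ 0%N p0)/colP/(_ k0).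
  rewrite monomials0 !mxE rmorph1 => Tx; rewrite [LHS]Tx -tsumZ; apply: eq_tsum => u Gu.
  by rewrite Z_ysub// ysub0 mulr1.
have v0 : v (@mpoly.mnm0 d) != 0.
  have [x] := ae_exists T1.
  by apply: contra_eq_neq => ->; rewrite mul0r oner_eq0.
have T1' : {ae lam, forall x, T (fun=> 1) x = (v (@mpoly.mnm0 d))^-1}.
  by apply: filterS T1 => x H; rewrite -[LHS](mulKf v0) -H mulr1.
have := tsum1_integral crystal tl f_supp int_f T1'.
move=> H; apply/eqP; rewrite mulf_neq0//; apply/eqP => f0.
move: H; rewrite f0 mulr0 => /eqP; rewrite mulf_eq0 invr_eq0 (negPf v0) /=.
rewrite (_ : 0 = 0%:C%C)// (inj_eq (@complexI R)) gt_eqF// fine_gt0//.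
by rewrite (lebesgue_tile_gt0 tl) (lebesgue_tile_fin tl).
Qed.

Lemma conditionII_coefficients : conditionII Gamma c a f p v.
Proof.
split; first exact: v0_neq0.
move=> s sp w Gw; rewrite -Z_ysub// (Z_refine sp Gw); congr (_ *m _).
apply/colP => l; rewrite mxE (row_mulE crystal adm_a fin_Gamma' c0)//.
by apply: eq_fsbigr => u; rewrite inE => Gu; rewrite Z_ysub.
Qed.

End series_coefficients.

Theorem accuracy_conditionII : exists v, conditionII Gamma c a f p v.
Proof.
have /choice[z Hz] (m : mpoly.multinom d) : exists b, (mpoly.mdeg m < p)%N ->
    {ae lam, forall x, (monom m x)%:C%C = T b x}.
  have [mp|] := boolP (mpoly.mdeg m < p)%N; last by exists (fun=> 0).
  have mm := cmeasurable_real (@measurable_monom R d m).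
  have [b Hb] := translate_space_series crystal f_supp int_f mm (accuracy_monom acc_f mp).
  by exists b.
by exists (fun m => z m (@aff1 R d)); exact: conditionII_coefficients Hz.
Qed.

End necessity.

(** * Condition (II) implies accuracy *)

Section sufficiency.
Context {R : realType} {d : nat}.
Local Notation lam := (lebesgue_cV d : {sigma_finite_measure set 'cV[R]_d -> \bar R}).
Local Notation nb := (nb_index d).
Variables (Gamma : set (affine R d)) (G : set 'M[R]_d) (Lambda : set 'cV[R]_d).
Hypothesis crystal : splitting_crystal_triple Gamma G Lambda.
Variables (f : 'cV[R]_d -> R[i]) (n0 : nat).
Hypothesis f_supp : forall x, f x != 0 -> cube n0%:R x.
Hypothesis int_f : integrableC f.
Let mf := integrableC_measurable int_f.
Local Notation T := (tsum Gamma f).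

(** A series of translates is a finite sum on each compact set. *)
Lemma series_translate_space h b : cmeasurable h ->
  {ae lam, forall x, h x = T b x} -> translate_space Gamma f h.
Proof.
move=> mh hT K cK eps eps0; have [n _ Kn] := compact_cube cK.
have finA := active_finite crystal n0 n.
exists (active Gamma n0 n), b; split => //; first by move=> u [].
have mK := compact_measurable_cV cK.
pose g x := \sum_(u \in active Gamma n0 n) b u * f (aff_act u x).
have gE : g = fun x => \sum_(u <- active_seq Gamma n0 n) b u * f (aff_act u x).
  by apply/funext => x; rewrite /g fsbig_finite.
have mg : cmeasurable g.
  rewrite gE; apply: cmeasurable_sum => u; apply: cmeasurableM.
  exact: cmeasurable_affine.
rewrite (_ : L1dist _ _ _ = 0%E) ?lte_fin//.
rewrite -/g (ae_eq_L1dist mK mh mg (@cmeasurable0 R d) (@cmeasurable0 R d)).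
  by rewrite L1distE; under eq_integral do rewrite subrr cmod0; rewrite integral0.
apply: filterS hT => x -> /Kn xn.
by rewrite gE -(tsum_local crystal f_supp _ xn) !subrr.
Qed.

Section monomial_series.
Variables (v : mpoly.multinom d -> R[i]) (K : R[i]) (p : nat).
Hypothesis K0 : K != 0.
Hypothesis gvecE : forall s, (s < p)%N ->
  {ae lam, forall x, gvec Gamma f v s x = K *: toC (monomials s x)}.

Lemma monom_series (m : mpoly.multinom d) : (mpoly.mdeg m < p)%N ->
  exists b, {ae lam, forall x, (monom m x)%:C%C = T b x}.
Proof.
move=> mp; have [k mk] := index_val_surj (erefl (mpoly.mdeg m)).
exists (fun u => K^-1 * ysub v (mpoly.mdeg m) u k 0).
apply: filterS (gvecE mp) => x /colP/(_ k) Hx; rewrite tsumZ.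
have {}Hx : T (fun u => ysub v (mpoly.mdeg m) u k 0) x = K * (monom m x)%:C%C.
  by move: Hx; rewrite mxE => ->; rewrite [LHS]mxE; congr (_ * _); rewrite mxE monomialsE -mk.
by rewrite Hx mulKf.
Qed.

Lemma poly_fun_series (q : mpoly.mpoly d R[i]) : (mpoly.mmeasure mpoly.mdeg q <= p)%N ->
  exists b, {ae lam, forall x, poly_fun q x = T b x}.
Proof.
move=> qp.
have /choice[z Hz] (m : mpoly.multinom d) : exists b, (mpoly.mdeg m < p)%N ->
    {ae lam, forall x, (monom m x)%:C%C = T b x}.
  have [/monom_series[b Hb]|] := boolP (mpoly.mdeg m < p)%N; last by exists (fun=> 0).
  by exists b.
exists (fun u => \sum_(m <- mpoly.msupp q) mpoly.mcoeff m q * z m u).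
have H : {ae lam, forall x, forall m, [set` mpoly.msupp q] m -> (monom m x)%:C%C = T (z m) x}.
  apply: ae_countable => [|m mq]; first by apply: finite_set_countable; exact: finite_seq.
  by apply: Hz; apply: leq_trans qp; exact: mpoly.msize_mdeg_lt.
apply: filterS H => x Hx; rewrite /poly_fun mpoly.mevalE (tsum_sum crystal f_supp).
rewrite big_seq [RHS]big_seq; apply: eq_bigr => m mq.
rewrite tsumZ -Hx//; congr (_ * _); rewrite /monom rmorph_prod.
by apply: eq_bigr => i _; rewrite rmorphXn.
Qed.

Lemma cmeasurable_poly_fun (q : mpoly.mpoly d R[i]) : cmeasurable (poly_fun q : 'cV[R]_d -> R[i]).
Proof.
rewrite (_ : poly_fun q = fun x => \sum_(m <- mpoly.msupp q) mpoly.mcoeff m q * (monom m x)%:C%C).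
  apply: cmeasurable_sum => m; apply: cmeasurableM; apply: cmeasurable_real.
  exact: measurable_monom.
apply/funext => x; rewrite /poly_fun mpoly.mevalE; apply: eq_bigr => m _.
by rewrite -poly_funX /poly_fun mpoly.mevalX.
Qed.

Lemma accuracy_ge : (p%:R%:E <= accuracy Gamma f)%E.
Proof.
apply: ereal_sup_ubound; exists p => //= q qp.
have [b Hb] := poly_fun_series qp.
exact: series_translate_space (cmeasurable_poly_fun q) Hb.
Qed.

End monomial_series.
End sufficiency.

(** * Volume of a fundamental domain *)

Section fundamental_domain_volume.
Context {R : realType} {d : nat}.
Local Notation lam := (lebesgue_cV d : {sigma_finite_measure set 'cV[R]_d -> \bar R}).
Variables (Gamma : set (affine R d)) (G : set 'M[R]_d) (Lambda : set 'cV[R]_d).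
Hypothesis crystal : splitting_crystal_triple Gamma G Lambda.
Variables (e : nat -> 'cV[R]_d) (U : set 'cV[R]_d).
Hypothesis tl : lattice_tiling Lambda e U.
Variable P : set 'cV[R]_d.
Hypothesis fundP : fundamental_domain Gamma P.
Hypothesis boundaryP : lam (P `\` P°) = 0%E.

Let closedP : closed P. Proof. by case: fundP. Qed.
Let mP : measurable P. Proof. exact: closed_measurable_cV. Qed.

(** Almost every point has exactly one image in P under the group, so that
    P meets each orbit in as many points, up to null sets, as U does divided by
    the order of the point group. *)
Lemma tile_volume : fine (lam U) = (point_order G)%:R * fine (lam P).
Proof.
case: (fundP) => bP _ coverP disjP.
have [n1 _ Pn1] := bounded_cube bP.
have [m Um] := tiling_bounded tl.
have mU := tiling_measurable tl.
have mi : measurable_fun setT (\1_P : 'cV[R]_d -> R) by exact: measurable_indic.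
have i0 x : 0 <= (\1_P x : R) by rewrite indicE ler0n.
have i_supp x : (\1_P x : R) != 0 -> cube n1%:R x.
  rewrite indicE; have [|] := boolP (x \in P); last by rewrite eqxx.
  by rewrite inE => /Pn1.
have := integral_periodization crystal tl Um i_supp i0 mi.
rewrite integral_indic// setIT => H.
have PE : lam P = (fine (lam P))%:E.
  rewrite fineK// ge0_fin_numE//; apply: (@le_lt_trans _ _ (lam (cube n1%:R))); last exact: lebesgue_cube_fin.
  by apply: le_measure => //; rewrite inE//; exact: measurable_cube.
suff UE : lam U = ((point_order G)%:R%:E * lam P)%E by rewrite UE PE -EFinM.
rewrite -H -[LHS]mul1e -integral_cst//; apply: ge0_ae_eq_integral => //.
- apply/measurable_EFinP; apply: measurable_funTS; apply: measurable_sum => u.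
  by apply: (measurableT_comp mi); exact: measurable_affine.
- by move=> x _; rewrite lee_fin sumr_ge0.
have aeP : {ae lam, forall x, ~ (P `\` P°) x}.
  exists (P `\` P°); split => //; last by move=> x /= /contrapT.
  by apply: measurableD => //; exact: open_measurable_cV (open_interior _).
have {}aeP : {ae lam, forall x, forall u, Gamma u -> ~ (P `\` P°) (aff_act u x)}.
  apply: ae_countable => [|u Gu]; first exact: crystal_countable crystal.
  exact: ae_affine (crystal_unit crystal Gu) aeP.
apply: filterS aeP => x Hx Ux; congr EFin.
have intP u : Gamma u -> P (aff_act u x) -> P° (aff_act u x).
  by move=> Gu Pu; apply: contrapT => nP; apply: (Hx u Gu).
have [w Gw [y Py wy]] : (\bigcup_(u in Gamma) (aff_act u @` P)) x by rewrite coverP.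
have Gw' := crystalV crystal Gw; have wu := crystal_unit crystal Gw.
have Pw' : P (aff_act (aff_inv w) x) by rewrite -wy aff_actK.
have Aw' : aff_inv w \in active_seq Gamma n1 m.
  rewrite /active_seq in_fset_set ?inE; last exact: active_finite crystal _ _.
  by split => //; exists x; [exact: Um|exact: Pn1].
rewrite (bigD1_seq (aff_inv w))//=; last exact: finmap.fset_uniq.
rewrite big_seq_cond big1 ?addr0 => [|u /andP[/(mem_active crystal) Gu uw]].
  by rewrite indicE mem_set.
rewrite indicE memNset// => Pu; case/negP: uw; apply/eqP.
have Gu' := crystalV crystal Gu; have uu := crystal_unit crystal Gu.
have : aff_inv u = w.
  apply: disjP => //; exists x; split.
    by exists (aff_act u x); [exact: intP|rewrite aff_actK].
  by exists (aff_act (aff_inv w) x); [exact: intP|rewrite aff_actVK].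
by move=> <-; rewrite aff_invK.
Qed.

End fundamental_domain_volume.

(** * Accuracy and condition (II) *)

Theorem theorem3p3 (R : realType) (d : nat) (d_gt0 : (0 < d)%N)
    (Gamma : set (affine R d)) (G : set 'M[R]_d) (Lambda : set 'cV[R]_d)
    (crystal : splitting_crystal_triple Gamma G Lambda)
    (P : set 'cV[R]_d) (fundP : fundamental_domain Gamma P)
    (a : 'M[R]_d) (adm_a : admissible Gamma a)
    (p : nat) (p_gt0 : (0 < p)%N)
    (f : 'cV[R]_d -> R[i]) (int_f : integrableC f)
    (supp_f : compactly_supported f)
    (Gamma' : set (affine R d)) (fin_Gamma' : finite_set Gamma')
    (sub_Gamma' : Gamma' `<=` Gamma)
    (c : affine R d -> R[i]) (c0 : forall u, ~ Gamma' u -> c u = 0)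
    (ref_f : refinable Gamma' c a f) :
  (independent_translates Gamma f ->
    (p%:R%:E <= accuracy Gamma f)%E ->
    exists v : mpoly.multinom d -> R[i], conditionII Gamma c a f p v) /\
  ((exists v : mpoly.multinom d -> R[i], conditionII Gamma c a f p v) ->
    (p%:R%:E <= accuracy Gamma f)%E) /\
  (lebesgue_cV d (P `\` P°) = 0%E ->
    forall v : mpoly.multinom d -> R[i], conditionII Gamma c a f p v ->
    let C := (v (@mpoly.mnm0 d) * integralC f)^-1 *
             (fine (lebesgue_cV d P))%:C%C in
    forall s : nat, (s < p)%N ->
      {ae lebesgue_cV d, forall x : 'cV[R]_d,
        toC (monomials s x) =
        \sum_(u \in Gamma) f (aff_act u x) *: ysub (fun m => C * v m) s u}).
Proof.
have [n0 _ f_cube] := compact_cube supp_f.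
have f_supp x : f x != 0 -> cube n0%:R x by move=> fx; apply/f_cube/subset_closure.
have [e [U tl]] := lattice_tiling_exists crystal d_gt0.
have U_neq0 : (fine (lebesgue_cV d U))%:C%C != 0 :> R[i].
  rewrite (_ : 0 = 0%:C%C)// (inj_eq (@complexI R)) gt_eqF// fine_gt0//.
  by rewrite (lebesgue_tile_gt0 tl) (lebesgue_tile_fin tl).
have N_neq0 : (point_order G)%:R != 0 :> R[i].
  by rewrite pnatr_eq0 -lt0n (point_order_gt0 crystal).
split; [|split].
- move=> ind_f acc_f.
  exact: (accuracy_conditionII crystal tl f_supp int_f adm_a fin_Gamma' sub_Gamma' c0 ref_f
    p_gt0 ind_f acc_f).
- move=> [v condII].
  have [K [KU gvecE]] := gvec_monomials crystal tl f_supp int_f adm_a fin_Gamma'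
    sub_Gamma' c0 ref_f condII p_gt0.
  apply: (accuracy_ge crystal f_supp int_f _ gvecE).
  case: condII => /eqP v0f _; apply/eqP => K0; move: KU v0f.
  by rewrite K0 mul0r mulrCA => /esym/eqP; rewrite mulf_eq0 (negPf N_neq0) /= => ->.
- move=> boundaryP v condII C s sp.
  have [K [KU gvecE]] := gvec_monomials crystal tl f_supp int_f adm_a fin_Gamma'
    sub_Gamma' c0 ref_f condII p_gt0.
  have CK : C * K = 1.
    case: condII => /eqP v0f _.
    move: KU; rewrite (tile_volume crystal tl fundP boundaryP) rmorphM rmorph_nat.
    rewrite !(mulrCA _ (point_order G)%:R) => /(mulfI N_neq0) KP.
    by rewrite /C -mulrA [_ * K]mulrC KP mulVf.
  apply: filterS (gvecE s sp) => x Hx.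
  have [n _ xn] : (\bigcup_n cube n%:R) x by rewrite cube_cover.
  rewrite (active_sum crystal f_supp xn) => [|u ->]; last exact: scale0r.
  rewrite -[LHS]scale1r -CK -scalerA -Hx; apply/colP => k.
  rewrite !mxE summxE (tsum_local crystal f_supp _ xn) mulr_sumr.
  apply: eq_bigr => u _; rewrite ysubZ [RHS]mxE mulrA mulrC; congr (_ * _).
  by rewrite mxE.
Qed.
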